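(* Let $N\ge 2$ and $D\ge 1$ be integers, and let $(\Omega_N(\mathbb R^D),d)$ be the $N$-complex of smooth covariant tensor fields on $\mathbb R^D$ of Young symmetry types $Y^N=(Y^N_p)_{p\in\mathbb N}$, with generalized cohomology spaces $H^p_{(k)}(\Omega_N(\mathbb R^D))$ as defined in the context. Then for every $k\in\{1,\dots,N-1\}$: (i) $H^{(N-1)n}_{(k)}(\Omega_N(\mathbb R^D))=0$ for every integer $n\ge 1$; (ii) $H^{0}_{(k)}(\Omega_N(\mathbb R^D))$ is the space of real polynomial functions on $\mathbb R^D$ of degree strictly less than $k$ (i.e. of degree $\le k-1$).
   Context: **Young diagrams $Y^N_p$.** For $p\in\mathbb N$ write $p=(N-1)n_p+r_p$ with integers $n_p\ge 0$ and $0\le r_p\le N-2$. $Y^N_p$ is the Young diagram with $p$ cells having $n_p$ rows of $N-1$ cells and, if $r_p\neq 0$, one last row of $r_p$ cells. Thus the rows are filled maximally with at most $N-1$ columns, and $Y^N_{p+1}$ is obtained from $Y^N_p$ by adding one cell. **Young symmetrizers.** Number the cells of $Y^N_p$ by $1,\dots,p$ row by row (left to right, top to bottom). The Young symmetrizer $\mathbf Y_p$ acts on covariant tensors of degree $p$ on $\mathbb R^D$. It is the projection $\mathbf Y_p=c_p\,\mathbf A\circ\mathbf S$, where $\mathbf S$ symmetrizes over the indices in each row, $\mathbf A$ then antisymmetrizes over the indices in each column, and $c_p\neq0$ is the normalization constant making $\mathbf Y_p^2=\mathbf Y_p$. A tensor of degree $p$ has Young symmetry type $Y^N_p$ if it lies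 in the image of $\mathbf Y_p$. This image is an irreducible representation of $GL_D$, or zero if the first column has more than $D$ cells. For $p=0$ tensors are scalars and $\mathbf Y_0$ is the identity. **Tensor fields.** $\Omega^p_N(\mathbb R^D)$ is the real vector space of smooth ($C^\infty$) covariant tensor fields of degree $p$ on $\mathbb R^D$ taking values in the tensors of Young symmetry type $Y^N_p$. In particular $\Omega^0_N(\mathbb R^D)=C^\infty(\mathbb R^D)$. Set $\Omega_N(\mathbb R^D)=\bigoplus_{p\ge0}\Omega^p_N(\mathbb R^D)$. **The operator $d$.** For a covariant tensor field $T$ of degree $p$, $\partial T$ is the covariant tensor field of degree $p+1$ whose components are the first partial derivatives of the components of $T$ in the canonical coordinates. Here the $p$ indices of $T$ are assigned to the cells $1,\dots,p$ of $Y^N_{p+1}$ (forming $Y^N_p$) and the derivative index to the added cell $p+1$. Then $$d=\mathbf Y_{p+1}\circ\partial:\Omega^p_N(\mathbb R^D)\to\Omega^{p+1}_N(\mathbb R^D).$$ One has $d^N=0$. For $N=2$ this is, up to nonzero normalization, the de Rham complex of $\mathbb R^D$. **Generalized cohomology.** For $k\in\{1,\dots,N-1\}$ and $p\ge 0$, $$H^p_{(k)}(\Omega_N(\mathbb R^D))=\frac{\ker\big(d^k:\Omega^p_N(\mathbb R^D)\to\Omega^{p+k}_N(\mathbb R^D)\big)}{d^{N-k}\big(\Omega^{p+k-N}_N(\mathbb R^D)\big)},$$ where $\Omega^{q}_N(\mathbb R^D)=0$ for $q<0$. *)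

(* Defs.v *)
From mathcomp Require Import all_boot all_order all_algebra all_fingroup.
From mathcomp Require Import all_classical all_reals all_analysis.
(* The notations of mpoly clash with those of MathComp-Analysis. *)
From mathcomp Require Import (canonicals, coercions) mpoly.
Import Order.TTheory GRing.Theory Num.Theory.
Import numFieldNormedType.Exports.

Set Implicit Arguments.
Unset Strict Implicit.
Unset Printing Implicit Defensive.

Local Open Scope classical_set_scope.
Local Open Scope ring_scope.

(* A covariant tensor of degree p on R^D is given by its components T_{f 0, ..., f (p-1)}
   in the canonical basis; the multi-indices are the finite functions f. *)
Notation multi_index D p := {ffun 'I_p -> 'I_D}.
Notation tensor R D p := {ffun multi_index D p -> R}.
Notation tensor_field R D p := ('rV[R]_D -> tensor R D p).

Section YoungSymmetrizer.
Variables (R : realType) (N D p : nat).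

(* Cells of Y^N_p are numbered from 0, row by row, with rows of N-1 cells: cell i lies in
   row i %/ (N-1) and column i %% (N-1). *)
Definition young_row (i : 'I_p) : nat := (i %/ N.-1)%N.
Definition young_col (i : 'I_p) : nat := (i %% N.-1)%N.

Definition row_stab : {set 'S_p} := [set s : 'S_p | [forall i, young_row (s i) == young_row i]].
Definition col_stab : {set 'S_p} := [set s : 'S_p | [forall i, young_col (s i) == young_col i]].

Definition permute_indices (s : 'S_p) (T : tensor R D p) : tensor R D p :=
  [ffun f : multi_index D p => T [ffun i => f (s i)]].

(* Both are unnormalized sums; the factors are absorbed in [young_norm]. *)
Definition row_sym (T : tensor R D p) : tensor R D p :=
  \sum_(s in row_stab) permute_indices s T.
Definition col_antisym (T : tensor R D p) : tensor R D p :=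
  \sum_(s in col_stab) (-1) ^+ odd_perm s *: permute_indices s T.

(* The nonzero c for which c A S is idempotent.  It always exists (inverse of the product
   of the hook lengths), so the default value 1 is never used; it is unique unless A S = 0,
   in which case its value is irrelevant. *)
Definition young_norm : R :=
  xget 1 [set c : R | c != 0 /\
    idempotent_fun (fun T : tensor R D p => c *: col_antisym (row_sym T))].

Definition young_proj (T : tensor R D p) : tensor R D p :=
  young_norm *: col_antisym (row_sym T).

Definition young_type : set (tensor R D p) := range young_proj.

End YoungSymmetrizer.

Section Smooth.
Variables (R : realType) (D : nat).

Definition partial (i : 'I_D) (f : 'rV[R]_D -> R) : 'rV[R]_D -> R :=
  fun x => 'D_(delta_mx 0 i) f x.

(* C^oo: the partial derivatives of all orders (s is a sequence of directions) exist and
   are continuous on R^D. *)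
Definition smooth (f : 'rV[R]_D -> R) : Prop :=
  forall s : seq 'I_D, let g := foldr partial f s in
    continuous g /\ forall (i : 'I_D) (x : 'rV[R]_D), derivable g x (delta_mx 0 i).

Definition poly_fun_lt (k : nat) : set ('rV[R]_D -> R) :=
  [set f : 'rV[R]_D -> R | exists2 P : mpoly.mpoly D R,
    (mpoly.msize P <= k)%N (* msize is the total degree plus 1, and 0 for P = 0 *)
    & forall x : 'rV[R]_D, f x = mpoly.meval (fun i => x 0 i) P].

End Smooth.

Section NComplex.
Variables (R : realType) (N D : nat).

Definition Omega (p : nat) : set (tensor_field R D p) :=
  [set T : tensor_field R D p |
    (forall f : multi_index D p, smooth (fun x : 'rV[R]_D => T x f)) /\
    (forall x : 'rV[R]_D, young_type N (T x))].

(* The derivative index is the last one. *)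
Definition grad (p : nat) (T : tensor_field R D p) : tensor_field R D p.+1 :=
  fun x => [ffun f : multi_index D p.+1 =>
    partial (f ord_max) (fun y => T y [ffun i => f (widen_ord (leqnSn p) i)]) x].

Definition d (p : nat) (T : tensor_field R D p) : tensor_field R D p.+1 :=
  fun x => young_proj N (grad T x).

Fixpoint diter (k p : nat) (T : tensor_field R D p) : tensor_field R D (k + p) :=
  if k is k'.+1 then d (diter k' T) else T.

Definition cocycles (k p : nat) : set (tensor_field R D p) :=
  [set T : tensor_field R D p | Omega T /\ diter k T = 0].

(* d^(N-k) (Omega^(p+k-N)); this is {0} when p + k < N, as Omega^q = 0 for q < 0. *)
Definition coboundaries (k p : nat) : set (tensor_field R D p) :=
  [set T : tensor_field R D p | T = 0 \/
    exists (q : nat) (e : (N - k + q = p)%N),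
      exists2 S : tensor_field R D q, Omega S &
        T = ecast m (tensor_field R D m) e (diter (N - k) S)].

Definition coh_class (k p : nat) (T : tensor_field R D p) : set (tensor_field R D p) :=
  [set T + B | B in @coboundaries k p].

(* The quotient H^p_(k) as the set of classes of cocycles modulo coboundaries. *)
Definition cohomology (k p : nat) : set (set (tensor_field R D p)) :=
  @coh_class k p @` @cocycles k p.

Definition scalar_field (f : 'rV[R]_D -> R) : tensor_field R D 0 :=
  fun x => [ffun=> f x].

End NComplex.

Arguments poly_fun_lt R D k : clear implicits.
Arguments cohomology R N D k p : clear implicits.

(* Main.v *)
(* Write m = N - 1. On a field T of rectangular type (degree m n) the indices added by d^k fill a
   new row, so d^k T is, up to a nonzero factor, the antisymmetrization over the columns of the
   k-fold gradient of T. In degree 0 this is the k-fold gradient itself, which vanishes exactly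
   for the polynomials of degree < k.

   In degree m n with n >= 1, let d^(l+1) T = 0 and let X be the antisymmetrized l-fold gradient
   of T. The hypothesis says that X, seen as a differential form in the indices of its column l, is
   closed; exchanging columns of equal length, it is closed in each of the columns l, ..., m - 1.
   The Poincare homotopy (contraction with the position vector, after inverting the Euler
   operators c + sum_a x_a d_a by integration along rays) applies to these columns one after the
   other: contracting the last m - l cells of a suitable l-fold antiderivative of the corrected X
   gives a field S of type Y^N in degree m n - (m - l) such that d^l d^(m-l) S is a nonzero
   multiple of d^l T. Hence d^l kills T - kappa d^(N-(l+1)) S, and one concludes by induction
   on l. Young types are handled through the Garnir relations, which characterize them, survive
   the contractions and cancel the terms where a derivative hits the position vector. *)

Require Import Defs.
From HB Require Import structures.
From mathcomp Require Import all_boot all_order all_algebra all_fingroup.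
From mathcomp Require Import all_classical all_reals all_analysis.
From mathcomp Require Import (canonicals, coercions) mpoly.
From mathcomp Require Import zify ring.
Import Order.TTheory GRing.Theory Num.Theory.
Import numFieldNormedType.Exports.

Set Implicit Arguments.
Unset Strict Implicit.
Unset Printing Implicit Defensive.

Local Open Scope classical_set_scope.
Local Open Scope ring_scope.

(** * Calculus along lines and rays *)

Section Directional.
Variables (R : realType) (V : normedModType R).
Implicit Types (f : V -> R) (x u v : V).

(** Every scalar relating the differential to plain gradients is only shown to exist and to be
    nonzero, uniformly in the field: exactness is insensitive to its value, so no hook length is
    computed. The Euler constants arise as follows: a column of n cells is a form of degree n, which
    contributes n, and each derivative along a cell contracted earlier shifts the Euler operator by
    one. The operators to invert are thus Euler plus n, n + 1, ..., n + m - l - 1; these constants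
    are positive, so integration along rays gives smooth inverses. The inverses are wanted on X, but
    S is obtained by contracting a field of degree m n; hence they are moved below the l-fold
    gradient by an antiderivative, taken before any contraction. It exists because the inverses
    commute with partial derivatives up to a shift of the constants, so they keep gradients closed.
    The first l columns contain the derivative cells and are antisymmetrized on their own; the
    homotopies take place in the other columns, all of height n, where the fields are already
    alternating. *)

Lemma is_derive_line f x v (s d : R) :
  is_derive (s *: v + x) v f d -> is_derive s 1 (fun s : R => f (s *: v + x)) d.
Proof.
move=> [df dE]; have E : (fun h : R => h^-1 *: (((fun s : R => f (s *: v + x)) \o shift s) (h *: 1)
    - f (s *: v + x))) = (fun h : R => h^-1 *: ((f \o shift (s *: v + x)) (h *: v) - f (s *: v + x))).
  by apply/funext => h /=; rewrite [h *: 1]mulr1 scalerDl addrA.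
by split; rewrite /derivable /derive E.
Qed.

Lemma is_derive_line0 f x v (d : R) :
  is_derive (0 : R) 1 (fun s : R => f (s *: v + x)) d -> is_derive x v f d.
Proof.
move=> [df dE]; have E : (fun h : R => h^-1 *: (((fun s : R => f (s *: v + x)) \o shift 0) (h *: 1)
    - f ((0 : R) *: v + x))) = (fun h : R => h^-1 *: ((f \o shift x) (h *: v) - f x)).
  by apply/funext => h /=; rewrite [h *: 1]mulr1 addr0 scale0r add0r.
by split; [rewrite /derivable -E|rewrite /derive -E].
Qed.

(** The bound [|th| <= |h|] serves both signs of [h] at once in the limits below. *)
Lemma line_MVT f (df : V -> R) x v (h : R) : (forall y, is_derive y v f (df y)) ->
  exists2 th : R, `|th| <= `|h| & f (h *: v + x) - f x = h * df (th *: v + x).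
Proof.
move=> fd; pose g (s : R) := f (s *: v + x); pose dg (s : R) := df (s *: v + x).
have gd (s : R) : is_derive s 1 g (dg s) by apply: is_derive_line.
have gc : continuous g.
  by move=> s; apply/differentiable_continuous/derivable1_diffP; have [] := gd s.
have g0 : g 0 = f x by rewrite /g scale0r add0r.
have [h0|h0] := lerP 0 h.
  have [//|c] := @MVT_segment R g dg 0 h h0 (fun t _ => gd t).
    exact: continuous_subspaceT.
  rewrite in_itv /= => /andP[c0 ch] e; exists c; first by rewrite !ger0_norm.
  by rewrite -g0 -/(g h) e subr0 mulrC.
have [//|c] := @MVT_segment R g dg h 0 (ltW h0) (fun t _ => gd t).
  exact: continuous_subspaceT.
rewrite in_itv /= => /andP[c0 ch] e; exists c; first by rewrite !ler0_norm ?lerN2 // ltW.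
by rewrite -g0 -/(g h) -opprB e sub0r mulrN opprK mulrC.
Qed.

Lemma is_derive_scale f x v (c d : R) : is_derive x v f d -> is_derive x (c *: v) f (c * d).
Proof.
move=> fd; apply: is_derive_line0.
have -> : (fun s : R => f (s *: (c *: v) + x)) = (fun s : R => f (s *: v + x)) \o (fun s => c * s).
  by apply/funext => s /=; rewrite scalerA mulrC.
have h1 : is_derive (0 : R) 1 (fun s : R => c * s) c.
  by apply: is_derive_eq; rewrite ?[_ *: _]mulr1.
have h2 : is_derive (c * 0) 1 (fun s : R => f (s *: v + x)) d.
  by apply: is_derive_line; rewrite mulr0 scale0r add0r.
have h3 := @is_derive1_comp _ _ _ _ _ _ h2 h1.
by apply: (is_derive_eq h3); rewrite mulrC.
Qed.

(** The increment is split at the point [h *: v + x]; the mean value theorem turns the part along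
    [u] into [du] at a point tending to [x]. This leads from partial derivatives to arbitrary
    directions. *)
Lemma is_derive_add_dir f (du : V -> R) x u v (dv : R) :
  (forall y, is_derive y u f (du y)) -> {for x, continuous du} ->
  is_derive x v f dv -> is_derive x (u + v) f (du x + dv).
Proof.
move=> fu cdu [fv dvE].
suff : (fun h : R => h^-1 *: ((f \o shift x) (h *: (u + v)) - f x)) @ 0^' --> du x + dv.
  move=> H; have H' := cvg_lim (@Rhausdorff R) H.
  by split; [apply/cvg_ex; exists (du x + dv)|exact: H'].
have hv : (fun h : R => h^-1 *: ((f \o shift x) (h *: v) - f x)) @ 0^' --> dv.
  by rewrite -dvE; exact: fv.
rewrite (_ : (fun h : R => _) = (fun h : R =>
    h^-1 *: (f (h *: u + (h *: v + x)) - f (h *: v + x)) +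
    h^-1 *: ((f \o shift x) (h *: v) - f x))); last first.
  by apply/funext => h /=; rewrite -scalerDr addrA subrK addrA -scalerDr.
apply: cvgD => //; apply/cvgrPdist_lt => e e0.
move/cvgrPdist_lt: cdu => /(_ _ e0) /nbhs_ballP [r /= r0 hr].
near=> h.
have h0 : h != 0 by near: h; exact: nbhs_dnbhs_neq.
have [th hth ->] := line_MVT (h *: v + x) h fu.
rewrite [_ *: _]mulrA mulVf // mul1r; apply: hr.
rewrite -ball_normE /= addrA opprD addrCA subrr addr0 normrN.
apply: le_lt_trans (ler_normD _ _) _; rewrite !normrZ.
rewrite (@le_lt_trans _ _ (`|h| * (`|u| + `|v|))) //.
  by rewrite mulrDr lerD2r ler_wpM2r.
have uv : 0 < `|u| + `|v| + 1 by rewrite ltr_wpDl.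
rewrite (@le_lt_trans _ _ (`|h| * (`|u| + `|v| + 1))) //.
  by rewrite ler_wpM2l // lerDl.
rewrite -ltr_pdivlMr //; near: h; apply: dnbhs0_lt.
by rewrite divr_gt0.
Unshelve. all: by end_near. Qed.

End Directional.

(** * Integrals over the unit interval and their dependence on parameters *)

Section UnitIntegral.
Variable R : realType.
Implicit Types (g h : R -> R).

Definition unit_integral g : R := (\int[@lebesgue_measure R]_(t in `[0%R, 1%R]) g t)%R.

Lemma unit_integrable g : continuous g ->
  (@lebesgue_measure R).-integrable `[0%R, 1%R] (EFin \o g).
Proof.
move=> cg; apply: continuous_compact_integrable; first exact: segment_compact.
exact: continuous_subspaceT.
Qed.

Lemma unit_integralD g h : continuous g -> continuous h ->
  unit_integral (fun t => g t + h t) = unit_integral g + unit_integral h.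
Proof. by move=> cg ch; apply: RintegralD => //; exact: unit_integrable. Qed.

Lemma unit_integralB g h : continuous g -> continuous h ->
  unit_integral (fun t => g t - h t) = unit_integral g - unit_integral h.
Proof. by move=> cg ch; apply: RintegralB => //; exact: unit_integrable. Qed.

Lemma unit_integralZ c g : continuous g ->
  unit_integral (fun t => c * g t) = c * unit_integral g.
Proof. by move=> cg; apply: RintegralZl => //; exact: unit_integrable. Qed.

Lemma unit_integral_FTC (G g : R -> R) : continuous g ->
  (forall t, is_derive t (1 : R) G (g t)) -> unit_integral g = G 1 - G 0.
Proof.
move=> cg dG; have cG : continuous G.
  by move=> t; apply/differentiable_continuous/derivable1_diffP; have [] := dG t.
rewrite /unit_integral /Rintegral (@continuous_FTC2 R g G) //.
- exact: continuous_subspaceT.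
- split; first by move=> t _; have [] := dG t.
  + by apply: cvg_at_right_filter; exact: cG.
  + by apply: cvg_at_left_filter; exact: cG.
- by move=> t _; rewrite derive1E; have [] := dG t.
Qed.

Lemma unit_integral_cst (c : R) : unit_integral (fun=> c) = c.
Proof.
have cc : continuous (fun _ : R => c) by move=> t; exact: cvg_cst.
have dc t : is_derive t (1 : R) (fun t => c * t) c by apply: is_derive_eq; rewrite ?[_ *: _]mulr1.
by rewrite (unit_integral_FTC cc dc) mulr1 mulr0 subr0.
Qed.

Lemma unit_integral_norm_le g (e : R) : continuous g ->
  (forall t, 0 <= t <= 1 -> `|g t| <= e) -> `|unit_integral g| <= e.
Proof.
move=> cg hg; have cc (c : R) : continuous (fun _ : R => c) by move=> t; exact: cvg_cst.
rewrite ler_norml; apply/andP; split.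
  rewrite -[leLHS]unit_integral_cst; apply: le_Rintegral => //; try exact: unit_integrable.
  by move=> t; rewrite /= in_itv /= => /hg; rewrite ler_norml => /andP[].
rewrite -[leRHS]unit_integral_cst; apply: le_Rintegral => //; try exact: unit_integrable.
by move=> t; rewrite /= in_itv /= => /hg; rewrite ler_norml => /andP[].
Qed.

End UnitIntegral.

Lemma continuous_pair (T U V : topologicalType) (f : T -> U) (g : T -> V) :
  continuous f -> continuous g -> continuous (fun x => (f x, g x)).
Proof. by move=> cf cg x; apply: cvg_pair; [exact: cf|exact: cg]. Qed.

Lemma continuous_fst (T U : topologicalType) : continuous (fun z : T * U => z.1).
Proof. by move=> z; exact: cvg_fst. Qed.

Lemma continuous_snd (T U : topologicalType) : continuous (fun z : T * U => z.2).
Proof. by move=> z; exact: cvg_snd. Qed.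

Section ParametricIntegral.
Variables (R : realType) (V : normedModType R).
Implicit Types (x v : V) (F : V * R -> R).

Lemma param_section F x : continuous F -> continuous (fun t : R => F (x, t)).
Proof.
move=> cF t; apply: (@continuous_comp _ _ _ (fun t : R => (x, t)) F); last exact: cF.
by apply: (continuous_pair (f := fun=> x) (g := id)) => s; [exact: cvg_cst|exact: cvg_id].
Qed.

(** Compactness of [[0, 1]] turns joint continuity into continuity at [x] uniform in [t]. *)
Lemma param_uniform (T : topologicalType) (F : T * R -> R) (x : T) (e : R) :
  continuous F -> 0 < e ->
  \forall y \near x, forall t, 0 <= t <= 1 -> `|F (x, t) - F (y, t)| < e.
Proof.
move=> cF e0.
have := @segment_compact R 0 1; move/compact_near_coveringP.
move=> /(_ T (nbhs x) (fun y t => `|F (x, t) - F (y, t)| < e)) H.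
have {}H := H _; apply: filterS (H _ _) => [y hy t ht|t _].
  by apply: hy; rewrite /= in_itv.
have : {for (t, x), continuous (fun z : R * T => F (x, z.1) - F (z.2, z.1))}.
  apply: continuousB.
    apply: (@continuous_comp _ _ _ (fun z : R * T => (x, z.1)) F); last exact: cF.
    apply: (continuous_pair (f := fun=> x) (g := fst)); last exact: continuous_fst.
    by move=> z; exact: cvg_cst.
  apply: (@continuous_comp _ _ _ (fun z : R * T => (z.2, z.1)) F); last exact: cF.
  by apply: (continuous_pair (f := snd) (g := fst)); [exact: continuous_snd|exact: continuous_fst].
move/cvgrPdist_lt => /(_ _ e0) /=.
by rewrite subrr; apply: filterS => -[t' y] /=; rewrite sub0r normrN.
Qed.

Lemma param_continuous F : continuous F ->
  continuous (fun x => unit_integral (fun t => F (x, t))).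
Proof.
move=> cF x; apply/cvgrPdist_le => e e0.
apply: filterS (param_uniform x cF e0) => y hy.
rewrite -unit_integralB; [|exact: param_section..].
apply: unit_integral_norm_le => [|t ht]; last by rewrite ltW ?hy.
by move=> t; apply: continuousB; exact: param_section.
Qed.

(** The mean value theorem replaces the difference quotient by [dF] at an intermediate point, and
    [param_uniform] makes the convergence uniform in [t]. *)
Lemma param_is_derive F (dF : V * R -> R) x v : continuous F -> continuous dF ->
  (forall y t, is_derive y v (fun z => F (z, t)) (dF (y, t))) ->
  is_derive x v (fun y => unit_integral (fun t => F (y, t))) (unit_integral (fun t => dF (x, t))).
Proof.
move=> cF cdF hd.
set I := fun y => _; set d := unit_integral _.
suff : (fun h : R => h^-1 *: ((I \o shift x) (h *: v) - I x)) @ 0^' --> d.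
  move=> H; have H' := cvg_lim (@Rhausdorff R) H.
  by split; [apply/cvg_ex; exists d|exact: H'].
apply/cvgrPdist_le => e e0.
have cl : continuous (fun z : R * R => dF (z.1 *: v + x, z.2)).
  move=> z; apply: (@continuous_comp _ _ _ (fun z : R * R => (z.1 *: v + x, z.2)) dF); last exact: cdF.
  apply: (continuous_pair (f := fun z : R * R => z.1 *: v + x) (g := @snd R R)); last exact: continuous_snd.
  by move=> {}z; apply: cvgD; [apply: cvgZ; [exact: cvg_fst|exact: cvg_cst]|exact: cvg_cst].
have := @param_uniform R _ 0 e cl e0; rewrite /= => /nbhs_ballP[r /= r0 hr].
near=> h.
have h0 : h != 0 by near: h; exact: nbhs_dnbhs_neq.
have hr' : `|h| < r by near: h; exact: dnbhs0_lt.
rewrite /= /d /I -unit_integralB; [|exact: param_section..].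
have cB y z : continuous (fun t => F (y, t) - F (z, t)).
  by move=> t; apply: continuousB; exact: param_section.
have cq : continuous (fun t => h^-1 * (F (h *: v + x, t) - F (x, t))).
  by move=> t; apply: cvgM; [exact: cvg_cst|exact: cB].
have -> : h^-1 *: unit_integral (fun t => F (h *: v + x, t) - F (x, t)) =
    unit_integral (fun t => h^-1 * (F (h *: v + x, t) - F (x, t))) by rewrite unit_integralZ.
rewrite -unit_integralB //; last exact: param_section.
apply: unit_integral_norm_le => [|t ht].
  by move=> t; apply: cvgB; [exact: param_section|exact: cq].
have [th hth ->] := @line_MVT R V (fun z => F (z, t)) (fun z => dF (z, t)) x v h (fun y => hd y t).
rewrite mulKf //; apply: ltW; have := hr th _ t ht; rewrite scale0r add0r; apply.
by rewrite -ball_normE /= sub0r normrN (le_lt_trans hth).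
Unshelve. all: by end_near.
Qed.

End ParametricIntegral.

Lemma continuous_mulc (R : realType) (T : topologicalType) (c : R) (g : T -> R) :
  continuous g -> continuous (fun t => c * g t).
Proof. by move=> cg t; apply: cvgM; [exact: cvg_cst|exact: cg]. Qed.

Lemma continuous_addf (R : realType) (T : topologicalType) (f g : T -> R) :
  continuous f -> continuous g -> continuous (fun t => f t + g t).
Proof. by move=> cf cg t; apply: cvgD; [exact: cf|exact: cg]. Qed.

Lemma continuous_mulf (R : realType) (T : topologicalType) (f g : T -> R) :
  continuous f -> continuous g -> continuous (fun t => f t * g t).
Proof. by move=> cf cg t; apply: cvgM; [exact: cf|exact: cg]. Qed.

Lemma continuous_sumf (R : realType) (T : topologicalType) (I : Type) (s : seq I) (F : I -> T -> R) :
  (forall k, continuous (F k)) -> continuous (fun t => \sum_(k <- s) F k t).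
Proof.
move=> cF; elim: s => [|k s IH].
  rewrite (_ : (fun t => _) = fun=> 0); first exact: (@cst_continuous T R 0).
  by apply/funext => t; rewrite big_nil.
rewrite (_ : (fun t => _) = fun t => F k t + \sum_(k <- s) F k t).
  exact: continuous_addf.
by apply/funext => t; rewrite big_cons.
Qed.

Lemma is_derive_unique (R : realType) (V : normedModType R) (f : V -> R) x v (d1 d2 : R) :
  is_derive x v f d1 -> is_derive x v f d2 -> d1 = d2.
Proof. by move=> [_ <-] [_ <-]. Qed.

Lemma is_derive_shift (R : realType) (V : normedModType R) (f : V -> R) (w y u : V) (d : R) :
  is_derive (w + y) u f d -> is_derive y u (fun z => f (w + z)) d.
Proof.
move=> [df dE]; have E : (fun h : R => h^-1 *: (((fun z => f (w + z)) \o shift y) (h *: u) - f (w + y)))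
    = (fun h : R => h^-1 *: ((f \o shift (w + y)) (h *: u) - f (w + y))).
  by apply/funext => h /=; rewrite addrCA.
by split; rewrite /derivable /derive E.
Qed.

(* Differentiate [f (t v + y) - f y = int_0^1 t (fv (s t v + y)) ds] along [u] under the integral. *)
Lemma derive_commute (R : realType) (V : normedModType R) (f fu fv fuv fvu : V -> R) (u v : V) :
  (forall y, is_derive y u f (fu y)) -> (forall y, is_derive y v f (fv y)) ->
  (forall y, is_derive y u fv (fuv y)) -> (forall y, is_derive y v fu (fvu y)) ->
  continuous fv -> continuous fuv -> fuv =1 fvu.
Proof.
move=> hu hv huv hvu cv cuv x.
have cseg (g : V -> R) t : continuous g -> continuous (fun z : V * R => g ((z.2 * t) *: v + z.1)).
  move=> cg z; apply: (@continuous_comp _ _ _ (fun z : V * R => (z.2 * t) *: v + z.1) g); last exact: cg.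
  apply: cvgD; [apply: cvgZ; last exact: cvg_cst|exact: cvg_fst].
  by apply: cvgM; [exact: cvg_snd|exact: cvg_cst].
have FTCf t y : f (t *: v + y) - f y = unit_integral (fun s => t * fv ((s * t) *: v + y)).
  have cg : continuous (fun s : R => t * fv ((s * t) *: v + y)).
    by apply: continuous_mulc; exact: (param_section (x := y) (cseg _ t cv)).
  suff dG (s : R) : is_derive s (1 : R) (fun s => f ((s * t) *: v + y)) (t * fv ((s * t) *: v + y)).
    by rewrite (unit_integral_FTC cg dG) mul1r mul0r scale0r add0r.
  have h := is_derive_line (hv ((s * t) *: v + y)).
  have h1 : is_derive s (1 : R) (fun s : R => s * t) t by apply: is_derive_eq; rewrite scaler0 add0r [_ *: _]mulr1.
  have := @is_derive1_comp _ (fun s => f (s *: v + y)) (fun s => s * t) s _ _ h h1.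
  by move=> h2; apply: (is_derive_eq h2); rewrite mulrC.
pose G t := unit_integral (fun s => fuv ((s * t) *: v + x)).
have dFTC t : fu (t *: v + x) - fu x = t * G t.
  have cF : continuous (fun z : V * R => t * fv ((z.2 * t) *: v + z.1)).
    by apply: continuous_mulc; exact: cseg.
  have cdF : continuous (fun z : V * R => t * fuv ((z.2 * t) *: v + z.1)).
    by apply: continuous_mulc; exact: cseg.
  have h0 := is_derive_shift (hu (t *: v + x)).
  have h1 : is_derive x u (fun y => f (t *: v + y) - f y) (fu (t *: v + x) - fu x).
    by apply: is_deriveB.
  have h2 := @param_is_derive R V _ _ x u cF cdF.
  have E : (fun y => f (t *: v + y) - f y) = (fun y => unit_integral (fun s => t * fv ((s * t) *: v + y))).
    by apply/funext => y; rewrite FTCf.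
  rewrite E in h1; rewrite (is_derive_unique h1 (h2 _)) /=.
    by rewrite unit_integralZ //; exact: (param_section (x := x) (cseg _ t cuv)).
  move=> y s; have h3 := is_derive_shift (huv ((s * t) *: v + y)).
  exact: (@is_deriveZ _ _ _ _ t _ _ _ h3).
have cG : continuous G.
  have c2 : continuous (fun z : R * R => fuv ((z.2 * z.1) *: v + x)).
    move=> z; apply: (@continuous_comp _ _ _ (fun z : R * R => (z.2 * z.1) *: v + x) fuv); last exact: cuv.
    apply: cvgD; [apply: cvgZ; last exact: cvg_cst|exact: cvg_cst].
    by apply: cvgM; [exact: cvg_snd|exact: cvg_fst].
  exact: (param_continuous c2).
have G0 : G 0 = fuv x.
  rewrite /G (_ : (fun s => _) = fun=> fuv x) ?unit_integral_cst //.
  by apply/funext => s; rewrite mulr0 scale0r add0r.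
rewrite -G0; have [_ <-] := hvu x; rewrite /derive; apply/esym/cvg_lim => //.
have G' : G @ 0^' --> G 0 by apply: cvg_trans (cG 0); apply: cvg_app; exact: nbhs_dnbhs.
move: G'.
apply: cvg_trans; apply: near_eq_cvg; near=> t.
have t0 : t != 0 by near: t; exact: nbhs_dnbhs_neq.
by rewrite /= dFTC [_ *: _]mulrA mulVf // mul1r.
Unshelve. all: by end_near. Qed.

(** * Smooth functions *)

Section SmoothTheory.
Variables (R : realType) (D : nat).
Local Notation V := 'rV[R]_D.
Local Notation dir i := (delta_mx 0 i : V).
Implicit Types (f g : V -> R) (i j : 'I_D) (s : seq 'I_D) (c : R) (n : nat).

Lemma smooth_partial f i : smooth f -> smooth (partial i f).
Proof. by move=> hf s; have := hf (rcons s i); rewrite foldr_rcons. Qed.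

Lemma smooth_foldr f s : smooth f -> smooth (foldr (@partial R D) f s).
Proof. by move=> hf; elim: s => [|i s]; [exact: hf|exact: smooth_partial]. Qed.

Lemma smooth_continuous f : smooth f -> continuous f.
Proof. by move=> /(_ [::]) []. Qed.

Lemma smooth_is_derive f i x : smooth f -> is_derive x (dir i) f (partial i f x).
Proof. by move=> /(_ [::]) [_ /(_ i x) /= h]; exact: DeriveDef. Qed.

(** Coinduction principle: it spares formulas for iterated derivatives of products and ray
    integrals, since only a class stable under one derivative has to be exhibited. *)
Lemma smooth_coind (P : set (V -> R)) :
  (forall f, P f -> continuous f) ->
  (forall f i, P f -> exists2 g, P g & forall x, is_derive x (dir i) f (g x)) ->
  forall f, P f -> smooth f.
Proof.
move=> Pc Pd.
have Pp f i : P f -> P (partial i f).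
  move=> /(Pd _ i) [g Pg hg]; suff -> : partial i f = g by [].
  by apply/funext => x; have [_ <-] := hg x.
move=> f Pf s g; have {Pf} : P g by rewrite /g; elim: s {g} => //= i s; exact: Pp.
by move=> Pg; split=> [|i x]; [exact: Pc|have [h _ dh] := Pd _ i Pg; have [] := dh x].
Qed.

Local Opaque smooth.

Lemma partial_val f g i : (forall x, is_derive x (dir i) f (g x)) -> partial i f = g.
Proof. by move=> h; apply/funext => x; have [_ <-] := h x. Qed.

Lemma smooth_cst c : smooth (fun _ : V => c).
Proof.
apply: (@smooth_coind [set f | exists c, f = fun=> c]); last by exists c.
  by move=> _ [a ->]; exact: (@cst_continuous V R a).
by move=> _ i [a ->]; exists (fun=> 0); [exists 0|move=> x; exact: (is_derive_cst a x (dir i))].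
Qed.

Lemma is_derive_coord i j x : is_derive x (dir i) (fun y : V => y 0 j) (j == i)%:R.
Proof.
have E : (fun h : R => h^-1 *: (((fun y : V => y 0 j) \o shift x) (h *: dir i) - x 0 j)) @ 0^'
    --> ((j == i)%:R : R).
  apply: cvg_near_cst; near=> h.
  have h0 : h != 0 by near: h; exact: nbhs_dnbhs_neq.
  by rewrite /= !mxE addrK eqxx [LHS]mulrA mulVf // mul1r.
by split; [apply/cvg_ex; exists (j == i)%:R|apply: cvg_lim].
Unshelve. all: by end_near. Qed.

Lemma continuous_coord j : continuous (fun y : V => y 0 j).
Proof. exact: coord_continuous. Qed.

Lemma is_derive_coordMD f g j i x : smooth f -> smooth g ->
  is_derive x (dir i) (fun x : V => x 0 j * f x + g x)
    (x 0 j * partial i f x + ((j == i)%:R * f x + partial i g x)).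
Proof.
move=> hf hg; have h1 := is_derive_coord i j x.
have h2 := smooth_is_derive i x hf; have h3 := smooth_is_derive i x hg.
have h4 := is_deriveD (is_deriveM h1 h2) h3.
apply: (is_derive_eq h4); rewrite addrA; congr (_ + _ + _).
by rewrite [LHS]mulrC.
Qed.

Lemma smoothZ c f : smooth f -> smooth (fun x => c * f x).
Proof.
move=> hf; apply: (@smooth_coind [set h | exists2 f, smooth f & h = fun x => c * f x]).
- by move=> _ [{hf} {}f hf ->]; apply: continuous_mulc; exact: smooth_continuous.
- move=> _ i [{hf} {}f hf ->]; exists (fun x => c * partial i f x).
    by exists (partial i f); [exact: smooth_partial|].
  by move=> x; exact: (is_deriveZ c (smooth_is_derive i x hf)).
- by exists f.
Qed.

Lemma smoothD f g : smooth f -> smooth g -> smooth (fun x => f x + g x).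
Proof.
move=> hf hg; apply: (@smooth_coind [set h | exists f g, [/\ smooth f, smooth g &
    h = fun x : V => f x + g x]]); last by exists f, g.
- by move=> _ [{hf hg} {}f [{}g [hf hg ->]]]; apply: continuous_addf; exact: smooth_continuous.
- move=> _ i [{hf hg} {}f [{}g [hf hg ->]]].
  exists (fun x => partial i f x + partial i g x).
    by exists (partial i f), (partial i g); split; [exact: smooth_partial|exact: smooth_partial|].
  by move=> x; exact: (is_deriveD (smooth_is_derive i x hf) (smooth_is_derive i x hg)).
Qed.

(** The summand [g] makes this class of functions stable under partial derivatives: it absorbs the
    Leibniz term. *)
Lemma smooth_coordMD f g j : smooth f -> smooth g -> smooth (fun x : V => x 0 j * f x + g x).
Proof.
move=> hf hg.
apply: (@smooth_coind [set h | exists f g, [/\ smooth f, smooth g &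
    h = fun x : V => x 0 j * f x + g x]]); last by exists f, g.
  move=> _ [{hf hg} {}f [{}g [hf hg ->]]]; apply: continuous_addf; last exact: smooth_continuous.
  by apply: continuous_mulf; [exact: continuous_coord|exact: smooth_continuous].
move=> _ i [{hf hg} {}f [{}g [hf hg ->]]].
exists (fun x : V => x 0 j * partial i f x + ((j == i)%:R * f x + partial i g x)).
  exists (partial i f), (fun x => (j == i)%:R * f x + partial i g x).
  by split; [exact: smooth_partial|apply: smoothD; [exact: smoothZ|exact: smooth_partial]|].
by move=> x; exact: is_derive_coordMD.
Qed.

Lemma smooth_coordM f j : smooth f -> smooth (fun x : V => x 0 j * f x).
Proof.
move=> hf; have := smooth_coordMD j hf (smooth_cst 0).
by rewrite (_ : (fun x => _) = fun x : V => x 0 j * f x) //; apply/funext => x; rewrite addr0.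
Qed.

Lemma smooth_sum (I : Type) (r : seq I) (P : pred I) (F : I -> V -> R) :
  (forall k, P k -> smooth (F k)) -> smooth (fun x => \sum_(k <- r | P k) F k x).
Proof.
move=> hF; elim: r => [|k r IH].
  by rewrite (_ : (fun x => _) = fun=> 0); [exact: smooth_cst|apply/funext => x; rewrite big_nil].
case Pk: (P k); last first.
  by rewrite (_ : (fun x => _) = fun x => \sum_(k <- r | P k) F k x) //; apply/funext => x; rewrite big_cons Pk.
rewrite (_ : (fun x => _) = fun x => F k x + \sum_(k <- r | P k) F k x).
  exact (smoothD (hF k Pk) IH).
apply/funext => x; rewrite big_cons Pk; reflexivity.
Qed.

Lemma partialD i f g : smooth f -> smooth g ->
  partial i (fun x => f x + g x) = fun x => partial i f x + partial i g x.
Proof.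
move=> hf hg; apply: partial_val => x.
exact: (is_deriveD (smooth_is_derive i x hf) (smooth_is_derive i x hg)).
Qed.

Lemma partialZ i c f : smooth f -> partial i (fun x => c * f x) = fun x => c * partial i f x.
Proof. by move=> hf; apply: partial_val => x; exact: (is_deriveZ c (smooth_is_derive i x hf)). Qed.

Lemma partial_cst i c : partial i (fun=> c) = fun=> 0.
Proof. by apply: partial_val => x; exact: (is_derive_cst c x (dir i)). Qed.

Lemma partial_sum (I : Type) (r : seq I) (P : pred I) (F : I -> V -> R) i :
  (forall k, P k -> smooth (F k)) ->
  partial i (fun x => \sum_(k <- r | P k) F k x) = fun x => \sum_(k <- r | P k) partial i (F k) x.
Proof.
move=> hF; elim: r => [|k r IH].
  rewrite (_ : (fun x => _) = fun=> 0) ?partial_cst; apply/funext => x; by rewrite big_nil.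
have [Pk|Pk] := boolP (P k); last first.
  rewrite (_ : (fun x => _) = fun x => \sum_(k <- r | P k) F k x); last first.
    by apply/funext => x; rewrite big_cons (negbTE Pk).
  by rewrite IH; apply/funext => x; rewrite big_cons (negbTE Pk).
rewrite (_ : (fun x => _) = fun x => F k x + \sum_(k <- r | P k) F k x); last first.
  by apply/funext => x; rewrite big_cons Pk.
rewrite partialD; [|exact: hF|exact: smooth_sum].
by rewrite IH; apply/funext => x; rewrite big_cons Pk.
Qed.

Lemma partial_coordM i j f : smooth f ->
  partial i (fun x : V => x 0 j * f x) = fun x : V => x 0 j * partial i f x + (j == i)%:R * f x.
Proof.
move=> hf; apply: partial_val => x.
have h := is_derive_coordMD j i x hf (smooth_cst 0).
have E : (fun x : V => x 0 j * f x + 0) = fun x : V => x 0 j * f x by apply/funext => y; rewrite addr0.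
by rewrite E partial_cst addr0 in h.
Qed.

Lemma partialC i j f : smooth f -> partial i (partial j f) = partial j (partial i f).
Proof.
move=> hf; have hp k := smooth_partial k hf; apply/funext.
exact: (@derive_commute R V f (partial i f) (partial j f) _ _ (dir i) (dir j)
  (fun y => smooth_is_derive i y hf) (fun y => smooth_is_derive j y hf)
  (fun y => smooth_is_derive i y (hp j)) (fun y => smooth_is_derive j y (hp i))
  (smooth_continuous (hp j)) (smooth_continuous (smooth_partial i (hp j)))).
Qed.

Lemma foldr_partial_perm f s1 s2 : smooth f -> perm_eq s1 s2 ->
  foldr (@partial R D) f s1 = foldr (@partial R D) f s2.
Proof.
move=> hf h; have := h; move: s2 {h}; elim: s1 => [|i s1 IH] s2.
  by move=> /perm_size/esym/size0nil ->.
move=> h; have hi : i \in s2 by rewrite -(perm_mem h) mem_head.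
have [l [r e]] : exists l r, s2 = l ++ i :: r.
  by case/splitPr: hi => l r; exists l, r.
move: h; rewrite e perm_sym -[i :: r]cat1s perm_catCA /= perm_cons perm_sym => /IH ->.
rewrite !foldr_cat /=; elim: l {e} => [|j l IHl] /=; first reflexivity.
by rewrite partialC; [rewrite IHl|do 2 apply: smooth_foldr].
Qed.

Lemma smooth_is_derive_dir f x v : smooth f ->
  is_derive x v f (\sum_i v 0 i * partial i f x).
Proof.
move=> hf; have {1}-> : v = \sum_(i <- index_enum 'I_D) v 0 i *: dir i.
  by rewrite {1}[v]row_sum_delta.
elim: (index_enum _) => [|i r IH]; first by rewrite !big_nil; exact: is_derive0.
rewrite !big_cons; have h y := is_derive_scale (v 0 i) (smooth_is_derive i y hf).
apply: (@is_derive_add_dir _ _ f (fun y => v 0 i * partial i f y)).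
by apply: continuous_mulc; apply: smooth_continuous; exact: smooth_partial.
Qed.

End SmoothTheory.

(** * Ray integrals, Euler operators and iterated primitives *)

Section RayIntegral.
Variables (R : realType) (D : nat).
Local Notation V := 'rV[R]_D.
Local Notation dir i := (delta_mx 0 i : V).
Implicit Types (f g : V -> R) (i j a b : 'I_D) (c n r l : nat).

Definition ray_integral c f (x : V) : R := unit_integral (fun t => t ^+ c * f (t *: x)).

Lemma continuous_ray c f : continuous f -> continuous (fun z : V * R => z.2 ^+ c * f (z.2 *: z.1)).
Proof.
move=> cf; apply: continuous_mulf.
  elim: c => [|c IH]; first exact: cst_continuous.
  rewrite (_ : (fun z => _) = fun z : V * R => z.2 * z.2 ^+ c); last by apply/funext => z; rewrite exprS.
  by apply: continuous_mulf => //; exact: continuous_snd.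
move=> z; apply: (@continuous_comp _ _ _ (fun z : V * R => z.2 *: z.1) f); last exact: cf.
by apply: cvgZ; [exact: cvg_snd|exact: cvg_fst].
Qed.

Lemma continuous_ray_section c f x : continuous f ->
  continuous (fun t : R => t ^+ c * f (t *: x)).
Proof. by move=> cf; exact (param_section (x := x) (continuous_ray (c := c) cf)). Qed.

Lemma is_derive_dilate f (t : R) (y v : V) (d : R) :
  is_derive (t *: y) v f d -> is_derive y v (fun z => f (t *: z)) (t * d).
Proof.
move=> /(is_derive_scale t) [df dE].
have E : (fun h : R => h^-1 *: (((fun z => f (t *: z)) \o shift y) (h *: v) - f (t *: y)))
    = (fun h : R => h^-1 *: ((f \o shift (t *: y)) (h *: (t *: v)) - f (t *: y))).
  by apply/funext => h /=; rewrite (scalerDr t) !scalerA [t * h]mulrC.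
by split; rewrite /derivable /derive E.
Qed.

Lemma is_derive_ray_integral c f i x : smooth f ->
  is_derive x (dir i) (ray_integral c f) (ray_integral c.+1 (partial i f) x).
Proof.
move=> hf; have cf := smooth_continuous hf.
have cpf := smooth_continuous (smooth_partial i hf).
apply: (param_is_derive (F := fun z : V * R => z.2 ^+ c * f (z.2 *: z.1))
  (dF := fun z : V * R => z.2 ^+ c.+1 * partial i f (z.2 *: z.1))) => [||y t].
- exact: continuous_ray.
- exact: continuous_ray.
have h := is_derive_dilate (smooth_is_derive i (t *: y) hf).
by apply: (is_derive_eq (is_deriveZ (t ^+ c) h)); rewrite [LHS]mulrA -exprSr.
Qed.

Lemma smooth_ray_integral c f : smooth f -> smooth (ray_integral c f).
Proof.
move=> hf; apply: (@smooth_coind _ _ [set g | exists c f, smooth f /\ g = ray_integral c f]).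
- move=> _ [{}c [{hf} {}f [hf ->]]].
  exact: (param_continuous (continuous_ray (c := c) (smooth_continuous hf))).
- move=> _ i [{}c [{hf} {}f [hf ->]]]; exists (ray_integral c.+1 (partial i f)).
    by exists c.+1, (partial i f); split=> //; exact: smooth_partial.
  by move=> x; exact: is_derive_ray_integral.
- by exists c, f.
Qed.

Lemma partial_ray_integral c f i : smooth f ->
  partial i (ray_integral c f) = ray_integral c.+1 (partial i f).
Proof. by move=> hf; apply: partial_val => x; exact: is_derive_ray_integral. Qed.

Lemma ray_integralD c f g : smooth f -> smooth g ->
  ray_integral c (fun x => f x + g x) = fun x => ray_integral c f x + ray_integral c g x.
Proof.
move=> hf hg; apply/funext => x; rewrite -unit_integralD.
- by congr unit_integral; apply/funext => t; rewrite mulrDr.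
- by apply: continuous_ray_section; exact: smooth_continuous.
- by apply: continuous_ray_section; exact: smooth_continuous.
Qed.

Lemma ray_integralZ c f (k : R) : smooth f ->
  ray_integral c (fun x => k * f x) = fun x => k * ray_integral c f x.
Proof.
move=> hf; apply/funext => x; rewrite -unit_integralZ.
  by congr unit_integral; apply/funext => t; rewrite mulrCA.
by apply: continuous_ray_section; exact: smooth_continuous.
Qed.

Definition euler f (x : V) : R := \sum_i x 0 i * partial i f x.

Lemma unit_integral_sum (I : Type) (s : seq I) (F : I -> R -> R) : (forall k, continuous (F k)) ->
  unit_integral (fun t => \sum_(k <- s) F k t) = \sum_(k <- s) unit_integral (F k).
Proof.
move=> cF; elim: s => [|k s IH].
  rewrite big_nil -[RHS](unit_integral_cst 0); congr unit_integral.
  by apply/funext => t; rewrite big_nil.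
rewrite big_cons -IH -unit_integralD //; last exact: continuous_sumf.
by congr unit_integral; apply/funext => t; rewrite big_cons.
Qed.

(** Integrate the derivative of [t ^+ c.+1 * f (t *: x)] over [[0, 1]]; the boundary term at 0
    vanishes because the exponent is positive. *)
Lemma euler_ray_integral c f x : smooth f ->
  c.+1%:R * ray_integral c f x + euler (ray_integral c f) x = f x.
Proof.
move=> hf; have cf := smooth_continuous hf.
have cp i := smooth_continuous (smooth_partial i hf).
pose g (t : R) := c.+1%:R * (t ^+ c * f (t *: x)) + \sum_i x 0 i * (t ^+ c.+1 * partial i f (t *: x)).
have dG (t : R) : is_derive t (1 : R) (fun t => t ^+ c.+1 * f (t *: x)) (g t).
  have hl : is_derive t (1 : R) (fun t => f (t *: x)) (\sum_i x 0 i * partial i f (t *: x)).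
    have := is_derive_line (x := 0) (s := t) (smooth_is_derive_dir (t *: x + 0) x hf).
    rewrite addr0; congr is_derive.
    by apply/funext => s; rewrite addr0.
  have hX : is_derive t (1 : R) (fun t => t ^+ c.+1) (c.+1%:R * t ^+ c).
    by split; [exact: exprn_derivable|rewrite exp_derive [LHS]mulr1].
  apply: (is_derive_eq (is_deriveM hX hl)).
  rewrite /g addrC; congr (_ + _); first by rewrite [LHS]mulrC mulrA.
  by rewrite [LHS]mulr_sumr; apply: eq_bigr => i _; rewrite mulrCA.
have cr i : continuous (fun t : R => t ^+ c.+1 * partial i f (t *: x)).
  exact: continuous_ray_section.
have c1 : continuous (fun t : R => t ^+ c * f (t *: x)) by exact: continuous_ray_section.
have cS : continuous (fun t : R => \sum_i x 0 i * (t ^+ c.+1 * partial i f (t *: x))).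
  by apply: continuous_sumf => i; exact: continuous_mulc.
have cg : continuous g.
  by apply: continuous_addf => //; exact: continuous_mulc.
have := unit_integral_FTC cg dG.
rewrite expr1n mul1r scale1r expr0n mul0r subr0 => <-.
rewrite unit_integralD //; last exact: continuous_mulc.
rewrite unit_integralZ // unit_integral_sum; last by move=> i; exact: continuous_mulc.
by congr (_ + _); apply: eq_bigr => i _; rewrite unit_integralZ // partial_ray_integral.
Qed.

Local Opaque smooth.

(* [ray_integral c] inverts [euler + c.+1]; this is the product of the inverses for
   [c = n, ..., n + r - 1]. *)
Fixpoint euler_inv n r f : V -> R :=
  if r is r'.+1 then ray_integral n (euler_inv n.+1 r' f) else f.

Lemma smooth_euler_inv n r f : smooth f -> smooth (euler_inv n r f).
Proof. by elim: r n => [|r IH] n hf /=; [|apply: smooth_ray_integral; exact: IH]. Qed.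

Lemma partial_euler_inv n r f i : smooth f ->
  partial i (euler_inv n r f) = euler_inv n.+1 r (partial i f).
Proof.
move=> hf; elim: r n => [|r IH] n /=; first by [].
by rewrite partial_ray_integral; [rewrite IH|exact: smooth_euler_inv].
Qed.

(** Linearity is asked on smooth functions, where the integrals involved exist and are additive. *)
Definition linear_on_smooth (G : (V -> R) -> V -> R) :=
  (forall f g, smooth f -> smooth g -> G (fun x => f x + g x) = fun x => G f x + G g x) /\
  (forall (k : R) f, smooth f -> G (fun x => k * f x) = fun x => k * G f x).

Lemma linear_on_smooth_sum G (I : Type) (s : seq I) (P : pred I) (F : I -> V -> R) :
  linear_on_smooth G -> (forall k, P k -> smooth (F k)) ->
  G (fun x => \sum_(k <- s | P k) F k x) = fun x => \sum_(k <- s | P k) G (F k) x.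
Proof.
move=> [GD GZ] hF; elim: s => [|k s IH].
  transitivity (G (fun x => 0 * (fun _ : V => 0) x)).
    by congr G; apply/funext => x; rewrite big_nil mul0r.
  by rewrite GZ; [apply/funext => x; rewrite big_nil mul0r|exact: smooth_cst].
have [Pk|/negbTE Pk] := boolP (P k); last first.
  transitivity (G (fun x => \sum_(k <- s | P k) F k x)).
    by congr G; apply/funext => x; rewrite big_cons Pk.
  by rewrite IH; apply/funext => x; rewrite big_cons Pk.
transitivity (G (fun x => F k x + \sum_(k <- s | P k) F k x)).
  by congr G; apply/funext => x; rewrite big_cons Pk.
by rewrite GD; [rewrite IH; apply/funext => x; rewrite big_cons Pk|exact: hF|exact: smooth_sum].
Qed.

Lemma linear_euler_inv n r : linear_on_smooth (euler_inv n r).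
Proof.
elim: r n => [|r IH] n; first by split.
have [IHD IHZ] := IH n.+1; split=> [f g hf hg|k f hf] /=.
  by rewrite (IHD _ _ hf hg) ray_integralD; [|exact: smooth_euler_inv..].
by rewrite (IHZ _ _ hf) ray_integralZ; [|exact: smooth_euler_inv].
Qed.

Lemma euler_euler_inv n r f x : smooth f ->
  n.+1%:R * euler_inv n r.+1 f x + euler (euler_inv n r.+1 f) x = euler_inv n.+1 r f x.
Proof. by move=> hf; rewrite /= euler_ray_integral; [|exact: smooth_euler_inv]. Qed.

(** Poincare lemma for 1-forms: by closedness, the derivative of the sum is [1 + euler] applied to
    [ray_integral 0 (h b)]. *)
Lemma closed_gradient (h : 'I_D -> V -> R) b : (forall a, smooth (h a)) ->
  (forall a, partial b (h a) = partial a (h b)) ->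
  partial b (fun x => \sum_a x 0 a * ray_integral 0 (h a) x) = h b.
Proof.
move=> sh ch; have sr a : smooth (ray_integral 0 (h a)) by exact: smooth_ray_integral.
rewrite partial_sum; last by move=> a _; exact: smooth_coordM.
apply/funext => x; rewrite -[RHS](euler_ray_integral 0 x (sh b)) mul1r addrC.
transitivity (\sum_a (x 0 a * partial a (ray_integral 0 (h b)) x +
    (if a == b then ray_integral 0 (h b) x else 0))).
  apply: eq_bigr => a _; rewrite partial_coordM; last exact: sr.
  rewrite (partial_ray_integral _ _ (sh a)) (partial_ray_integral _ _ (sh b)) ch.
  by congr (_ + _); case: eqP => [->|_]; rewrite ?mul1r ?mul0r.
by rewrite big_split /= -big_mkcond /= big_pred1_eq.
Qed.

(* Integrating [l] times the closed 1-form with components [G (partial a f)] yields a field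
   whose [l]-fold gradient is [G] applied to the [l]-fold gradient of [f]. *)
Fixpoint grad_lift l (G : (V -> R) -> V -> R) f : V -> R :=
  if l is l'.+1 then fun x => \sum_a x 0 a * ray_integral 0 (grad_lift l' G (partial a f)) x
  else G f.

Lemma linear_grad_lift l G : (forall f, smooth f -> smooth (G f)) ->
  linear_on_smooth G -> linear_on_smooth (grad_lift l G).
Proof.
move=> sG lG.
have sl l' f : smooth f -> smooth (grad_lift l' G f).
  elim: l' f => [|l' IH] f hf; first exact: sG.
  apply: smooth_sum => a _; apply: smooth_coordM; apply: smooth_ray_integral; apply: IH.
  exact: smooth_partial.
elim: l => [|l [IHD IHZ]]; first exact: lG.
have sp f a : smooth f -> smooth (grad_lift l G (partial a f)).
  by move=> hf; apply: sl; exact: smooth_partial.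
split=> [f g hf hg|k f hf]; apply/funext => x /=.
  rewrite -big_split /=; apply: eq_bigr => a _.
  rewrite (partialD _ hf hg) IHD; [|exact: smooth_partial..].
  by rewrite ray_integralD; [rewrite mulrDr|exact: sp..].
rewrite mulr_sumr; apply: eq_bigr => a _.
rewrite (partialZ _ _ hf) IHZ; last exact: smooth_partial.
by rewrite ray_integralZ; [rewrite mulrCA|exact: sp].
Qed.

Section GradLift.
Variable G : (V -> R) -> V -> R.
Hypothesis smoothG : forall f, smooth f -> smooth (G f).
Hypothesis closedG : forall f a b, smooth f ->
  partial b (G (partial a f)) = partial a (G (partial b f)).

Lemma smooth_grad_lift l f : smooth f -> smooth (grad_lift l G f).
Proof.
elim: l f => [|l IH] f hf; first exact: smoothG.
apply: smooth_sum => a _; apply: smooth_coordM; apply: smooth_ray_integral; apply: IH.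
exact: smooth_partial.
Qed.

(** The 1-form integrated at each stage is closed: one derivative lowers the order of the lift by
    one, and the partial derivatives of [f] commute. The hypothesis [closedG] starts the
    induction. *)
Lemma partial_grad_lift l f b : smooth f ->
  partial b (grad_lift l.+1 G f) = grad_lift l G (partial b f).
Proof.
elim: l f b => [|l IH] f b hf.
  have sh a : smooth (G (partial a f)) by apply: smoothG; exact: smooth_partial.
  exact (closed_gradient sh (fun a => closedG a b hf)).
have sh a : smooth (grad_lift l.+1 G (partial a f)).
  by apply: smooth_grad_lift; exact: smooth_partial.
have ch a : partial b (grad_lift l.+1 G (partial a f)) = partial a (grad_lift l.+1 G (partial b f)).
  rewrite IH; last exact: smooth_partial.
  by rewrite IH; [rewrite (partialC _ _ hf)|exact: smooth_partial].
exact (closed_gradient sh ch).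
Qed.

Lemma foldr_partial_grad_lift l f s : smooth f -> size s = l ->
  foldr (@partial R D) (grad_lift l G f) s = G (foldr (@partial R D) f s).
Proof.
(* The last direction of [s] is applied first by [foldr], hence the induction from the right. *)
elim/last_ind: s l f => [|s a IH] l f hf; first by move=> <-.
rewrite size_rcons => <-; rewrite !foldr_rcons (partial_grad_lift _ _ hf).
by apply: IH => //; exact: smooth_partial.
Qed.

End GradLift.

(** Both sides are the Euler inverse with constants shifted by one, applied to the same second
    derivative. *)
Lemma closed_euler_inv n r f a b : smooth f ->
  partial b (euler_inv n r (partial a f)) = partial a (euler_inv n r (partial b f)).
Proof.
move=> hf; rewrite !partial_euler_inv; [|exact: smooth_partial..].
by rewrite (partialC _ _ hf).
Qed.

End RayIntegral.

(** * Polynomials as smooth functions with vanishing higher derivatives *)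

Section Polynomials.
Variables (R : realType) (D : nat).
Local Notation V := 'rV[R]_D.
Implicit Types (f g : V -> R) (i j a : 'I_D) (k c : nat) (s : seq 'I_D).

Definition flat k f := smooth f /\
  forall s, size s = k -> foldr (@partial R D) f s = fun=> 0.

Lemma flatS k f : flat k f -> flat k.+1 f.
Proof.
move=> [sf hf]; split=> [|[|i s] //= [hs]]; first exact: sf.
by rewrite hf // partial_cst.
Qed.

Lemma flat_partial k f : smooth f -> (forall i, flat k (partial i f)) -> flat k.+1 f.
Proof.
move=> sf hf; split; first exact: sf.
elim/last_ind => // s j _; rewrite size_rcons foldr_rcons => -[hs].
by have [_ ->] := hf j.
Qed.

Lemma flat_partialV k f i : flat k.+1 f -> flat k (partial i f).
Proof.
move=> [sf hf]; split; first exact: smooth_partial.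
by move=> s hs; rewrite -foldr_rcons hf // size_rcons hs.
Qed.

Lemma foldr_partialD f g s : smooth f -> smooth g ->
  foldr (@partial R D) (fun x => f x + g x) s =
  fun x => foldr (@partial R D) f s x + foldr (@partial R D) g s x.
Proof.
move=> sf sg; elim: s => [|i s /= ->]; first reflexivity.
by rewrite partialD; [|exact: smooth_foldr..].
Qed.

Lemma foldr_partialZ f (c : R) s : smooth f ->
  foldr (@partial R D) (fun x => c * f x) s = fun x => c * foldr (@partial R D) f s x.
Proof.
move=> sf; elim: s => [|i s /= ->]; first reflexivity.
by rewrite partialZ; [|exact: smooth_foldr].
Qed.

Lemma flatD k f g : flat k f -> flat k g -> flat k (fun x => f x + g x).
Proof.
move=> [sf hf] [sg hg]; split; first exact: smoothD.
by move=> s hs; rewrite foldr_partialD // hf // hg //; apply/funext => x; rewrite addr0.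
Qed.

Lemma flatZ k (c : R) f : flat k f -> flat k (fun x => c * f x).
Proof.
move=> [sf hf]; split; first exact: smoothZ.
by move=> s hs; rewrite foldr_partialZ // hf //; apply/funext => x; rewrite mulr0.
Qed.

Lemma flat0 k : flat k (fun=> 0).
Proof.
split=> [|s _]; first exact: smooth_cst.
by elim: s => [|i s /= ->]; [reflexivity|exact: partial_cst].
Qed.

Lemma flat_le k l f : (k <= l)%N -> flat k f -> flat l f.
Proof. by move=> /subnK <- hf; elim: (l - k)%N => // n; exact: flatS. Qed.

Lemma flat_coordM k f j : flat k f -> flat k.+1 (fun x : V => x 0 j * f x).
Proof.
elim: k f => [|k IH] f hf.
  have [_ h0] := hf; have {}h0 := h0 [::] erefl; rewrite /= in h0.
  by rewrite (_ : (fun x => _) = fun=> 0); [exact: flat0|apply/funext => x; rewrite h0 mulr0].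
have [sf _] := hf; apply: flat_partial => [|i]; first exact: smooth_coordM.
rewrite (partial_coordM _ _ sf).
exact (flatD (IH _ (flat_partialV i hf)) (flatZ (j == i)%:R hf)).
Qed.

Lemma flat_coordXM k f j n : flat k f -> flat (n + k) (fun x : V => x 0 j ^+ n * f x).
Proof.
move=> hf; elim: n => [|n IH].
  by rewrite (_ : (fun x => _) = f) //; apply/funext => x; rewrite expr0 mul1r.
rewrite (_ : (fun x => _) = fun x : V => x 0 j * (x 0 j ^+ n * f x)); first exact: flat_coordM.
by apply/funext => x; rewrite exprS mulrA.
Qed.

Lemma flat_cst (c : R) : flat 1 (fun _ : V => c).
Proof.
split=> [|[|i [|]] // _]; first exact: smooth_cst.
exact: partial_cst.
Qed.

Lemma flat_monomial (m : 'I_D -> nat) : flat (\sum_i m i).+1 (fun x : V => \prod_i x 0 i ^+ m i).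
Proof.
elim: (index_enum _) => [|i r IH].
  rewrite big_nil (_ : (fun x => _) = fun=> 1); first exact: flat_cst.
  by apply/funext => x; rewrite big_nil.
rewrite big_cons -addnS (_ : (fun x => _) = fun x : V => x 0 i ^+ m i * \prod_(i <- r) x 0 i ^+ m i).
  exact: flat_coordXM.
by apply/funext => x; rewrite big_cons.
Qed.

Lemma flat_sum k (I : Type) (r : seq I) (P : pred I) (F : I -> V -> R) :
  (forall u, P u -> flat k (F u)) -> flat k (fun x => \sum_(u <- r | P u) F u x).
Proof.
move=> hF; elim: r => [|u r IH].
  by rewrite (_ : (fun x => _) = fun=> 0); [exact: flat0|apply/funext => x; rewrite big_nil].
have [Pu|/negbTE Pu] := boolP (P u).
  rewrite (_ : (fun x => _) = fun x => F u x + \sum_(u <- r | P u) F u x).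
    by apply: flatD; [exact: hF|exact: IH].
  by apply/funext => x; rewrite big_cons Pu.
rewrite (_ : (fun x => _) = fun x => \sum_(u <- r | P u) F u x) //.
by apply/funext => x; rewrite big_cons Pu.
Qed.

Lemma poly_fun_flat k f : poly_fun_lt R D k f -> flat k f.
Proof.
move=> [P hP hf].
rewrite (_ : f = fun x : V => \sum_(m <- mpoly.msupp P) mpoly.mcoeff m P * \prod_i x 0 i ^+ mpoly.fun_of_multinom m i).
  rewrite (_ : (fun x => _) = fun x : V => \sum_(m <- mpoly.msupp P | m \in mpoly.msupp P)
    mpoly.mcoeff m P * \prod_i x 0 i ^+ mpoly.fun_of_multinom m i).
    apply: flat_sum => m hm; apply: flatZ; apply: flat_le (flat_monomial _).
    by rewrite -mpoly.mdegE; apply: leq_trans hP; exact: mpoly.msize_mdeg_lt.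
  by apply/funext => x; rewrite -big_seq.
by apply/funext => x; rewrite hf mpoly.mevalE.
Qed.

Lemma poly_funD k f g : poly_fun_lt R D k f -> poly_fun_lt R D k g ->
  poly_fun_lt R D k (fun x => f x + g x).
Proof.
move=> [P hP hf] [Q hQ hg]; exists (P + Q) => [|x].
  by apply: leq_trans (mpoly.msizeD_le _ _) _; rewrite geq_max hP.
by rewrite mpoly.mevalD hf hg.
Qed.

Lemma poly_funZ k (c : R) f : poly_fun_lt R D k f -> poly_fun_lt R D k (fun x => c * f x).
Proof.
move=> [P hP hf]; exists (c *: P) => [|x]; first exact: leq_trans (mpoly.msizeZ_le _ _) hP.
by rewrite mpoly.mevalZ hf.
Qed.

Lemma poly_fun0 k : poly_fun_lt R D k (fun=> 0).
Proof. by exists 0 => [|x]; [rewrite mpoly.msize0|rewrite mpoly.meval0]. Qed.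

Lemma poly_fun_cst k (c : R) : poly_fun_lt R D k.+1 (fun=> c).
Proof.
exists (mpoly.mpolyC D c) => [|x]; last by rewrite mpoly.mevalC.
by rewrite mpoly.msizeC; case: (c != 0).
Qed.

Lemma poly_fun_sum k (I : Type) (r : seq I) (P : pred I) (F : I -> V -> R) :
  (forall u, P u -> poly_fun_lt R D k (F u)) ->
  poly_fun_lt R D k (fun x => \sum_(u <- r | P u) F u x).
Proof.
move=> hF; elim: r => [|u r IH].
  by rewrite (_ : (fun x => _) = fun=> 0); [exact: poly_fun0|apply/funext => x; rewrite big_nil].
have [Pu|/negbTE Pu] := boolP (P u).
  rewrite (_ : (fun x => _) = fun x => F u x + \sum_(u <- r | P u) F u x).
    by apply: poly_funD; [exact: hF|exact: IH].
  by apply/funext => x; rewrite big_cons Pu.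
rewrite (_ : (fun x => _) = fun x => \sum_(u <- r | P u) F u x) //.
by apply/funext => x; rewrite big_cons Pu.
Qed.

Lemma poly_fun_coordM k f j : poly_fun_lt R D k f -> poly_fun_lt R D k.+1 (fun x => x 0 j * f x).
Proof.
move=> [P hP hf]; exists (mpoly.mpolyX R (mpoly.mnm1 j) * P) => [|x].
  have [->|P0] := eqVneq P 0; first by rewrite mulr0 mpoly.msize0.
  rewrite mpoly.msizeM //; last by rewrite -mpoly.msize_poly_eq0 mpoly.msizeX.
  by rewrite mpoly.msizeX mpoly.mdeg1 add2n.
by rewrite mpoly.mevalM mpoly.mevalXU hf.
Qed.

(** By homogeneity, a ray integral multiplies each monomial by a scalar. *)
Lemma ray_integral_poly c k f : poly_fun_lt R D k f -> poly_fun_lt R D k (ray_integral c f).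
Proof.
move=> [P hP hf].
have smono (m : mpoly.multinom D) : smooth (fun x : V => \prod_i x 0 i ^+ mpoly.fun_of_multinom m i).
  by have [] := flat_monomial (mpoly.fun_of_multinom m).
have -> : ray_integral c f = fun x : V => \sum_(m <- mpoly.msupp P | m \in mpoly.msupp P)
    mpoly.mcoeff m P * ray_integral c (fun x : V => \prod_i x 0 i ^+ mpoly.fun_of_multinom m i) x.
  have lin : linear_on_smooth (@ray_integral R D c) := linear_euler_inv R D c 1.
  have -> : f = fun x : V => \sum_(m <- mpoly.msupp P | m \in mpoly.msupp P)
      mpoly.mcoeff m P * \prod_i x 0 i ^+ mpoly.fun_of_multinom m i.
    by apply/funext => x; rewrite hf mpoly.mevalE big_seq.
  rewrite (linear_on_smooth_sum _ lin); last first.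
    by move=> m _; exact: smoothZ.
  by apply/funext => x; apply: eq_bigr => m _; rewrite ray_integralZ.
apply: poly_fun_sum => m hm; apply: poly_funZ.
have -> : ray_integral c (fun x : V => \prod_i x 0 i ^+ mpoly.fun_of_multinom m i) =
    fun x : V => (unit_integral (fun t => t ^+ (c + mpoly.mdeg m))) *
      \prod_i x 0 i ^+ mpoly.fun_of_multinom m i.
  apply/funext => x; rewrite mulrC -unit_integralZ; last first.
    by move=> t; apply: exprn_continuous.
  congr unit_integral; apply/funext => t; rewrite exprD mulrCA; congr (_ * _).
  rewrite mpoly.mdegE expr_sum -big_split /=; apply: eq_bigr => i _.
  by rewrite mxE exprMn mulrC.
apply: poly_funZ; exists (mpoly.mpolyX R m) => [|x]; last by rewrite mpoly.mevalX.
by rewrite mpoly.msizeX; apply: leq_trans hP; exact: mpoly.msize_mdeg_lt.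
Qed.

(** Up to a constant, [f] is the potential rebuilt from its gradient; the gradient is polynomial by
    induction, and the reconstruction raises the degree bound by one. *)
Lemma flat_poly_fun k f : flat k f -> poly_fun_lt R D k f.
Proof.
elim: k f => [|k IH] f hf.
  have [_ h0] := hf; have {}h0 := h0 [::] erefl; rewrite /= in h0.
  by rewrite h0; exact: poly_fun0.
have [sf _] := hf.
have sp a := smooth_partial a sf.
pose h (x : V) := \sum_a x 0 a * ray_integral 0 (partial a f) x.
have sh : smooth h.
  by apply: smooth_sum => a _; apply: smooth_coordM; exact: smooth_ray_integral.
pose g (x : V) := f x + -1 * h x.
have sg : smooth g by apply: smoothD; [exact: sf|exact: smoothZ].
have g0 a x : partial a g x = 0.
  rewrite /g partialD; [|exact: sf|exact: smoothZ].
  rewrite partialZ; last exact: sh.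
  have -> : partial a h = partial a f by exact (closed_gradient sp (fun b => partialC a b sf)).
  by rewrite mulN1r subrr.
have gc x : g x = g 0.
  have hd y : is_derive y x g 0.
    by apply: (is_derive_eq (smooth_is_derive_dir y x sg)); apply: big1 => a _; rewrite g0 mulr0.
  have [th _] := line_MVT 0 1 hd.
  by rewrite scale1r addr0 mulr0 => /eqP; rewrite subr_eq0 => /eqP.
have -> : f = fun x => g 0 + h x.
  by apply/funext => x; rewrite -(gc x) /g mulN1r subrK.
apply: poly_funD; first exact: poly_fun_cst.
apply: poly_fun_sum => a _; apply: poly_fun_coordM; apply: ray_integral_poly; apply: IH.
exact: flat_partialV.
Qed.

End Polynomials.

(** * Symmetrizers and Garnir relations *)

Local Opaque smooth.
(* [set x | P x] and [set x] now denote finite sets. *)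
Local Close Scope classical_set_scope.

Lemma eq_opp_eq0 (R : realType) (V : lmodType R) (x : V) : x = - x -> x = 0.
Proof.
move=> h; apply/eqP; have : 2%:R *: x == 0 by rewrite scaler_nat mulr2n {2}h subrr.
by rewrite scaler_eq0 pnatr_eq0.
Qed.

Section Permute.
Variables (R : realType) (D p : nat).
Implicit Types (s t : 'S_p) (T U : tensor R D p) (f : multi_index D p).
Local Notation perm_ix := (@permute_indices R D p).

Definition reindex_by s f : multi_index D p := [ffun i => f (s i)].

Lemma permE_ix s T f : perm_ix s T f = T (reindex_by s f).
Proof. by rewrite ffunE. Qed.

Lemma reindex_byM s t f : reindex_by t (reindex_by s f) = reindex_by (t * s)%g f.
Proof. by apply/ffunP => i; rewrite !ffunE permM. Qed.

Lemma reindex_by1 f : reindex_by 1%g f = f.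
Proof. by apply/ffunP => i; rewrite !ffunE perm1. Qed.

Lemma permute_indicesM s t T : perm_ix s (perm_ix t T) = perm_ix (t * s)%g T.
Proof. by apply/ffunP => f; rewrite !permE_ix reindex_byM. Qed.

Lemma permute_indices1 T : perm_ix 1%g T = T.
Proof. by apply/ffunP => f; rewrite !permE_ix reindex_by1. Qed.

Lemma permute_indices_is_linear s : linear (perm_ix s).
Proof. by move=> a T U; apply/ffunP => f; rewrite !ffunE. Qed.
HB.instance Definition _ s := GRing.isLinear.Build R (tensor R D p) (tensor R D p) _
  (perm_ix s) (permute_indices_is_linear s).

End Permute.

(** * Stabilizers of labellings and the symmetrizers attached to them *)

Section Stab.
Variables (p : nat) (I : eqType).
Implicit Types (s t : 'S_p) (lab : 'I_p -> I).

Definition stab lab : {set 'S_p} := [set s : 'S_p | [forall i, lab (s i) == lab i]].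

Lemma stabP lab s : reflect (forall i, lab (s i) = lab i) (s \in stab lab).
Proof. by rewrite inE; apply: (iffP forallP) => h i; apply/eqP; apply: h. Qed.

Lemma stab1 lab : 1%g \in stab lab.
Proof. by apply/stabP => i; rewrite perm1. Qed.

Lemma stabM lab s t : s \in stab lab -> t \in stab lab -> (s * t)%g \in stab lab.
Proof. by move=> /stabP hs /stabP ht; apply/stabP => i; rewrite permM ht hs. Qed.

Lemma stabV lab s : s \in stab lab -> (s^-1)%g \in stab lab.
Proof. by move=> /stabP hs; apply/stabP => i; rewrite -{2}(permKV s i) hs. Qed.

Lemma stabMr lab s t : t \in stab lab -> ((s * t)%g \in stab lab) = (s \in stab lab).
Proof.
move=> ht; apply/idP/idP => h; last exact: stabM.
by rewrite -(mulgK t s); apply: stabM => //; exact: stabV.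
Qed.

Lemma stabMl lab s t : t \in stab lab -> ((t * s)%g \in stab lab) = (s \in stab lab).
Proof.
move=> ht; apply/idP/idP => h; last exact: stabM.
by rewrite -(mulKg t s); apply: stabM => //; exact: stabV.
Qed.

Lemma stab_tperm lab a b : lab a = lab b -> tperm a b \in stab lab.
Proof. by move=> h; apply/stabP => i; case: tpermP => // ->. Qed.

(** Transpositions inside label classes generate the stabilizer: composing [s] with the
    transposition of [i] and [s i] fixes [s i] and moves no new cell. *)
Lemma stab_ind lab (Pr : 'S_p -> Prop) : Pr 1%g ->
  (forall s a b, a != b -> lab a = lab b -> s \in stab lab -> Pr s -> Pr (tperm a b * s)%g) ->
  forall s, s \in stab lab -> Pr s.
Proof.
move=> P1 PM s; have [n] := ubnP #|[set i | s i != i]|.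
elim: n s => // n IH s; rewrite ltnS => hn hs.
have [/eqP e|] := boolP (s == 1%g); first by rewrite e.
move=> /eqP ns1; have [i hi] : exists i, s i != i.
  apply/existsP; apply: contra_notT ns1 => /existsPn h.
  by apply/permP => i; rewrite perm1; apply/eqP; rewrite -[_ == _]negbK h.
have hl : lab i = lab (s i) by rewrite (stabP _ _ hs).
rewrite -(mulKg (tperm i (s i)) s) tpermV.
set t := (tperm i (s i) * s)%g.
have ht : t \in stab lab by rewrite stabMl // stab_tperm.
apply: PM => //; first by rewrite eq_sym.
apply: IH => //; apply: (leq_trans _ hn); apply: proper_card.
apply/properP; split.
  apply/fintype.subsetP => z; rewrite !inE /t permM; apply: contraNN => /eqP sz.
  rewrite tpermD ?sz //; first by apply: contra_neq hi => ->.
  by apply/eqP => e; have iz := perm_inj (etrans e (esym sz)); rewrite iz sz eqxx in hi.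
exists (s i); rewrite !inE; first by rewrite (inj_eq perm_inj).
by rewrite /t permM tpermR eqxx.
Qed.

Lemma stab_fiber_card lab z b : lab b = lab z ->
  #|[set s : 'S_p in stab lab | s z == b]| = #|[set s : 'S_p in stab lab | s z == z]|.
Proof.
move=> hb; have ht : tperm b z \in stab lab by exact: stab_tperm.
rewrite -[RHS](card_imset _ (@mulIg _ (tperm b z))); apply: eq_card => s.
apply/idP/imsetP => [|[t + ->]].
  rewrite inE => /andP[hs /eqP sz]; exists (s * tperm b z)%g; last by rewrite -mulgA tperm2 mulg1.
  by rewrite inE stabMr // hs permM sz tpermL /=.
by move=> ht'; move: ht'; rewrite [t \in _]inE => /andP[h1 /eqP h2]; rewrite inE stabMr // h1 permM h2 tpermR /=.
Qed.

Lemma stab_fiber_gt0 lab z : (0 < #|[set s : 'S_p in stab lab | s z == z]|)%N.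
Proof.
by apply/card_gt0P; exists 1%g; rewrite inE stab1 perm1 eqxx.
Qed.

(** As [s] runs through the stabilizer, [s z] is equidistributed over the label class of [z]. *)
Lemma stab_sum (V : nmodType) lab z (F : 'I_p -> V) :
  \sum_(s in stab lab) F (s z) =
  (\sum_(b | lab b == lab z) F b) *+ #|[set s : 'S_p in stab lab | s z == z]|.
Proof.
rewrite (partition_big (fun s : 'S_p => s z) (fun b => lab b == lab z)) /=; last first.
  by move=> s /stabP ->.
rewrite -sumrMnl; apply: eq_bigr => b /eqP hb.
rewrite (eq_bigr (fun=> F b)); last by move=> s /andP[_ /eqP ->].
rewrite sumr_const; congr (_ *+ _); rewrite -(stab_fiber_card hb).
by rewrite cardsE.
Qed.

End Stab.

Section GroupSums.
Variables (R : realType) (D p : nat) (I : eqType).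
Implicit Types (s t : 'S_p) (T U : tensor R D p) (lab : 'I_p -> I) (e : bool).
Local Notation perm_ix := (@permute_indices R D p).

Definition stab_sgn e s : R := (-1) ^+ (e && odd_perm s).

Lemma stab_sgnM e s t : stab_sgn e (s * t)%g = stab_sgn e s * stab_sgn e t.
Proof. by case: e; rewrite /stab_sgn /= ?mulr1 // odd_permM signr_addb. Qed.

Lemma stab_sgn_sq e s : stab_sgn e s * stab_sgn e s = 1.
Proof. by rewrite /stab_sgn -signr_addb addbb. Qed.

Lemma stab_sgnV e s : stab_sgn e (s^-1)%g = stab_sgn e s.
Proof. by rewrite /stab_sgn odd_permV. Qed.

Lemma stab_sgn_tperm e (a b : 'I_p) : a != b -> stab_sgn e (tperm a b) = (-1) ^+ e.
Proof. by move=> h; rewrite /stab_sgn odd_tperm h andbT. Qed.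

(* Symmetrization ([e = false]) or antisymmetrization ([e = true]) over [stab lab]. *)
Definition stab_proj lab e T : tensor R D p :=
  \sum_(s in stab lab) stab_sgn e s *: perm_ix s T.

Lemma stab_proj_is_linear lab e : linear (stab_proj lab e).
Proof.
move=> a T U; rewrite /stab_proj scaler_sumr -big_split /=; apply: eq_bigr => s _.
by rewrite linearP scalerDr !scalerA mulrC.
Qed.
HB.instance Definition _ lab e := GRing.isLinear.Build R (tensor R D p) (tensor R D p) _
  (stab_proj lab e) (stab_proj_is_linear lab e).

Lemma stab_proj_perm lab e s T : s \in stab lab ->
  stab_proj lab e (perm_ix s T) = stab_sgn e s *: stab_proj lab e T.
Proof.
move=> hs; rewrite /stab_proj (reindex_inj (mulgI s^-1)%g) /= scaler_sumr.
apply: eq_big => [t|t _]; first by rewrite stabMl // stabV.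
by rewrite permute_indicesM mulKVg stab_sgnM stab_sgnV scalerA.
Qed.

Lemma perm_stab_proj lab e s T : s \in stab lab ->
  perm_ix s (stab_proj lab e T) = stab_sgn e s *: stab_proj lab e T.
Proof.
move=> hs; rewrite /stab_proj linear_sum /= (reindex_inj (mulIg s^-1)%g) /= scaler_sumr.
apply: eq_big => [t|t _]; first by rewrite stabMr // stabV.
by rewrite linearZ /= permute_indicesM mulgKV stab_sgnM stab_sgnV scalerA mulrC.
Qed.

Lemma stab_proj_inv lab e T :
  (forall s, s \in stab lab -> perm_ix s T = stab_sgn e s *: T) ->
  stab_proj lab e T = #|stab lab|%:R *: T.
Proof.
move=> h; rewrite /stab_proj (eq_bigr (fun=> T)).
  by rewrite sumr_const scaler_nat.
by move=> s hs; rewrite h // scalerA stab_sgn_sq scale1r.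
Qed.

Lemma stab_inv_tperm lab e T :
  (forall a b, a != b -> lab a = lab b -> perm_ix (tperm a b) T = (-1) ^+ e *: T) ->
  forall s, s \in stab lab -> perm_ix s T = stab_sgn e s *: T.
Proof.
move=> h; apply: stab_ind => [|s a b ab hl hs IH].
  by rewrite permute_indices1 /stab_sgn odd_perm1 andbF scale1r.
by rewrite -permute_indicesM h // linearZ /= IH stab_sgnM stab_sgn_tperm // scalerA.
Qed.

Lemma card_stab_neq0 lab : #|stab lab|%:R != 0 :> R.
Proof. by rewrite pnatr_eq0 -lt0n; apply/card_gt0P; exists 1%g; exact: stab1. Qed.

Lemma stab_proj_idem lab e T :
  stab_proj lab e (stab_proj lab e T) = #|stab lab|%:R *: stab_proj lab e T.
Proof. by apply: stab_proj_inv => s hs; rewrite perm_stab_proj. Qed.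

(** Such a [t] permutes the label classes, so conjugation by it preserves the stabilizer and the
    signs. *)
Lemma stab_proj_normal lab e t T (g : I -> I) : (forall i, lab (t i) = g (lab i)) ->
  injective g -> stab_proj lab e (perm_ix t T) = perm_ix t (stab_proj lab e T).
Proof.
move=> ht gi; rewrite /stab_proj linear_sum /= [RHS](reindex_inj (conjg_inj t^-1)%g) /=.
have conjE s i : t ((s ^ t^-1)%g i) = s (t i) by rewrite /conjg invgK !permM permKV.
apply: eq_big => [s|s _].
  apply/stabP/stabP => h i; first by apply: gi; rewrite -!ht conjE h.
  by rewrite -[i](permKV t) -conjE !ht h.
rewrite linearZ /= !permute_indicesM /stab_sgn odd_permJ; congr (_ *: permute_indices _ _).
by rewrite /conjg invgK !mulgA mulgKV.
Qed.

(** A positive definite scalar product making all these symmetrizers self-adjoint; it serves to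
    exclude the scalar 0 in [young_idempotent]. *)
Definition tensor_dot T U : R := \sum_f T f * U f.

Lemma tensor_dot_perm s T U :
  tensor_dot (perm_ix s T) U = tensor_dot T (perm_ix s^-1%g U).
Proof.
rewrite /tensor_dot (reindex (reindex_by s^-1%g)) /=.
  by apply: eq_bigr => f _; rewrite !permE_ix reindex_byM mulgV reindex_by1.
by exists (reindex_by s) => f _; rewrite reindex_byM ?mulgV ?mulVg reindex_by1.
Qed.

Lemma tensor_dotC T U : tensor_dot T U = tensor_dot U T.
Proof. by apply: eq_bigr => f _; rewrite mulrC. Qed.

Lemma tensor_dot_is_linear T : linear_for *%R (tensor_dot T).
Proof.
move=> a U V; rewrite /tensor_dot mulr_sumr -big_split /=; apply: eq_bigr => f _.
by rewrite !ffunE mulrDr mulrCA.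
Qed.
HB.instance Definition _ T := GRing.isLinear.Build R (tensor R D p) R _
  (tensor_dot T) (tensor_dot_is_linear T).

Lemma tensor_dot_stab_proj lab e T U :
  tensor_dot (stab_proj lab e T) U = tensor_dot T (stab_proj lab e U).
Proof.
rewrite tensor_dotC /stab_proj !linear_sum /= (reindex_inj invg_inj) /=.
apply: eq_big => [s|s _].
  by apply/idP/idP => h; [rewrite -[s]invgK|]; exact: stabV.
by rewrite !linearZ /= stab_sgnV [tensor_dot U _]tensor_dotC tensor_dot_perm invgK.
Qed.

Lemma tensor_dot_eq0 T : tensor_dot T T = 0 -> T = 0.
Proof.
move=> h; apply/ffunP => f; rewrite ffunE.
have e : \sum_f T f ^+ 2 = 0 by rewrite -[RHS]h; apply: eq_bigr => g _; rewrite expr2.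
have := psumr_eq0P (fun g _ => sqr_ge0 (T g)) e (isT : xpredT f).
by move=> h2; apply/eqP; rewrite -sqrf_eq0; apply/eqP.
Qed.

End GroupSums.

(** * Young symmetrizers and the Garnir relations *)

Section Young.
Variables (R : realType) (N p : nat).
Local Notation col := (@young_col N p).
Local Notation row := (@young_row N p).
Local Notation P s T := (permute_indices s T).

Lemma row_symE D (T : tensor R D p) : row_sym N T = stab_proj row false T.
Proof. by apply: eq_bigr => s _; rewrite /stab_sgn scale1r. Qed.

Lemma col_antisymE D (T : tensor R D p) : col_antisym N T = stab_proj col true T.
Proof. by []. Qed.

Lemma row_sym_is_linear D : linear (@row_sym R N D p).
Proof. by move=> a T U; rewrite !row_symE linearP. Qed.
HB.instance Definition _ D := GRing.isLinear.Build R (tensor R D p) (tensor R D p) _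
  (@row_sym R N D p) (@row_sym_is_linear D).

Lemma col_antisym_is_linear D : linear (@col_antisym R N D p).
Proof. by move=> a T U; rewrite !col_antisymE linearP. Qed.
HB.instance Definition _ D := GRing.isLinear.Build R (tensor R D p) (tensor R D p) _
  (@col_antisym R N D p) (@col_antisym_is_linear D).

Definition col_alternating D (Y : tensor R D p) :=
  forall a b : 'I_p, a != b -> col a = col b -> P (tperm a b) Y = - Y.

(** Exchange relations of a single cell: [y] is exchanged in turn with every cell of a column
    further left. They are linear in [Y], hence inherited under operators acting componentwise. *)
Definition garnir D (Y : tensor R D p) := col_alternating Y /\
  forall c y, (c < col y)%N -> Y = \sum_(i | col i == c) P (tperm i y) Y.

Lemma col_antisym_tperm D (Y : tensor R D p) (a b : 'I_p) : a != b -> col a = col b ->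
  col_antisym N (P (tperm a b) Y) = - col_antisym N Y.
Proof.
move=> ab h; rewrite !col_antisymE stab_proj_perm; last exact: stab_tperm.
by rewrite stab_sgn_tperm // expr1 scaleN1r.
Qed.

Lemma col_antisym_alternating D (Y : tensor R D p) : col_alternating (col_antisym N Y).
Proof.
move=> a b ab h; rewrite !col_antisymE perm_stab_proj; last exact: stab_tperm.
by rewrite stab_sgn_tperm // expr1 scaleN1r.
Qed.

Lemma col_alternatingP D (Y : tensor R D p) : col_alternating Y ->
  col_antisym N Y = #|col_stab N p|%:R *: Y.
Proof.
move=> h; rewrite col_antisymE; apply: stab_proj_inv; apply: stab_inv_tperm => a b ab hc.
by rewrite h // expr1 scaleN1r.
Qed.

Lemma row_sym_tperm D (T : tensor R D p) (a b : 'I_p) : row a = row b ->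
  P (tperm a b) (row_sym N T) = row_sym N T.
Proof.
by move=> h; rewrite row_symE perm_stab_proj ?scale1r //; exact: stab_tperm.
Qed.

Lemma cell_inj (i j : 'I_p) : row i = row j -> col i = col j -> i = j.
Proof.
by rewrite /young_row /young_col => hr hc; apply: val_inj; rewrite /= (divn_eq i N.-1) hr hc -divn_eq.
Qed.

Lemma cell_left (y : 'I_p) c : (c < col y)%N -> exists2 j : 'I_p, row j = row y & col j = c.
Proof.
rewrite /young_col /young_row; case: (N.-1) => [|m] hc.
  rewrite modn0 in hc.
  by exists (Ordinal (ltn_trans hc (ltn_ord y))); rewrite ?divn0 ?modn0.
have lt_j : (y %/ m.+1 * m.+1 + c < p)%N.
  by rewrite (leq_trans _ (ltn_ord y)) // [X in (_ < X.+1)%N](divn_eq y m.+1) ltnS leq_add2l ltnW.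
have cm : (c < m.+1)%N by rewrite (ltn_trans hc) // ltn_mod.
exists (Ordinal lt_j) => /=; first by rewrite divnMDl // (divn_small cm) addn0.
by rewrite modnMDl modn_small.
Qed.

Lemma garnir_young D (V : tensor R D p) : garnir (col_antisym N (row_sym N V)).
Proof.
split; first exact: col_antisym_alternating.
move=> c y hc; set R0 := row_sym N V.
(* [R0] is row symmetric, so the transposition of [j] with the cell of column [c] in the row of
   [y'] matches the terms in pairs of opposite signs. *)
have cancel (j y' : 'I_p) : (c < col y')%N -> col j = c -> row j != row y' ->
    \sum_(s | (s \in stab col) && (s^-1%g y == y'))
      stab_sgn R true s *: P s (P (tperm j y') R0) = 0.
  move=> hy' hj hr; set Z := \sum_(_ | _) _.
  have [j0 rj0 cj0] := cell_left hy'.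
  have j_y' : j != y' by apply: contra_neq hr => ->.
  have j0_y' : j0 != y' by apply/eqP => e; move: hy'; rewrite -cj0 e ltnn.
  have j_j0 : j != j0 by apply: contra_neq hr => ->.
  have fixR0 : P (tperm j j0) (P (tperm j y') R0) = P (tperm j y') R0.
    rewrite permute_indicesM.
    have -> : (tperm j y' * tperm j j0 = tperm y' j0 * tperm j y')%g.
      have <- : (tperm j j0 ^ tperm j y' = tperm y' j0)%g by rewrite tpermJ tpermL tpermD // eq_sym.
      by rewrite /conjg tpermV -!mulgA tperm2 mulg1.
    by rewrite -permute_indicesM row_sym_tperm.
  have tst : tperm j j0 \in stab col by apply: stab_tperm; rewrite cj0.
  have ZN : Z = - Z.
    rewrite [LHS](reindex_inj (mulgI (tperm j j0))) /= -sumrN.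
    apply: eq_big => [s|s _]; first rewrite stabMl //.
      congr (_ && _); rewrite invMg permM tpermV; case: tpermP => // ->.
        by rewrite (negbTE j_y') (negbTE j0_y').
      by rewrite (negbTE j_y') (negbTE j0_y').
    rewrite -permute_indicesM fixR0 stab_sgnM stab_sgn_tperm // expr1 mulN1r scaleNr.
    by [].
  exact: eq_opp_eq0.
rewrite col_antisymE /stab_proj.
pose F s (j : 'I_p) := stab_sgn R true s *: P s (P (tperm j (s^-1%g y)) R0).
transitivity (\sum_(s in stab col) \sum_(j | col j == c) F s j); last first.
  under [RHS]eq_bigr do rewrite linear_sum /=.
  rewrite [RHS]exchange_big /=; apply: eq_bigr => s /stabP hs.
  rewrite [RHS](reindex_inj (@perm_inj _ s)) /=; apply: eq_big => [i|i _]; first by rewrite hs.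
  rewrite linearZ /= /F !permute_indicesM; congr (_ *: P _ _).
  rewrite -[y in RHS](permKV s) -tpermJ /conjg.
  by rewrite !mulgA mulgV mul1g.
have yV s : s \in stab col -> (c < col (s^-1%g y))%N.
  by move=> hs; rewrite (stabP _ _ (stabV hs)).
transitivity (\sum_(s in stab col) stab_sgn R true s *: P s R0 +
    \sum_(s in stab col) \sum_(j | (col j == c) && (row j != row (s^-1%g y))) F s j).
  rewrite [X in _ + X](_ : _ = 0) ?addr0 //.
  (* Grouping by [y' = s^-1 y] fixes the transposition, so that [cancel] applies to each group. *)
  rewrite (partition_big (fun s : 'S_p => s^-1%g y) xpredT) //=; apply: big1 => y' _.
  have [hy'|hy'] := ltnP c (col y'); last first.
    by rewrite big_pred0 // => s; apply/andP => -[hs /eqP e]; have := yV _ hs; rewrite e ltnNge hy'.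
  rewrite (eq_bigr (fun s : 'S_p => \sum_(j | (col j == c) && (row j != row y'))
      stab_sgn R true s *: P s (P (tperm j y') R0))); last by move=> s /andP[_ /eqP <-].
  by rewrite exchange_big /= big1 // => j /andP[/eqP hj hr]; exact: cancel.
rewrite -big_split /=; apply: eq_bigr => s hs.
(* Column [c] has a single cell in the row of [s^-1 y]; for it the transposition is absorbed by the
   row symmetry and the original term remains. *)
rewrite [RHS](bigID (fun j => row j == row (s^-1%g y))) /=; congr (_ + _).
have [j0 rj0 cj0] := cell_left (yV _ hs).
rewrite (big_pred1 j0) ?/F ?row_sym_tperm // => j /=.
apply/andP/eqP => [[/eqP h1 /eqP h2]|->]; last by rewrite cj0 rj0 !eqxx.
by apply: cell_inj; rewrite ?h1 ?h2.
Qed.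

End Young.

Section Idempotent.
Variables (R : realType) (N p : nat).
Local Notation col := (@young_col N p).
Local Notation row := (@young_row N p).
Local Notation P s T := (permute_indices s T).

(* Induction on the number of cells that [s] moves to another column: the Garnir relation at a
   cell moved to the left either lowers this number or reproduces the term with a sign. *)
Lemma garnir_perm_scalar (s : 'S_p) : exists k : R, forall D (Y : tensor R D p),
  garnir N Y -> col_antisym N (P s Y) = k *: Y.
Proof.
have [n] := ubnP #|[set z | col (s z) != col z]|.
elim: n s => // n IH s; rewrite ltnS => hn.
have [/existsP[y hy]|] := boolP [exists y, (col (s y) < col y)%N]; last first.
  move=> /existsPn h; exists (stab_sgn R true s * #|col_stab N p|%:R) => D Y [hY _].
  have hs : s \in stab col.
    (* No cell moves to the left and the sum of all column numbers is invariant, so no cell changes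
       column. *)
    have hle (z : 'I_p) : (col z <= col (s z) ?= iff (col z == col (s z)))%N.
      by apply: leqif_eq; rewrite leqNgt h.
    have [_] := leqif_sum (fun z (_ : true) => hle z).
    rewrite -(reindex_inj (@perm_inj _ s) (P := xpredT) (F := fun z : 'I_p => col z)) eqxx.
    by move=> /esym/forallP h'; apply/stabP => z; apply/esym/eqP; exact: h'.
  by rewrite col_antisymE stab_proj_perm // -col_antisymE col_alternatingP // scalerA.
set c := col (s y) in hy.
have y_notc i : col i = c -> i != y by move=> e; apply/eqP => e'; rewrite -e e' ltnn in hy.
(* The permutation [tperm i y * s] sends [i] to [s y], which lies in the column [c] of [i]: thus [i]
   leaves the set of moved cells, to which [y] already belonged. *)
have /choice [k hk] i : exists k : R, col i = c -> col (s i) != c -> forall D (Y : tensor R D p),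
    garnir N Y -> col_antisym N (P (tperm i y * s)%g Y) = k *: Y.
  have [/eqP h1|] := boolP (col i == c); last by move=> /eqP; exists 0.
  have [|h2] := boolP (col (s i) == c); first by exists 0.
  have [|k hk] := IH (tperm i y * s)%g; last by exists k.
  apply: leq_trans hn; apply: proper_card; apply/properP; split; last first.
    by exists i; rewrite !inE h1 // permM tpermL /c eqxx.
  apply/fintype.subsetP => z; rewrite !inE permM; case: tpermP => [->|->|//].
    by rewrite h1 eqxx.
  by move=> _; rewrite neq_ltn hy.
pose m := #|[pred i | (col i == c) && (col (s i) == c)]|.
exists (m.+1%:R^-1 * \sum_(i | (col i == c) && (col (s i) != c)) k i) => D Y hY.
have [hY1 hY2] := hY.
set X := col_antisym N (P s Y).
have E : X = - (m%:R *: X) + (\sum_(i | (col i == c) && (col (s i) != c)) k i) *: Y.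
  have {1}-> : X = \sum_(i | col i == c) col_antisym N (P s (P (tperm i y) Y)).
    by rewrite /X {1}(hY2 _ _ hy) linear_sum (linear_sum (@col_antisym R N D p)).
  rewrite (bigID (fun i => col (s i) == c)) /=.
  congr (_ + _); last first.
    rewrite scaler_suml; apply: eq_bigr => i /andP[/eqP h1 h2].
    by rewrite permute_indicesM hk.
  rewrite -sumr_const scaler_suml -sumrN; apply: eq_bigr => i /andP[/eqP h1 /eqP h2].
  rewrite scale1r permute_indicesM.
  have -> : (tperm i y * s = s * tperm (s i) (s y))%g.
    by rewrite -tpermJ /conjg !mulgA mulgV mul1g.
  by rewrite -permute_indicesM col_antisym_tperm // (inj_eq perm_inj) y_notc.
have H : m.+1%:R *: X = (\sum_(i | (col i == c) && (col (s i) != c)) k i) *: Y.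
  by rewrite -addn1 natrD scalerDl scale1r {2}E addrA subrr add0r.
by rewrite -scalerA -H scalerA mulVf ?scale1r // pnatr_eq0.
Qed.

Lemma row_col_stab1 (s : 'S_p) : s \in stab row -> s \in stab col -> s = 1%g.
Proof.
move=> /stabP h1 /stabP h2; apply/permP => i; rewrite perm1.
exact: cell_inj.
Qed.

(** The tensor [e] is the product of the [p] basis vectors in dimension [p]. Its image has component
    1 at the identity multi-index, because a row permutation that is also a column permutation is
    trivial. *)
Lemma young_test_neq0 : exists e : tensor R p p, col_antisym N (row_sym N e) != 0.
Proof.
pose i0 : multi_index p p := [ffun i => i].
pose e : tensor R p p := [ffun f => (f == i0)%:R].
have eE (s t : 'S_p) : e (reindex_by t (reindex_by s i0)) = (s == t^-1%g)%:R.
  rewrite ffunE; congr (nat_of_bool _)%:R; apply/eqP/eqP => [/ffunP h|->].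
    by apply/permP => i; have := h (t^-1%g i); rewrite !ffunE permKV.
  by apply/ffunP => i; rewrite !ffunE permK.
have rowE s : s \in stab col -> row_sym N e (reindex_by s i0) = (s == 1%g)%:R.
  move=> hs; rewrite row_symE sum_ffunE (bigD1 1%g) /=; last exact: stab1.
  rewrite ffunE permE_ix eE invg1 /stab_sgn expr0 scale1r big1 ?addr0 //.
  move=> t /andP[ht t1]; rewrite ffunE permE_ix eE.
  case: eqP => [st|]; last by rewrite scaler0.
  have h1 : s = 1%g by apply: row_col_stab1; rewrite // st stabV.
  by case/eqP: t1; rewrite -[t]invgK -st h1 invg1.
exists e; apply/eqP => /ffunP/(_ i0); apply/eqP.
rewrite ffunE col_antisymE /stab_proj sum_ffunE (bigD1 1%g) /=; last exact: stab1.
rewrite ffunE permE_ix rowE ?stab1 // eqxx /stab_sgn odd_perm1 expr0 scale1r big1 ?addr0 ?oner_eq0 //.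
by move=> s /andP[hs /negbTE s1]; rewrite ffunE permE_ix rowE // s1 scaler0.
Qed.

(** The scalar comes from [garnir_perm_scalar], uniformly in [D], so it can be tested in dimension
    [p]. Write A and S for the two symmetrizers: they are self-adjoint and proportional to
    projections. If the scalar were 0, then A S A S e = 0, whence S A S e = 0 and A S e = 0 by
    positivity of the scalar product. *)
Lemma young_idempotent : exists2 k : R, k != 0 & forall D (Y : tensor R D p),
  garnir N Y -> col_antisym N (row_sym N Y) = k *: Y.
Proof.
have /choice [kf hk] := garnir_perm_scalar.
pose k := \sum_(s in stab row) kf s.
have hkS D (Y : tensor R D p) : garnir N Y -> col_antisym N (row_sym N Y) = k *: Y.
  move=> hY; rewrite row_symE /stab_proj linear_sum scaler_suml; apply: eq_bigr => s _.
  by rewrite /stab_sgn /= scale1r hk.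
exists k => //; have [e he] := young_test_neq0; apply: contraNneq he => k0.
pose S (T : tensor R p p) := row_sym N T; pose A (T : tensor R p p) := col_antisym N T.
have h1 : A (S (A (S e))) = 0 by rewrite /A hkS ?k0 ?scale0r //; exact: garnir_young.
have SS T : S (S T) = #|row_stab N p|%:R *: S T by rewrite /S !row_symE stab_proj_idem.
have AA T : A (A T) = #|col_stab N p|%:R *: A T by rewrite /A !col_antisymE stab_proj_idem.
have dS T U : tensor_dot (S T) U = tensor_dot T (S U).
  by rewrite /S !row_symE tensor_dot_stab_proj.
have dA T U : tensor_dot (A T) U = tensor_dot T (A U).
  by rewrite /A !col_antisymE tensor_dot_stab_proj.
have h2 : S (A (S e)) = 0.
  by apply: tensor_dot_eq0; rewrite dS SS dA {1}/A linearZ /= -/(A _) h1 scaler0 linear0.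
have : A (S e) = 0.
  by apply: tensor_dot_eq0; rewrite dA AA linearZ /= dS h2 linear0 mulr0.
by move/eqP.
Qed.

Lemma row_symZ D c (Y : tensor R D p) : row_sym N (c *: Y) = c *: row_sym N Y.
Proof. exact: linearZ. Qed.

Lemma col_antisymZ D c (Y : tensor R D p) : col_antisym N (c *: Y) = c *: col_antisym N Y.
Proof. exact: linearZ. Qed.

(** Images of the projection satisfy the relations by [garnir_young]. Conversely [young_idempotent]
    makes a Garnir tensor proportional to its own image; both branches of [xget] give a nonzero
    [young_norm]. *)
Lemma garnir_in_young D (Y : tensor R D p) : garnir N Y <-> young_type N Y.
Proof.
have [k k0 hk] := young_idempotent.
have n0 : young_norm R N D p != 0.
  rewrite /young_norm; case: xgetP => [c _ [] //|_]; exact: oner_neq0.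
split=> [hY|[T _ <-]].
  exists ((young_norm R N D p * k)^-1 *: Y) => //.
  rewrite /young_proj row_symZ col_antisymZ hk //.
  by rewrite !scalerA mulrAC mulfV ?scale1r // mulf_neq0.
rewrite /young_proj -col_antisymZ -row_symZ.
exact: garnir_young.
Qed.

End Idempotent.

(** * Iterated gradients *)

Section Fields.
Variables (R : realType) (D : nat).
Local Notation P s T := (permute_indices s T).

Definition smooth_field p (Z : tensor_field R D p) := forall f, smooth (fun x => Z x f).

Definition restrict_ix j q (le : (j <= q)%N) (f : multi_index D q) : multi_index D j :=
  [ffun i => f (widen_ord le i)].

(** Viewing [T] as a field of degree [q], constant in the indices of the cells from [j] on, lets
    permutations of all [q] cells act on it and on its gradients. *)
Definition ext j q (le : (j <= q)%N) (T : tensor_field R D j) : tensor_field R D q :=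
  fun x => [ffun f => T x (restrict_ix le f)].

(* Differentiation along the index carried by each cell of [cs]. *)
Definition dcells q (cs : seq 'I_q) (Z : tensor_field R D q) : tensor_field R D q :=
  fun x => [ffun f => foldr (@partial R D) (fun y => Z y f) [seq f c | c <- cs] x].

Definition cells_from j q : seq 'I_q := [seq c : 'I_q <- enum 'I_q | (j <= c)%N].

Lemma mem_cells_from j q c : (c \in cells_from j q) = (j <= c)%N.
Proof. by rewrite mem_filter mem_enum andbT. Qed.

Lemma cells_from_uniq j q : uniq (cells_from j q).
Proof. by rewrite filter_uniq // enum_uniq. Qed.

Definition igrad j q (le : (j <= q)%N) (T : tensor_field R D j) : tensor_field R D q :=
  dcells (cells_from j q) (ext le T).

Lemma smooth_ext j q (le : (j <= q)%N) (T : tensor_field R D j) :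
  smooth_field T -> smooth_field (ext le T).
Proof.
move=> hT f; rewrite (_ : (fun x => _) = fun x => T x (restrict_ix le f)); first exact: hT.
by apply/funext => x; rewrite ffunE.
Qed.

Lemma dcellsE q (cs : seq 'I_q) (Z : tensor_field R D q) f :
  (fun x => dcells cs Z x f) = foldr (@partial R D) (fun y => Z y f) [seq f c | c <- cs].
Proof. by apply/funext => x; rewrite ffunE. Qed.

Lemma smooth_dcells q (cs : seq 'I_q) (Z : tensor_field R D q) :
  smooth_field Z -> smooth_field (dcells cs Z).
Proof. by move=> hZ f; rewrite dcellsE; apply: smooth_foldr; exact: hZ. Qed.

Lemma smooth_igrad j q (le : (j <= q)%N) (T : tensor_field R D j) :
  smooth_field T -> smooth_field (igrad le T).
Proof. by move=> hT; apply: smooth_dcells; exact: smooth_ext. Qed.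

Lemma smooth_perm p (s : 'S_p) (Z : tensor_field R D p) :
  smooth_field Z -> smooth_field (fun x => P s (Z x)).
Proof.
move=> hZ f; rewrite (_ : (fun x => _) = fun x => Z x (reindex_by s f)); first exact: hZ.
by apply/funext => x; rewrite permE_ix.
Qed.

Lemma smooth_fieldZ p (c : R) (Z : tensor_field R D p) :
  smooth_field Z -> smooth_field (fun x => c *: Z x).
Proof.
move=> hZ f; rewrite (_ : (fun x => _) = fun x => c * Z x f); first exact: smoothZ.
by apply/funext => x; rewrite ffunE.
Qed.

Lemma smooth_fieldD p (Y Z : tensor_field R D p) : smooth_field Y ->
  smooth_field Z -> smooth_field (fun x => Y x + Z x).
Proof.
move=> hY hZ f; rewrite (_ : (fun x => _) = fun x => Y x f + Z x f).
  by apply: smoothD; [exact: hY|exact: hZ].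
by apply/funext => x; rewrite ffunE.
Qed.

Lemma smooth_field_sum p (I : Type) (r : seq I) (Q : pred I) (F : I -> tensor_field R D p) :
  (forall i, Q i -> smooth_field (F i)) -> smooth_field (fun x => \sum_(i <- r | Q i) F i x).
Proof.
move=> hF f; rewrite (_ : (fun x => _) = fun x => \sum_(i <- r | Q i) F i x f).
  by apply: smooth_sum => i Qi; exact: hF.
by apply/funext => x; rewrite sum_ffunE.
Qed.

Lemma smooth_stab_proj p (I : eqType) (lab : 'I_p -> I) e (Z : tensor_field R D p) :
  smooth_field Z -> smooth_field (fun x => stab_proj lab e (Z x)).
Proof.
move=> hZ; apply: smooth_field_sum => s _; apply: smooth_fieldZ; exact: smooth_perm.
Qed.

Lemma foldr_partial_lin (I : Type) (r : seq I) (Q : pred I) (k : I -> R)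
    (F : I -> 'rV[R]_D -> R) s : (forall i, Q i -> smooth (F i)) ->
  foldr (@partial R D) (fun x => \sum_(i <- r | Q i) k i * F i x) s =
  fun x => \sum_(i <- r | Q i) k i * foldr (@partial R D) (F i) s x.
Proof.
move=> hF; elim: s => [|a s /= ->]; first reflexivity.
have hs i : Q i -> smooth (foldr (@partial R D) (F i) s).
  by move=> Qi; apply: smooth_foldr; exact: hF.
rewrite partial_sum; last by move=> i Qi; apply: smoothZ; exact: hs.
by apply/funext => x; apply: eq_bigr => i Qi; rewrite partialZ; [|exact: hs].
Qed.

Lemma dcells_sum q (cs : seq 'I_q) (I : Type) (r : seq I) (Q : pred I)
    (k : I -> R) (F : I -> tensor_field R D q) x : (forall i, Q i -> smooth_field (F i)) ->
  dcells cs (fun y => \sum_(i <- r | Q i) k i *: F i y) x =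
  \sum_(i <- r | Q i) k i *: dcells cs (F i) x.
Proof.
move=> hF; apply/ffunP => f; rewrite ffunE sum_ffunE.
transitivity (foldr (@partial R D) (fun y => \sum_(i <- r | Q i) k i * F i y f) [seq f c | c <- cs] x).
  congr (foldr _ _ _ x); apply/funext => y; rewrite sum_ffunE.
  by apply: eq_bigr => i _; rewrite ffunE.
rewrite foldr_partial_lin; last by move=> i Qi; exact: hF.
by apply: eq_bigr => i _; rewrite !ffunE.
Qed.

Lemma dcellsZ q (cs : seq 'I_q) (c : R) (Z : tensor_field R D q) x : smooth_field Z ->
  dcells cs (fun y => c *: Z y) x = c *: dcells cs Z x.
Proof.
move=> hZ; have := @dcells_sum q cs unit [:: tt] xpredT (fun=> c) (fun=> Z) x (fun _ _ => hZ).
rewrite big_seq1 => <-; congr (dcells cs _ x); apply/funext => y.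
by rewrite big_seq1.
Qed.

Lemma ext_sum j q (le : (j <= q)%N) (I : Type) (r : seq I) (Q : pred I)
    (k : I -> R) (F : I -> tensor_field R D j) :
  ext le (fun y => \sum_(i <- r | Q i) k i *: F i y) =
  fun y => \sum_(i <- r | Q i) k i *: ext le (F i) y.
Proof.
apply/funext => x; apply/ffunP => f; rewrite ffunE !sum_ffunE.
by apply: eq_bigr => i _; rewrite !ffunE.
Qed.

Lemma igrad_sum j q (le : (j <= q)%N) (I : Type) (r : seq I) (Q : pred I)
    (k : I -> R) (F : I -> tensor_field R D j) x : (forall i, Q i -> smooth_field (F i)) ->
  igrad le (fun y => \sum_(i <- r | Q i) k i *: F i y) x =
  \sum_(i <- r | Q i) k i *: igrad le (F i) x.
Proof.
move=> hF; rewrite /igrad ext_sum dcells_sum // => i Qi f; by apply: smooth_ext; exact: hF.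
Qed.

Lemma igradZ j q (le : (j <= q)%N) (c : R) (T : tensor_field R D j) x : smooth_field T ->
  igrad le (fun y => c *: T y) x = c *: igrad le T x.
Proof.
move=> hT; rewrite /igrad -dcellsZ; last exact: smooth_ext.
by congr (dcells _ _ x); apply/funext => y; apply/ffunP => f; rewrite !ffunE.
Qed.

Lemma igradD j q (le : (j <= q)%N) (T U : tensor_field R D j) x : smooth_field T ->
  smooth_field U -> igrad le (fun y => T y + U y) x = igrad le T x + igrad le U x.
Proof.
move=> hT hU.
have h := @igrad_sum j q le bool [:: true; false] xpredT (fun=> 1) (fun b => if b then T else U) x _.
rewrite !big_cons !big_nil !addr0 !scale1r in h; rewrite -h; last by case.
by congr (igrad _ _ x); apply/funext => y; rewrite !big_cons big_nil addr0 !scale1r.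
Qed.

Lemma perm_dcells q (s : 'S_q) (cs : seq 'I_q) (Z : tensor_field R D q) x :
  P s (dcells cs Z x) = dcells (map s cs) (fun y => P s (Z y)) x.
Proof.
apply/ffunP => f; rewrite !ffunE.
rewrite (_ : [seq reindex_by s f c | c <- cs] = [seq f c | c <- map s cs]).
  by congr (foldr _ _ _ x); apply/funext => y; rewrite ffunE.
by rewrite -map_comp; apply: eq_map => c /=; rewrite ffunE.
Qed.

Lemma dcells_perm_eq q (cs cs' : seq 'I_q) (Z : tensor_field R D q) : smooth_field Z ->
  perm_eq cs cs' -> dcells cs Z = dcells cs' Z.
Proof.
move=> hZ h; apply/funext => x; apply/ffunP => f; rewrite !ffunE.
by rewrite (foldr_partial_perm (hZ f) (perm_map f h)).
Qed.

Lemma dcells_cat q (cs cs' : seq 'I_q) (Z : tensor_field R D q) :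
  dcells (cs ++ cs') Z = dcells cs (dcells cs' Z).
Proof.
apply/funext => x; apply/ffunP => f; rewrite !ffunE map_cat foldr_cat.
by congr (foldr _ _ _ x); apply/funext => y; rewrite ffunE.
Qed.

Lemma perm_ext j q (le : (j <= q)%N) (s : 'S_q) (s' : 'S_j) (T : tensor_field R D j) x :
  (forall i, s (widen_ord le i) = widen_ord le (s' i)) ->
  P s (ext le T x) = ext le (fun y => P s' (T y)) x.
Proof.
move=> h; apply/ffunP => f; rewrite !ffunE; congr (T x _).
by apply/ffunP => i; rewrite !ffunE h.
Qed.

Lemma widen_ord_inj j q (le : (j <= q)%N) : injective (widen_ord le).
Proof. by move=> a b h; apply: val_inj; have := congr1 val h. Qed.

Lemma tperm_widen j q (le : (j <= q)%N) (a b i : 'I_j) :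
  tperm (widen_ord le a) (widen_ord le b) (widen_ord le i) = widen_ord le (tperm a b i).
Proof.
case: tpermP => [/widen_ord_inj ->|/widen_ord_inj ->|/eqP h1 /eqP h2]; rewrite ?tpermL ?tpermR //.
by rewrite tpermD //; rewrite eq_sym; [move: h1|move: h2]; apply: contra_neq => ->.
Qed.

Lemma map_tperm_low j q (a b : 'I_q) : (a < j)%N -> (b < j)%N ->
  map (tperm a b) (cells_from j q) = cells_from j q.
Proof.
move=> ha hb; rewrite -[RHS]map_id; apply/eq_in_map => c.
rewrite mem_cells_from => hc; rewrite tpermD //; apply/eqP => e.
  by rewrite e ltnNge hc in ha.
by rewrite e ltnNge hc in hb.
Qed.

Lemma igrad_perm_low j q (le : (j <= q)%N) (a b : 'I_j) (T : tensor_field R D j) x :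
  P (tperm (widen_ord le a) (widen_ord le b)) (igrad le T x) =
  igrad le (fun y => P (tperm a b) (T y)) x.
Proof.
rewrite /igrad perm_dcells map_tperm_low; [|exact: (ltn_ord a)|exact: (ltn_ord b)].
have -> : (fun y => P (tperm (widen_ord le a) (widen_ord le b)) (ext le T y)) =
    ext le (fun y => P (tperm a b) (T y)); last by [].
by apply/funext => y; apply: perm_ext => i; exact: tperm_widen.
Qed.

(** As [s] preserves the first [j] cells, it permutes the derivative cells, and partial derivatives
    commute. *)
Lemma igrad_perm_fix j q (le : (j <= q)%N) (s : 'S_q) (s' : 'S_j) (T : tensor_field R D j) x :
  smooth_field T -> (forall i, s (widen_ord le i) = widen_ord le (s' i)) ->
  P s (igrad le T x) = igrad le (fun y => P s' (T y)) x.
Proof.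
move=> hT h; rewrite /igrad perm_dcells.
have -> : (fun y => P s (ext le T y)) = ext le (fun y => P s' (T y)).
  by apply/funext => y; exact: perm_ext.
congr (_ x); apply: dcells_perm_eq; first by apply: smooth_ext; exact: smooth_perm.
have low (i : 'I_q) : (s i < j)%N = (i < j)%N.
  apply/idP/idP => hi; last first.
    by have := h (Ordinal hi); rewrite (_ : widen_ord _ _ = i) => [->|]; [exact: (ltn_ord (s' _))|exact: val_inj].
  have := h (s'^-1 (Ordinal hi))%g; rewrite permKV => e.
  have e2 : s i = widen_ord le (Ordinal hi) by exact: val_inj.
  by have /perm_inj -> := etrans e2 (esym e); exact: (ltn_ord (s'^-1 (Ordinal hi))%g).
apply: uniq_perm.
- by rewrite map_inj_uniq; [exact: cells_from_uniq|exact: perm_inj].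
- exact: cells_from_uniq.
move=> c; rewrite -[c](permKV s) (mem_map (@perm_inj _ s)).
by rewrite !mem_cells_from leqNgt [in RHS]leqNgt low.
Qed.

Lemma igrad_tperm_high j q (le : (j <= q)%N) (a b : 'I_q) (T : tensor_field R D j) x :
  smooth_field T -> (j <= a)%N -> (j <= b)%N -> P (tperm a b) (igrad le T x) = igrad le T x.
Proof.
move=> hT ha hb.
have fixed (i : 'I_j) : tperm a b (widen_ord le i) = widen_ord le ((1%g : 'S_j) i).
  rewrite perm1 tpermD //; apply/eqP => e.
    by move: ha; rewrite e /= leqNgt ltn_ord.
  by move: hb; rewrite e /= leqNgt ltn_ord.
rewrite (igrad_perm_fix x hT fixed).
congr (_ x); congr igrad; apply/funext => y; exact: permute_indices1.
Qed.

Lemma gradE p (T : tensor_field R D p) : grad T = igrad (leqnSn p) T.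
Proof.
apply/funext => x; apply/ffunP => f; rewrite !ffunE.
have -> : cells_from p p.+1 = [:: ord_max].
  rewrite /cells_from enum_ordSr filter_rcons leqnn filter_map (eq_filter (a2 := pred0)).
    by rewrite filter_pred0.
  by move=> c /=; rewrite leqNgt ltn_ord.
by rewrite /=; congr (partial _ _ x); apply/funext => y; rewrite ffunE.
Qed.

Lemma igrad_refl p (le : (p <= p)%N) (T : tensor_field R D p) : igrad le T = T.
Proof.
apply/funext => x; apply/ffunP => f; rewrite ffunE.
rewrite (_ : cells_from p p = [::]) /=.
  by rewrite ffunE; congr (T x _); apply/ffunP => i; rewrite ffunE; congr (f _); exact: val_inj.
by apply/eqP; rewrite -(negbK (_ == _)) -has_filter -all_predC; apply/allP => c _ /=; rewrite -ltnNge.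
Qed.

Lemma igrad_comp i j q (le1 : (i <= j)%N) (le2 : (j <= q)%N) (le : (i <= q)%N)
    (T : tensor_field R D i) : smooth_field T -> igrad le2 (igrad le1 T) = igrad le T.
Proof.
move=> hT.
have E : ext le2 (igrad le1 T) = dcells (map (widen_ord le2) (cells_from i j)) (ext le T).
  apply/funext => x; apply/ffunP => f; rewrite !ffunE -map_comp.
  congr (foldr _ _ _ x); last by apply: eq_map => c /=; rewrite ffunE.
  apply/funext => y; rewrite !ffunE; congr (T y _).
  by apply/ffunP => k; rewrite !ffunE; congr (f _); exact: val_inj.
rewrite {1}/igrad E -dcells_cat; apply: dcells_perm_eq; first exact: smooth_ext.
apply: uniq_perm.
- rewrite cat_uniq map_inj_uniq; last exact: widen_ord_inj.
  rewrite !cells_from_uniq andbT; apply/hasPn => c /mapP[k _ ->].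
  by rewrite mem_cells_from /= leqNgt ltn_ord.
- exact: cells_from_uniq.
move=> c; rewrite mem_cat !mem_cells_from.
apply/orP/idP => [[hc|/mapP[k + ->]]|hc].
- exact: leq_trans hc.
- by rewrite mem_cells_from.
have [hjc|hcj] := leqP j c; [by left|right].
apply/mapP; exists (Ordinal hcj); last exact: val_inj.
by rewrite mem_cells_from.
Qed.

End Fields.

(** * Symmetrizers applied to gradients *)

Section LowSymmetry.
Variables (R : realType) (D q : nat) (I : eqType).
Local Notation P s T := (permute_indices s T).

Definition low_sym (lab : 'I_q -> I) j e (Z : tensor R D q) :=
  forall a b : 'I_q, (a < j)%N -> (b < j)%N -> a != b -> lab a = lab b ->
  P (tperm a b) Z = (-1) ^+ (nat_of_bool e) *: Z.

(** Giving each cell from [j] on a label of its own reduces the claim to [stab_inv_tperm]. *)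
Lemma low_sym_perm (lab : 'I_q -> I) j e (Z : tensor R D q) (s : 'S_q) :
  low_sym lab j e Z -> s \in stab lab -> (forall i : 'I_q, (j <= i)%N -> s i = i) ->
  P s Z = stab_sgn R e s *: Z.
Proof.
move=> hZ /stabP hs hfix.
pose lab' (i : 'I_q) : I + 'I_q := if (i < j)%N then inl (lab i) else inr i.
have slow (i : 'I_q) : (i < j)%N -> (s i < j)%N.
  move=> hi; rewrite ltnNge; apply/negP => h.
  by have /perm_inj e' := hfix _ h; rewrite e' leqNgt hi in h.
have hs' : s \in stab lab'.
  apply/stabP => i; rewrite /lab'; have [hi|hi] := ltnP i j; first by rewrite slow // hs.
  by rewrite hfix // ltnNge hi.
apply: (stab_inv_tperm _ hs') => a b ab; rewrite /lab'.
have [ha|ha] := ltnP a j; have [hb|hb] := ltnP b j => // -[h].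
  exact: hZ.
by rewrite h eqxx in ab.
Qed.

End LowSymmetry.

Section GradSums.
Variables (R : realType) (D : nat) (I : eqType).
Local Notation P s T := (permute_indices s T).

(** Induction over transpositions avoids extending [s] to a permutation of all [q] cells. *)
Lemma stab_proj_igrad_perm j q (le : (j <= q)%N) (lab : 'I_q -> I) (lab' : 'I_j -> I) e
    (T : tensor_field R D j) (s : 'S_j) x : (forall i, lab (widen_ord le i) = lab' i) ->
  s \in stab lab' ->
  stab_proj lab e (igrad le (fun y => P s (T y)) x) =
  stab_sgn R e s *: stab_proj lab e (igrad le T x).
Proof.
move=> hl hs; move: s hs T; apply: stab_ind => [|s a b ab h hs IH] T.
  rewrite /stab_sgn odd_perm1 andbF expr0 scale1r; congr (stab_proj _ _ (igrad _ _ x)).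
  by apply/funext => y; rewrite permute_indices1.
have -> : (fun y => P (tperm a b * s)%g (T y)) = fun y => P s (P (tperm a b) (T y)).
  by apply/funext => y; rewrite permute_indicesM.
rewrite IH -(igrad_perm_low le) stab_proj_perm; last by apply: stab_tperm; rewrite !hl.
rewrite scalerA stab_sgnM mulrC !stab_sgn_tperm //.
Qed.

Lemma stab_proj_igrad j q (le : (j <= q)%N) (lab : 'I_q -> I) (lab' : 'I_j -> I) e
    (T : tensor_field R D j) x : smooth_field T -> (forall i, lab (widen_ord le i) = lab' i) ->
  stab_proj lab e (igrad le (fun y => stab_proj lab' e (T y)) x) =
  #|stab lab'|%:R *: stab_proj lab e (igrad le T x).
Proof.
move=> hT hl; rewrite /stab_proj igrad_sum; last by move=> s _; exact: smooth_perm.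
rewrite -/(stab_proj lab e _) linear_sum /= (eq_bigr (fun=> stab_proj lab e (igrad le T x))).
  by rewrite sumr_const scaler_nat.
move=> s hs; rewrite linearZ /= (stab_proj_igrad_perm _ _ _ hl hs).
by rewrite scalerA stab_sgn_sq scale1r.
Qed.

Lemma igrad_low_sym j q (le : (j <= q)%N) (lab : 'I_q -> I) (lab' : 'I_j -> I) e
    (T : tensor_field R D j) x : smooth_field T -> (forall i, lab (widen_ord le i) = lab' i) ->
  (forall a b y, a != b -> lab' a = lab' b -> P (tperm a b) (T y) = (-1) ^+ (nat_of_bool e) *: T y) ->
  low_sym lab j e (igrad le T x).
Proof.
move=> hT hl h a b ha hb ab hab.
have ea : a = widen_ord le (Ordinal ha) by exact: val_inj.
have eb : b = widen_ord le (Ordinal hb) by exact: val_inj.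
rewrite ea eb igrad_perm_low -(igradZ le _ x hT); congr (igrad _ _ x); apply/funext => y.
rewrite h //.
by rewrite -!hl -ea -eb.
Qed.

End GradSums.

(** Coset decomposition of the stabilizer on [j.+1] cells modulo the subgroup fixing the last cell;
    the transpositions of the last cell with the cells of its class are representatives. *)
Lemma stab_proj_grad (R : realType) (I : eqType) j (lab : 'I_j.+1 -> I) (lab' : 'I_j -> I) e :
  (forall i, lab (widen_ord (leqnSn j) i) = lab' i) ->
  exists2 n : R, n != 0 & forall D (T : tensor_field R D j) x, smooth_field T ->
  stab_proj lab e (grad T x) = n *: \sum_(b | lab b == lab ord_max)
    (-1) ^+ (e && (b != ord_max)) *:
      permute_indices (tperm b ord_max) (grad (fun y => stab_proj lab' e (T y)) x).
Proof.
move=> hl; pose k := #|[set s : 'S_j.+1 in stab lab | s ord_max == ord_max]|.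
have k0 : k%:R != 0 :> R by rewrite pnatr_eq0 -lt0n stab_fiber_gt0.
exists (#|stab lab'|%:R^-1 * k%:R) => [|D T x hT].
  by rewrite mulf_neq0 // invr_neq0 // card_stab_neq0.
set X := fun y => stab_proj lab' e (T y).
have sX : smooth_field X by exact: smooth_stab_proj.
pose F b := (-1) ^+ (e && (b != ord_max)) *: permute_indices (tperm b ord_max) (grad X x).
have E : stab_proj lab e (grad X x) = k%:R *: \sum_(b | lab b == lab ord_max) F b.
  rewrite scaler_nat -stab_sum /stab_proj; apply: eq_bigr => s hs.
  pose s' := (s * tperm (s ord_max) ord_max)%g.
  have ts : tperm (s ord_max) ord_max \in stab lab by apply: stab_tperm; rewrite (stabP _ _ hs).
  have hs' : s' \in stab lab by exact: stabM.
  have low : low_sym lab j e (grad X x).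
    rewrite gradE; apply: (igrad_low_sym x sX hl) => a b y ab hab.
    by rewrite /X perm_stab_proj ?stab_sgn_tperm //; exact: stab_tperm.
  have fixs' (i : 'I_j.+1) : (j <= i)%N -> s' i = i.
    move=> hi; have -> : i = ord_max by apply: val_inj => /=; apply/eqP; rewrite eqn_leq hi -ltnS ltn_ord.
    by rewrite permM tpermL.
  have h1 := low_sym_perm low hs' fixs'.
  have -> : s = (s' * tperm (s ord_max) ord_max)%g by rewrite /s' -mulgA tperm2 mulg1.
  rewrite -permute_indicesM h1 linearZ /= scalerA stab_sgnM mulrAC stab_sgn_sq mul1r.
  rewrite permM fixs' // tpermR /F; congr (_ *: _).
  have [->|sm] := eqVneq (s ord_max) ord_max; last by rewrite stab_sgn_tperm // andbT.
  by rewrite /stab_sgn tperm1 odd_perm1 andbF.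
have := stab_proj_igrad e x hT hl; rewrite -!gradE -/X E => E2.
rewrite -scalerA -[X in _ = _ *: X]/(k%:R *: \sum_(b | lab b == lab ord_max) F b) E2 scalerA.
by rewrite mulVf ?scale1r // card_stab_neq0.
Qed.

(** * The differential and rectangular diagrams *)

Section ColumnSwap.

Definition swapn (a b x : nat) := if x == a then b else if x == b then a else x.

Lemma swapnK a b : involutive (swapn a b).
Proof.
move=> x; rewrite /swapn; case: (eqVneq x a) => [->|xa].
  by case: (eqVneq b a) => [->|_]; rewrite ?eqxx.
by case: (eqVneq x b) => [->|/negbTE xb]; rewrite ?eqxx // (negbTE xa) xb.
Qed.

(** The condition on [i] expresses that the two columns have equal height among the first [q]
    cells. *)
Lemma colswap_exists m q c1 c2 : (c1 < m)%N -> (c2 < m)%N ->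
  (forall i, (i < q)%N -> (i %/ m * m + swapn c1 c2 (i %% m) < q)%N) ->
  exists2 t : 'S_q, forall i : 'I_q, ((t i) %/ m = i %/ m)%N &
    forall i : 'I_q, ((t i) %% m = swapn c1 c2 (i %% m))%N.
Proof.
move=> h1 h2 hq; pose f (i : 'I_q) : 'I_q := Ordinal (hq _ (ltn_ord i)).
have m0 : (0 < m)%N := leq_ltn_trans (leq0n c1) h1.
have sm (i : 'I_q) : (swapn c1 c2 (i %% m) < m)%N.
  by rewrite /swapn; case: ifP => // _; case: ifP => // _; rewrite ltn_mod.
have fd i : (f i %/ m = i %/ m)%N by rewrite /= divnMDl // (divn_small (sm i)) addn0.
have fm i : (f i %% m = swapn c1 c2 (i %% m))%N by rewrite /= modnMDl (modn_small (sm i)).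
have fK : involutive f.
  by move=> i; apply: val_inj; rewrite [RHS](divn_eq i m) /= -/(f i : nat) fd fm swapnK.
by exists (perm (inv_inj fK)) => i; rewrite permE.
Qed.

End ColumnSwap.

Section YoungFields.
Variables (R : realType) (N : nat).
Hypothesis N2 : (2 <= N)%N.
Local Notation P s T := (permute_indices s T).
Local Notation m := N.-1.

Let m0 : (0 < m)%N. Proof. by case: N N2 => [|[]]. Qed.

Definition young_field D p (T : tensor_field R D p) :=
  smooth_field T /\ forall x, garnir N (T x).

(* The inner antisymmetrization makes the Young projection alternate in its argument and
   invariant under the exchange of two columns of equal length. *)
Definition young_op D q (Z : tensor R D q) := col_antisym N (row_sym N (col_antisym N Z)).

Lemma young_op_is_linear D q : linear (@young_op D q).
Proof. by move=> a T U; rewrite /young_op !linearP. Qed.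
HB.instance Definition _ D q := GRing.isLinear.Build R (tensor R D q) (tensor R D q) _
  (@young_op D q) (@young_op_is_linear D q).

Lemma young_op_col D q (Z : tensor R D q) (a b : 'I_q) : a != b ->
  young_col N a = young_col N b -> young_op (P (tperm a b) Z) = - young_op Z.
Proof.
by move=> ab h; rewrite /young_op col_antisym_tperm // !raddfN.
Qed.

(** The permutation [t] normalizes the column stabilizer, so it passes through the inner
    antisymmetrization; the row symmetrization then absorbs it. *)
Lemma young_op_colswap D q c1 c2 (t : 'S_q) (Z : tensor R D q) :
  (forall i, young_row N (t i) = young_row N i) ->
  (forall i, young_col N (t i) = swapn c1 c2 (young_col N i)) -> young_op (P t Z) = young_op Z.
Proof.
move=> hr hc; rewrite /young_op; congr (col_antisym N _).
rewrite [col_antisym N (P t Z)](stab_proj_normal true Z hc); last exact: inv_inj (swapnK _ _).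
rewrite !row_symE stab_proj_perm ?scale1r //; exact/stabP.
Qed.

Lemma young_op_garnir D q (Z : tensor R D q) (k : R) : garnir N Z ->
  (col_antisym N (row_sym N Z) = k *: Z) ->
  young_op Z = (#|col_stab N q|%:R * k) *: Z.
Proof.
by move=> [h _] hk; rewrite /young_op (col_alternatingP h) row_symZ col_antisymZ hk scalerA.
Qed.

Lemma smooth_row_sym D p (T : tensor_field R D p) :
  smooth_field T -> smooth_field (fun x => row_sym N (T x)).
Proof.
move=> hT; rewrite (_ : (fun x => _) = fun x => stab_proj (@young_row N p) false (T x)).
  exact: smooth_stab_proj.
by apply/funext => x; rewrite row_symE.
Qed.

Lemma smooth_col_antisym D p (T : tensor_field R D p) :
  smooth_field T -> smooth_field (fun x => col_antisym N (T x)).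
Proof. exact (@smooth_stab_proj R D p nat (@young_col N p) true T). Qed.

Lemma smooth_grad D p (T : tensor_field R D p) : smooth_field T -> smooth_field (grad T).
Proof. by move=> hT; rewrite gradE; exact: smooth_igrad. Qed.

Lemma igrad_step D p q (le : (p <= q.+1)%N) (le' : (p <= q)%N) (T : tensor_field R D p) :
  smooth_field T -> igrad le T = grad (igrad le' T).
Proof. by move=> hT; rewrite gradE (igrad_comp _ _ le). Qed.

Lemma grad_igrad D j q (le : (j.+1 <= q)%N) (le' : (j <= q)%N) (T : tensor_field R D j) :
  smooth_field T -> igrad le (grad T) = igrad le' T.
Proof. by move=> hT; rewrite gradE (igrad_comp _ _ le'). Qed.

Lemma row_sym_grad j : exists2 k : R, k != 0 & forall D (T : tensor_field R D j) x,
  smooth_field T -> row_sym N (grad T x) = k *: \sum_(b : 'I_j.+1 | young_row N b == young_row N (@ord_max j))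
     P (tperm b ord_max) (grad (fun y => row_sym N (T y)) x).
Proof.
have [k k0 hk] := @stab_proj_grad R nat j (@young_row N j.+1) (@young_row N j) false (fun=> erefl).
exists k => // D T x hT; rewrite row_symE (hk _ _ _ hT); congr (_ *: _); apply: eq_bigr => b _.
rewrite expr0 scale1r; congr (P _ (grad _ x)).
by apply/funext => y; rewrite row_symE.
Qed.

(** The derivative cells form a row of their own, in which the gradient is already symmetric: the
    [M] terms of [row_sym_grad] coincide. *)
Lemma row_sym_igrad n k (le : (m * n <= k + m * n)%N) : (k <= m)%N ->
  exists2 c : R, c != 0 & forall D (T : tensor_field R D (m * n)) x, smooth_field T ->
  row_sym N (igrad le T x) = c *: igrad le (fun y => row_sym N (T y)) x.
Proof.
elim: k le => [|k IH] le hk.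
  by exists 1; [exact: oner_neq0|move=> D T x hT; rewrite !igrad_refl scale1r].
have le' : (m * n <= k + m * n)%N by rewrite leq_addl.
have [c c0 hc] := IH le' (ltnW hk).
have [d d0 hd] := row_sym_grad (k + m * n).
pose M := #|[pred b : 'I_(k + m * n).+1 | young_row N b == young_row N (@ord_max (k + m * n))]|.
exists (d * (c * M%:R)) => [|D T x hT].
  rewrite !mulf_neq0 // pnatr_eq0 -lt0n; apply/card_gt0P; exists ord_max.
  by rewrite inE eqxx.
have sS := smooth_row_sym hT.
rewrite (igrad_step le le' hT) (igrad_step le le' sS) (hd _ _ _ (smooth_igrad le' hT)).
rewrite -scalerA; congr (_ *: _).
have -> : (fun y => row_sym N (igrad le' T y)) = fun y => c *: igrad le' (fun y => row_sym N (T y)) y.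
  by apply/funext => y; rewrite hc.
rewrite (eq_bigr (fun=> c *: grad (igrad le' (fun y => row_sym N (T y))) x)).
  by rewrite sumr_const -scaler_nat scalerA mulrC.
move=> b /eqP hb; rewrite gradE igradZ; last exact: smooth_igrad.
rewrite linearZ /= -gradE -(igrad_step le le' sS); congr (_ *: _).
apply: (igrad_tperm_high _ _ sS); last exact: leq_addl.
have hr : (young_row N b = n)%N.
  by rewrite hb /young_row /= addnC mulnC divnMDl // divn_small // addn0.
by have := leq_trunc_div b m; rewrite -/(young_row N b) hr mulnC.
Qed.

Lemma col_antisym_igrad D j q (le : (j <= q)%N) (T : tensor_field R D j) x : smooth_field T ->
  col_antisym N (igrad le (fun y => col_antisym N (T y)) x) =
  #|col_stab N j|%:R *: col_antisym N (igrad le T x).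
Proof.
move=> hT.
exact (@stab_proj_igrad R D nat j q le (@young_col N q) (@young_col N j) true T x hT (fun=> erefl)).
Qed.

Lemma young_op_igrad D j q (le : (j <= q)%N) (T : tensor_field R D j) x : smooth_field T ->
  young_op (igrad le (fun y => col_antisym N (T y)) x) =
  #|col_stab N j|%:R *: young_op (igrad le T x).
Proof. by move=> hT; rewrite /young_op col_antisym_igrad // row_symZ col_antisymZ. Qed.

Lemma card_col_stab_neq0 q : #|col_stab N q|%:R != 0 :> R.
Proof. exact: (@card_stab_neq0 R q nat (@young_col N q)). Qed.

(* Since the new row is disjoint from the cells of [T], it does not interact with the row
   symmetrization; this is where the rectangular shape is used. *)
Lemma col_antisym_row_sym_igrad n k (le : (m * n <= k + m * n)%N) : (k <= m)%N ->
  exists2 c : R, c != 0 & forall D (T : tensor_field R D (m * n)) x, young_field T ->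
  col_antisym N (row_sym N (igrad le T x)) = c *: col_antisym N (igrad le T x).
Proof.
move=> hk; have [c c0 hc] := row_sym_igrad le hk.
have [d d0 hd] := @young_idempotent R N (m * n).
have u0 := card_col_stab_neq0 (m * n).
exists (c * d / #|col_stab N (m * n)|%:R) => [|D T x [sT gT]].
  by rewrite !mulf_neq0 // invr_neq0.
rewrite hc // col_antisymZ -mulrA -scalerA; congr (_ *: _).
have := col_antisym_igrad le x (smooth_row_sym sT).
have -> : (fun y => col_antisym N (row_sym N (T y))) = fun y => d *: T y.
  by apply/funext => y; rewrite hd.
rewrite (igradZ le d x sT) col_antisymZ => h.
by rewrite mulrC -scalerA h scalerA mulVf // scale1r.
Qed.

Lemma garnir_igrad n k (le : (m * n <= k + m * n)%N) D (T : tensor_field R D (m * n)) x :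
  (k <= m)%N -> young_field T -> garnir N (col_antisym N (igrad le T x)).
Proof.
move=> hk hT; have [c c0 hc] := col_antisym_row_sym_igrad le hk.
rewrite -[col_antisym _ _]scale1r -(mulVf c0) -scalerA -hc // -col_antisymZ -row_symZ.
exact: garnir_young.
Qed.

Lemma young_op_rect n k (le : (m * n <= k + m * n)%N) : (k <= m)%N ->
  exists2 c : R, c != 0 & forall D (T : tensor_field R D (m * n)) x, young_field T ->
  young_op (igrad le T x) = c *: col_antisym N (igrad le T x).
Proof.
move=> hk; have [c c0 hc] := @young_idempotent R N (k + m * n).
by exists c => // D T x hT; rewrite /young_op hc //; exact: garnir_igrad.
Qed.

Lemma modn_neq_small (a b d : nat) : (a < b)%N -> (b < a + d)%N -> (b %% d != a %% d)%N.
Proof.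
move=> ab bd; apply/negP => h; have : (b = a %[mod d])%N by exact/eqP.
move/eqP; rewrite (eqn_mod_dvd _ (ltnW ab)) => /dvdn_leq.
by rewrite subn_gt0 ab => /(_ isT); rewrite leqNgt ltn_subLR ?bd // ltnW.
Qed.

(** As no cell lies below [b], the columns of [b] and [j] end in the same row. *)
Lemma colswap_bound b i (j q : nat) : (j < q)%N -> (b < j)%N ->
  (b %/ m = j %/ m)%N -> (q <= b + m)%N -> (i < q)%N ->
  (i %/ m * m + swapn (b %% m) (j %% m) (i %% m) < q)%N.
Proof.
move=> jq bj bjr qb iq.
have hb := divn_eq b m; have hj := divn_eq j m; have hi := divn_eq i m.
have hr : (b %% m < j %% m)%N by move: bj; rewrite {1}hb {1}hj bjr ltn_add2l.
rewrite /swapn; case: eqP => [ib|_].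
  have hd : (i %/ m <= j %/ m)%N.
    have := leq_trans iq qb; rewrite {1}hi {1}hb ib addnAC ltn_add2r bjr -mulSnr.
    by rewrite ltn_pmul2r // ltnS.
  by apply: leq_ltn_trans jq; rewrite [X in (_ <= X)%N]hj leq_add2r leq_pmul2r.
case: eqP => [ij|_]; last by rewrite -hi.
by apply: ltn_trans iq; rewrite [X in (_ < X)%N]hi ltn_add2l ij.
Qed.

(** A cell below [b] carries a derivative; after the exchange so does [b], and antisymmetrization in
    their common column gives 0. If there is no such cell, the columns of [b] and [j] have equal
    height, and exchanging them undoes the transposition up to row permutations of [T]. *)
Lemma young_op_swap_new D j q (jq : (j < q)%N) (T : tensor_field R D j) (b : 'I_j.+1) x :
  (q <= j + m)%N -> smooth_field T ->
  (forall a b y, a != b -> young_row N a = young_row N b -> P (tperm a b) (T y) = T y) ->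
  young_row N b = young_row N (@ord_max j) ->
  young_op (P (tperm (widen_ord jq b) (widen_ord jq ord_max)) (igrad (ltnW jq) T x)) =
  if (q <= b + m)%N then young_op (igrad (ltnW jq) T x) else 0.
Proof.
move=> qj sT rT hb; set G := igrad _ T x.
have [->|bmax] := eqVneq b ord_max; first by rewrite tperm1 permute_indices1 /= qj.
have bj : (b < j)%N.
  by rewrite ltn_neqAle -ltnS ltn_ord andbT; apply: contra_neq bmax => h; apply: val_inj.
have jb : (j < b + m)%N.
  have h1 := divn_eq j m; have h2 := divn_eq b m; have h3 := ltn_pmod j m0.
  rewrite (hb : (b %/ m = j %/ m)%N) in h2.
  by rewrite [X in (X < _)%N]h1 [X in (_ < X + _)%N]h2 -addnA ltn_add2l ltn_addl.
set wb := widen_ord jq b; set wj := widen_ord jq ord_max.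
have wbj : wb != wj by apply: contra_neq bmax => h; apply: val_inj; have := congr1 val h.
have [qb|bq] := leqP q (b + m); last first.
  pose e := Ordinal bq.
  have ej : e != wj by apply/eqP => h; have := congr1 val h => /= h'; rewrite h' ltnn in jb.
  have eb : e != wb.
    by apply/eqP => h; have := congr1 val h => /= h'; rewrite -h' in bj; lia.
  have hG : P (tperm wj e) G = G by apply: (igrad_tperm_high _ _ sT) => //=; exact: ltnW.
  apply: eq_opp_eq0; rewrite -(@young_op_col D q _ wb e) 1?eq_sym //; last first.
    by rewrite /young_col /= modnDr.
  rewrite permute_indicesM.
  have -> : (tperm wb wj * tperm wb e = tperm wj e * tperm wb wj)%g.
    have <- : (tperm wb e ^ tperm wb wj = tperm wj e)%g.
      by rewrite tpermJ tpermL tpermD // eq_sym.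
    by rewrite /conjg tpermV -!mulgA tperm2 mulg1.
  by rewrite -permute_indicesM hG.
have [t tr tc] : exists2 t : 'S_q, forall i : 'I_q, ((t i) %/ m = i %/ m)%N &
    forall i : 'I_q, ((t i) %% m = swapn (b %% m) (j %% m) (i %% m))%N.
  by apply: colswap_exists => [||i]; rewrite ?ltn_mod //; apply: colswap_bound.
rewrite -[RHS](young_op_colswap G tr tc); congr young_op.
have low : low_sym (@young_row N q) j false G.
  apply: (@igrad_low_sym R D nat j q (ltnW jq) (@young_row N q) (@young_row N j) false T x sT) => // u v y uv huv.
  by rewrite rT // scale1r.
(* This product preserves rows and fixes all derivative cells, so it only permutes indices of [T]
   within rows. *)
have hs : (t * tperm wb wj)%g \in stab (@young_row N q).
  by apply: stabM; [apply/stabP => i; exact: tr|exact: stab_tperm].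
have := low_sym_perm low hs; rewrite /stab_sgn expr0 scale1r => hfix.
have {}hfix : P (tperm wb wj) (P t G) = G.
  rewrite permute_indicesM; apply: hfix => i; rewrite leq_eqVlt => /orP[/eqP ji|ji].
    have ei : i = wj by exact: val_inj.
    have -> : (t * tperm wb wj)%g i = tperm wb wj (t i) by rewrite permM.
    rewrite ei (_ : t wj = wb) ?tpermL //; apply: val_inj.
    rewrite [LHS](divn_eq _ m) tr tc /= /swapn eqxx [RHS](divn_eq b m) -/(young_row N b) hb.
    by case: eqP => [->|_].
  have iq := ltn_ord i.
  have hj : (i %% m != j %% m)%N by apply: modn_neq_small => //; exact: leq_trans iq qj.
  have hbm : (i %% m != b %% m)%N.
    by apply: modn_neq_small; [exact: ltn_trans ji|exact: leq_trans iq qb].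
  have ti : t i = i.
    apply: val_inj; rewrite [LHS](divn_eq _ m) tr tc /swapn (negbTE hj) (negbTE hbm).
    by rewrite -divn_eq.
  rewrite permM ti tpermD //; apply/eqP => h; have := congr1 val h => /= h'.
    by rewrite -h' in ji; have := ltn_trans bj ji; rewrite ltnn.
  by rewrite -h' ltnn in ji.
by rewrite -{1}hfix permute_indicesM tperm2 permute_indices1.
Qed.

End YoungFields.

(** * Powers of the differential compared with iterated gradients *)

Section Differential.
Variables (R : realType) (N : nat).
Hypothesis N2 : (2 <= N)%N.
Local Notation P s T := (permute_indices s T).
Local Notation m := N.-1.

(** Among the terms of [row_sym_grad], those with no cell below [b] all give the same tensor and the
    others vanish. The last cell is of the first kind because [q <= j + m], so the count [M] is
    positive. *)
Lemma young_op_igrad_young j q (jq : (j < q)%N) : (q <= j + m)%N ->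
  exists2 c : R, c != 0 & forall D (T : tensor_field R D j) x, young_field N T ->
  young_op N (igrad jq (fun y => col_antisym N (row_sym N (grad T y))) x) =
  c *: young_op N (igrad (ltnW jq) T x).
Proof.
move=> qj; have [k k0 hk] := row_sym_grad R N j; have [d d0 hd] := @young_idempotent R N j.
pose good (b : 'I_j.+1) := (young_row N b == young_row N (@ord_max j)) && (q <= b + m)%N.
pose M := #|[pred b | good b]|.
have u0 := card_col_stab_neq0 R N j; have v0 := card_col_stab_neq0 R N j.+1.
exists (#|col_stab N j.+1|%:R * (k * (M%:R * (d / #|col_stab N j|%:R)))) => [|D T x [sT gT]].
  rewrite !mulf_neq0 ?invr_neq0 // pnatr_eq0 -lt0n; apply/card_gt0P; exists ord_max.
  by rewrite inE /good eqxx.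
have sS := smooth_row_sym N sT; have sG := smooth_grad sT; have sSG := smooth_grad sS.
rewrite young_op_igrad; last exact: smooth_row_sym.
rewrite -scalerA; congr (_ *: _).
pose R0 (y : 'rV[R]_D) := row_sym N (T y).
have -> : (fun y => row_sym N (grad T y)) = fun y =>
    \sum_(b : 'I_j.+1 | young_row N b == young_row N (@ord_max j)) k *: P (tperm b ord_max) (grad R0 y).
  by apply/funext => y; rewrite (hk _ _ _ sT) scaler_sumr.
rewrite igrad_sum; last by move=> b _; apply: smooth_perm.
rewrite linear_sum /= -[RHS]scalerA.
have inv_R0 a b y : a != b -> young_row N a = young_row N b -> P (tperm a b) (R0 y) = R0 y.
  by move=> _ h; exact: row_sym_tperm.
rewrite (eq_bigr (fun b : 'I_j.+1 => k *: (if (q <= b + m)%N then young_op N (igrad (ltnW jq) R0 x) else 0))).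
  rewrite -scaler_sumr -big_mkcondr /= sumr_const -scaler_nat -scalerA.
  congr (_ *: (_ *: _)); rewrite -scalerA.
  have h := young_op_igrad N (ltnW jq) x sS.
  have e : (fun y => col_antisym N (row_sym N (T y))) = fun y => d *: T y.
    by apply/funext => y; rewrite hd.
  rewrite e igradZ // linearZ /= in h.
  by rewrite [d *: _]scalerA mulrC -scalerA h scalerA mulVf // scale1r.
move=> b /eqP hb; rewrite linearZ /=; congr (_ *: _).
rewrite -(young_op_swap_new N2 jq x qj sS inv_R0 hb); congr young_op.
by rewrite -igrad_perm_low (grad_igrad _ (ltnW jq)).
Qed.

Variable D : nat.

Lemma young_norm_neq0 p : young_norm R N D p != 0.
Proof. by rewrite /young_norm; case: xgetP => [c _ [] //|_]; exact: oner_neq0. Qed.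

Lemma OmegaP p (T : tensor_field R D p) : Omega N T <-> young_field N T.
Proof. by split=> -[h1 h2]; split=> // x; apply/garnir_in_young. Qed.

Lemma dE p (T : tensor_field R D p) x :
  d N T x = young_norm R N D p.+1 *: col_antisym N (row_sym N (grad T x)).
Proof. by []. Qed.

Lemma young_field_d p (T : tensor_field R D p) : smooth_field T -> young_field N (d N T).
Proof.
move=> sT; split=> [|x].
  by apply: smooth_fieldZ; apply: smooth_col_antisym; apply: smooth_row_sym; exact: smooth_grad.
by rewrite dE -col_antisymZ -row_symZ; exact: garnir_young.
Qed.

Lemma young_field_diter i p (T : tensor_field R D p) : young_field N T -> young_field N (diter N i T).
Proof. by move=> hT; elim: i => //= i [h _]; exact: young_field_d. Qed.

Lemma d_lin p (c : R) (T U : tensor_field R D p) : smooth_field T -> smooth_field U ->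
  d N (fun x => c *: T x + U x) = fun x => c *: d N T x + d N U x.
Proof.
move=> sT sU; apply/funext => x; rewrite !dE !gradE (igradD _ _ (smooth_fieldZ c sT) sU) (igradZ _ _ _ sT).
by rewrite [row_sym _ _]linearP [col_antisym _ _]linearP scalerDr !scalerA mulrC.
Qed.

Lemma diter_lin i p (c : R) (T U : tensor_field R D p) : young_field N T -> young_field N U ->
  diter N i (fun x => c *: T x + U x) = fun x => c *: diter N i T x + diter N i U x.
Proof.
move=> hT hU; elim: i => //= i ->; apply: d_lin.
  by have [] := young_field_diter i hT.
by have [] := young_field_diter i hU.
Qed.

Lemma young_field_lin p (c : R) (T U : tensor_field R D p) : young_field N T -> young_field N U ->
  young_field N (fun x => c *: T x + U x).
Proof.
move=> [sT gT] [sU gU]; split=> [|x].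
  by apply: smooth_fieldD; [exact: smooth_fieldZ|].
have [h1 h2] := gT x; have [h3 h4] := gU x; split=> [a b ab h|c' y hc].
  by rewrite linearP /= h1 // h3 // scalerN opprD.
rewrite {1}(h2 _ _ hc) {1}(h4 _ _ hc) scaler_sumr -big_split /=.
by apply: eq_bigr => i _; rewrite linearP.
Qed.

(** Under [young_op] each differential may be replaced by a plain derivative. The bound [q <= j + m]
    ensures that no two derivative cells share a column. *)
Lemma young_op_igrad_diter i j q (le : (i + j <= q)%N) (le' : (j <= q)%N) : (q <= j + m)%N ->
  exists2 c : R, c != 0 & forall (T : tensor_field R D j) x, young_field N T ->
  young_op N (igrad le (diter N i T) x) = c *: young_op N (igrad le' T x).
Proof.
elim: i le => [|i IH] le hq.
  by exists 1; [exact: oner_neq0|move=> T x hT; rewrite scale1r (bool_irrelevance le le')].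
have [c c0 hc] := IH (ltnW le) hq.
have hq' : (q <= i + j + m)%N by rewrite (leq_trans hq) // leq_add2r leq_addl.
have [e e0 he] := young_op_igrad_young le hq'.
have n0 := young_norm_neq0 (i + j).+1.
exists (young_norm R N D (i + j).+1 * (e * c)) => [|T x hT]; first by rewrite !mulf_neq0.
have hi := young_field_diter i hT; have [si _] := hi.
rewrite -[diter N i.+1 T]/(fun y => young_norm R N D (i + j).+1 *:
  col_antisym N (row_sym N (grad (diter N i T) y))).
rewrite igradZ; last first.
  by apply: smooth_col_antisym; apply: smooth_row_sym; exact: smooth_grad.
by rewrite linearZ /= he // -!scalerA hc.
Qed.

(** For [q] the full degree, [young_op] gives a multiple of [diter N k T] on one side and, by
    [young_op_rect], a multiple of the antisymmetrized gradient on the other. *)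
Lemma diter_rect n k (le : (m * n <= k + m * n)%N) : (k <= m)%N ->
  exists2 c : R, c != 0 & forall (T : tensor_field R D (m * n)) x, young_field N T ->
  diter N k T x = c *: col_antisym N (igrad le T x).
Proof.
move=> hk; have hq : (k + m * n <= m * n + m)%N by rewrite addnC leq_add2l.
have [c c0 hc] := young_op_igrad_diter (leqnn _) le hq.
have [d d0 hd] := @young_op_rect R N N2 n k le hk.
have [e e0 he] := @young_idempotent R N (k + m * n).
have u0 := card_col_stab_neq0 R N (k + m * n).
exists ((#|col_stab N (k + m * n)|%:R * e)^-1 * (c * d)) => [|T x hT].
  by rewrite !mulf_neq0 // invr_neq0 // mulf_neq0.
have hi := young_field_diter k hT; have [_ gi] := hi.
have := hc T x hT; rewrite igrad_refl (young_op_garnir (gi x) (he _ _ (gi x))) hd //.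
by rewrite scalerA => h; rewrite -scalerA -h scalerA mulVf ?scale1r // mulf_neq0.
Qed.

End Differential.

(** * Contraction with the position vector *)

Section MultiIndices.
Variable D : nat.

Definition upd_ix q (f : multi_index D q) (c : 'I_q) (a : 'I_D) : multi_index D q :=
  [ffun i => if i == c then a else f i].

Definition rcons_ix j (g : multi_index D j) (a : 'I_D) : multi_index D j.+1 :=
  [ffun i : 'I_j.+1 => oapp g a (insub (i : nat))].

Local Notation wid := (widen_ord (leqnSn _)).

Lemma rcons_ix_widen j (g : multi_index D j) a i : rcons_ix g a (wid i) = g i.
Proof. by rewrite ffunE /= valK. Qed.

Lemma rcons_ix_max j (g : multi_index D j) a : rcons_ix g a ord_max = a.
Proof. by rewrite ffunE /= insubN // ltnn. Qed.

Lemma ord_lastP j (P : 'I_j.+1 -> Prop) : (forall i, P (wid i)) -> P ord_max -> forall i, P i.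
Proof.
move=> Pw Pm i; have [ij|ij] := ltnP i j.
  by have -> : i = wid (Ordinal ij) by exact: val_inj.
have -> // : i = ord_max; apply: val_inj; apply/eqP; rewrite eqn_leq ij andbT.
by rewrite -ltnS ltn_ord.
Qed.

Lemma reindex_rcons_ix j (g : multi_index D j) u a b :
  reindex_by (tperm (wid a) (wid b)) (rcons_ix g u) = rcons_ix (reindex_by (tperm a b) g) u.
Proof.
apply/ffunP; apply: ord_lastP => [i|].
  by rewrite rcons_ix_widen !ffunE tperm_widen /= valK.
rewrite rcons_ix_max ffunE tpermD ?rcons_ix_max //.
  by apply/eqP => h; have := congr1 val h => /= e; have := ltn_ord a; rewrite e ltnn.
by apply/eqP => h; have := congr1 val h => /= e; have := ltn_ord b; rewrite e ltnn.
Qed.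

Lemma upd_rcons_ix j (g : multi_index D j) u y v :
  rcons_ix (upd_ix g y v) u = upd_ix (rcons_ix g u) (wid y) v.
Proof.
apply/ffunP; apply: ord_lastP => [i|].
  by rewrite rcons_ix_widen !ffunE (inj_eq (@widen_ord_inj _ _ _)) /= valK.
rewrite rcons_ix_max ffunE rcons_ix_max; case: eqP => // h.
by have := congr1 val h => /= e; have := ltn_ord y; rewrite -e ltnn.
Qed.

Lemma reindex_max_rcons_ix j (g : multi_index D j) u y :
  reindex_by (tperm ord_max (wid y)) (rcons_ix g u) = upd_ix (rcons_ix g (g y)) (wid y) u.
Proof.
have ny (i : 'I_j) : (ord_max != wid i).
  by apply/eqP => h; have := congr1 val h => /= e; have := ltn_ord i; rewrite -e ltnn.
apply/ffunP; apply: ord_lastP => [i|]; rewrite !ffunE.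
  case: eqP => [->|/eqP iy]; first by rewrite tpermR /= insubN ?ltnn.
  by rewrite tpermD ?ny // 1?eq_sym // /= valK.
by rewrite tpermL (negbTE (ny y)) /= valK /= insubN ?ltnn.
Qed.

End MultiIndices.

Section Contraction.
Variables (R : realType) (N D : nat).
Hypothesis N2 : (2 <= N)%N.
Local Notation m := N.-1.
Local Notation wid := (widen_ord (leqnSn _)).

Definition ctr j (Y : tensor_field R D j.+1) : tensor_field R D j :=
  fun x => [ffun g => \sum_a x 0 a * Y x (rcons_ix g a)].

Lemma smooth_ctr j (Y : tensor_field R D j.+1) : smooth_field Y -> smooth_field (ctr Y).
Proof.
move=> hY g; rewrite (_ : (fun x => _) = fun x : 'rV[R]_D => \sum_a x 0 a * Y x (rcons_ix g a)).
  by apply: smooth_sum => a _; apply: smooth_coordM; exact: hY.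
by apply/funext => x; rewrite ffunE.
Qed.

(* [Y] has degree [j] and comes from a field of rectangular type of degree [p] by contracting
   the cells [j, ..., p - 1] of the last row with the position vector. *)
Definition contracted p j (Y : tensor_field R D j) := young_field N Y /\
  forall (y : 'I_j) (x : 'rV[R]_D) g, (m <= young_col N y + (p - j))%N ->
    \sum_a x 0 a * Y x (upd_ix g y a) = 0.

Lemma modn_last n j : (j < m * n)%N -> (m * n <= j + m)%N -> (j %% m = m - (m * n - j))%N.
Proof.
move=> h1 h2; case: n h1 h2 => [|n]; first by rewrite muln0.
rewrite mulnS => h1 h2.
have e : j = (n * m + (m - (m + m * n - j)))%N by rewrite mulnC; lia.
by rewrite {1}e modnMDl modn_small //; lia.
Qed.

(** Compared with the relations of [Y], those of [ctr Y] lack the term of the cell [j]. In that term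
    the position vector sits in a column further right, contracted before, where a second
    contraction vanishes. *)
Lemma contracted_ctr n j (Y : tensor_field R D j.+1) : (j < m * n)%N -> (m * n <= j + m)%N ->
  contracted (m * n) Y -> contracted (m * n) (ctr Y).
Proof.
move=> jp pj [[sY gY] cY]; have colj := modn_last jp pj.
have alt x f (a b : 'I_j.+1) : a != b -> young_col N a = young_col N b ->
    Y x (reindex_by (tperm a b) f) = - Y x f.
  by move=> ab h; have [h1 _] := gY x; rewrite -permE_ix h1 // ffunE.
split; last first.
  move=> y x g hy.
  have E u v : Y x (rcons_ix (upd_ix g y u) v) = Y x (upd_ix (rcons_ix g v) (wid y) u).
    by rewrite upd_rcons_ix.
  under eq_bigr do rewrite ffunE mulr_sumr.
  (* Either the column of [y] was contracted before, or it is the column of the cell [j], where two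
     position vectors meet an alternating pair of cells. *)
  have [hyl|hyl] := leqP m (young_col N y + (m * n - j.+1)).
    rewrite exchange_big /=; apply: big1 => v _.
    transitivity (x 0 v * \sum_u x 0 u * Y x (upd_ix (rcons_ix g v) (wid y) u)).
      by rewrite mulr_sumr; apply: eq_bigr => u _; rewrite E mulrCA.
    by rewrite cY ?mulr0.
  have yj : young_col N (wid y) = young_col N (@ord_max j).
    by rewrite /young_col /= colj; rewrite /young_col in hy hyl; lia.
  set Z := \sum_u _; suff : Z = - Z by exact: (@eq_opp_eq0 R R^o).
  rewrite {1}/Z exchange_big /= -sumrN; apply: eq_bigr => v _; rewrite -sumrN.
  apply: eq_bigr => u _; rewrite mulrCA -!mulrN; congr (_ * (_ * _)).
  have ym : wid y != ord_max by apply/eqP => h; have := congr1 val h => /= e; have := ltn_ord y; rewrite e ltnn.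
  rewrite !E -(alt x _ _ _ ym yj); congr (Y x _).
  apply/ffunP => i; rewrite !ffunE; case: tpermP => [->|->|/eqP iy /eqP im].
  - by rewrite eqxx eq_sym (negbTE ym) /= insubN ?ltnn.
  - by rewrite eq_sym (negbTE ym) eqxx /= insubN ?ltnn.
  - rewrite (negbTE iy); case: insubP => //= /negP [].
    by rewrite ltn_neqAle -ltnS ltn_ord andbT; apply: contra_neq im => h; exact: val_inj.
split; first exact: smooth_ctr.
move=> x; split=> [a b ab h|c y hc].
  apply/ffunP => g; rewrite permE_ix !ffunE -sumrN; apply: eq_bigr => u _.
  by rewrite -reindex_rcons_ix alt ?mulrN.
apply/ffunP => g; rewrite sum_ffunE ffunE.
have [_ /(_ c (wid y) hc) hg] := gY x.
transitivity (\sum_u (\sum_(i : 'I_j | young_col N i == c)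
    x 0 u * Y x (rcons_ix (reindex_by (tperm i y) g) u) +
    (if young_col N (@ord_max j) == c then
      x 0 u * Y x (upd_ix (rcons_ix g (g y)) (wid y) u) else 0))).
  apply: eq_bigr => u _; rewrite {1}hg sum_ffunE mulr_sumr big_mkcond big_ord_recr /=.
  rewrite -big_mkcond /= permE_ix reindex_max_rcons_ix; congr (_ + _).
  by apply: eq_bigr => i _; rewrite permE_ix reindex_rcons_ix.
rewrite big_split /= [X in _ + X](_ : _ = 0) ?addr0.
  by rewrite exchange_big /=; apply: eq_bigr => i _; rewrite !ffunE.
case: eqP => [jc|_]; last by rewrite big1.
apply: cY; move: hc; rewrite -jc /young_col /= colj; lia.
Qed.

End Contraction.

(** * Leibniz rules for contraction and the Euler operator *)

Section CellOperators.
Variables (R : realType) (D q : nat).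
Local Notation P s T := (permute_indices s T).
Local Notation V := 'rV[R]_D.
Implicit Types (Z : tensor_field R D q) (c z : 'I_q) (cs : seq 'I_q) (f : multi_index D q).

(* The result still has degree [q] but no longer depends on the index of the cell [c]. *)
Definition iota_cell c Z : tensor_field R D q :=
  fun x => [ffun f => \sum_a x 0 a * Z x (upd_ix f c a)].

(** The Kronecker term of the Leibniz rule: the derivative at the cell [c] hits the position vector
    contracted into [z], which puts the index of [c] into [z]. *)
Definition copy_cell z c Z : tensor_field R D q := fun x => [ffun f => Z x (upd_ix f z (f c))].

Definition euler_field Z : tensor_field R D q := fun x => [ffun f => euler (fun y => Z y f) x].

Lemma smooth_iota_cell c Z : smooth_field Z -> smooth_field (iota_cell c Z).
Proof.
move=> hZ f; rewrite (_ : (fun x => _) = fun x : V => \sum_a x 0 a * Z x (upd_ix f c a)).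
  by apply: smooth_sum => a _; apply: smooth_coordM; exact: hZ.
by apply/funext => x; rewrite ffunE.
Qed.

Lemma smooth_copy_cell z c Z : smooth_field Z -> smooth_field (copy_cell z c Z).
Proof.
move=> hZ f; rewrite (_ : (fun x => _) = fun x : V => Z x (upd_ix f z (f c))); first exact: hZ.
by apply/funext => x; rewrite ffunE.
Qed.

Lemma smooth_euler (g : V -> R) : smooth g -> smooth (euler g).
Proof. by move=> hg; apply: smooth_sum => a _; apply: smooth_coordM; exact: smooth_partial. Qed.

Lemma smooth_euler_field Z : smooth_field Z -> smooth_field (euler_field Z).
Proof.
move=> hZ f; rewrite (_ : (fun x => _) = euler (fun y => Z y f)).
  by apply: smooth_euler; exact: hZ.
by apply/funext => x; rewrite ffunE.
Qed.

Lemma upd_ix_same f c : upd_ix f c (f c) = f.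
Proof. by apply/ffunP => i; rewrite ffunE; case: eqP => // ->. Qed.

Lemma upd_reindex f (s : 'S_q) c a : upd_ix (reindex_by s f) c a = reindex_by s (upd_ix f (s c) a).
Proof. by apply/ffunP => i; rewrite !ffunE (inj_eq perm_inj). Qed.

Lemma dcells_nil Z : dcells [::] Z = Z.
Proof. by apply/funext => x; apply/ffunP => f; rewrite ffunE. Qed.

Lemma dcells1E c Z x f : dcells [:: c] Z x f = partial (f c) (fun y => Z y f) x.
Proof. by rewrite ffunE. Qed.

Lemma dcells_cons c cs Z : dcells (c :: cs) Z = dcells [:: c] (dcells cs Z).
Proof. exact: (dcells_cat [:: c]). Qed.

Lemma dcellsD cs (Y Z : tensor_field R D q) x : smooth_field Y -> smooth_field Z ->
  dcells cs (fun y => Y y + Z y) x = dcells cs Y x + dcells cs Z x.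
Proof.
move=> hY hZ.
have h := @dcells_sum R D q cs bool [:: true; false] xpredT (fun=> 1) (fun b => if b then Y else Z) x _.
rewrite !big_cons !big_nil !addr0 !scale1r in h; rewrite -h; last by case.
by congr (dcells _ _ x); apply/funext => y; rewrite !big_cons big_nil addr0 !scale1r.
Qed.

Lemma dcells_sum1 cs (I : Type) (r : seq I) (Q : pred I) (F : I -> tensor_field R D q) x :
  (forall i, Q i -> smooth_field (F i)) ->
  dcells cs (fun y => \sum_(i <- r | Q i) F i y) x = \sum_(i <- r | Q i) dcells cs (F i) x.
Proof.
move=> hF; have := @dcells_sum R D q cs I r Q (fun=> 1) F x hF.
under [in RHS]eq_bigr do rewrite scale1r; move=> <-.
by congr (dcells _ _ x); apply/funext => y; apply: eq_bigr => i _; rewrite scale1r.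
Qed.

Lemma dcells_perm_fix cs (s : 'S_q) Z x : (forall c, c \in cs -> s c = c) ->
  dcells cs (fun y => P s (Z y)) x = P s (dcells cs Z x).
Proof.
move=> h; rewrite perm_dcells; congr (dcells _ _ x).
by rewrite -[LHS]map_id; apply/eq_in_map => c hc; rewrite h.
Qed.

Lemma stab_proj_dcells (I : eqType) (lab : 'I_q -> I) e cs Z x : smooth_field Z ->
  (forall s c, s \in stab lab -> c \in cs -> s c = c) ->
  stab_proj lab e (dcells cs Z x) = dcells cs (fun y => stab_proj lab e (Z y)) x.
Proof.
move=> hZ h; rewrite /stab_proj dcells_sum; last by move=> s _; exact: smooth_perm.
apply: eq_bigr => s hs; rewrite dcells_perm_fix // => c hc; exact: h.
Qed.

Lemma stab_proj_iota_cell (I : eqType) (lab : 'I_q -> I) e c Z x :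
  (forall s, s \in stab lab -> s c = c) ->
  stab_proj lab e (iota_cell c Z x) = iota_cell c (fun y => stab_proj lab e (Z y)) x.
Proof.
move=> h; apply/ffunP => f; rewrite /stab_proj sum_ffunE ffunE.
under [RHS]eq_bigr do rewrite sum_ffunE mulr_sumr.
rewrite [RHS]exchange_big /=; apply: eq_bigr => s hs.
rewrite ffunE permE_ix ffunE scaler_sumr; apply: eq_bigr => a _.
by rewrite [in RHS]ffunE permE_ix upd_reindex h // [LHS]mulrCA.
Qed.

Lemma euler_field_stab_proj (I : eqType) (lab : 'I_q -> I) e Z x : smooth_field Z ->
  stab_proj lab e (euler_field Z x) = euler_field (fun y => stab_proj lab e (Z y)) x.
Proof.
move=> hZ; apply/ffunP => f; rewrite /stab_proj sum_ffunE ffunE /euler.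
have E : (fun y => (\sum_(s in stab lab) stab_sgn R e s *: P s (Z y)) f) =
    fun y => \sum_(s in stab lab) stab_sgn R e s * Z y (reindex_by s f).
  by apply/funext => y; rewrite sum_ffunE; apply: eq_bigr => s _; rewrite ffunE permE_ix.
have hp i : partial i (fun y => \sum_(s in stab lab) stab_sgn R e s * Z y (reindex_by s f)) x =
    \sum_(s in stab lab) stab_sgn R e s * partial i (fun y => Z y (reindex_by s f)) x.
  exact (congr1 (@^~ x) (foldr_partial_lin _ (stab_sgn R e) [:: i] (fun s (_ : s \in stab lab) => hZ (reindex_by s f)))).
rewrite E; under [RHS]eq_bigr do rewrite hp mulr_sumr.
rewrite [RHS]exchange_big /=; apply: eq_bigr => s _.
by rewrite ffunE permE_ix ffunE [LHS]mulr_sumr; apply: eq_bigr => i _; rewrite mulrCA.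
Qed.

Lemma dcells1_iota_cell z c Z x : smooth_field Z -> c != z ->
  dcells [:: c] (iota_cell z Z) x = iota_cell z (dcells [:: c] Z) x + copy_cell z c Z x.
Proof.
move=> hZ cz; apply/ffunP => f; rewrite dcells1E [RHS]ffunE !ffunE.
have -> : (fun y => iota_cell z Z y f) = fun y : V => \sum_a y 0 a * Z y (upd_ix f z a).
  by apply/funext => y; rewrite ffunE.
rewrite partial_sum; last by move=> a _; apply: smooth_coordM; exact: hZ.
transitivity (\sum_a (x 0 a * partial (f c) (fun y => Z y (upd_ix f z a)) x +
    (if a == f c then Z x (upd_ix f z a) else 0))).
  apply: eq_bigr => a _; rewrite partial_coordM; last exact: hZ.
  by congr (_ + _); case: eqP => _; rewrite ?mul1r ?mul0r.
rewrite big_split /= -big_mkcond /= big_pred1_eq; congr (_ + _).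
by apply: eq_bigr => a _; rewrite dcells1E [upd_ix f z a c]ffunE (negbTE cz).
Qed.

(** Leibniz rule; the position vector is linear, so at most one derivative hits it. *)
Lemma dcells_iota_cell z cs Z x : smooth_field Z -> uniq cs -> z \notin cs ->
  dcells cs (iota_cell z Z) x =
  iota_cell z (dcells cs Z) x + \sum_(c <- cs) dcells (rem c cs) (copy_cell z c Z) x.
Proof.
move=> hZ; elim: cs x => [|c cs IH] x /=.
  by rewrite big_nil addr0 !dcells_nil.
move=> /andP[ccs ucs]; rewrite inE negb_or => /andP[zc zcs].
rewrite dcells_cons.
have -> : dcells cs (iota_cell z Z) = fun y => iota_cell z (dcells cs Z) y +
    \sum_(c <- cs) dcells (rem c cs) (copy_cell z c Z) y.
  by apply/funext => y; exact: IH.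
have sd := smooth_dcells cs hZ.
rewrite dcellsD; last 2 first.
- exact: smooth_iota_cell.
- by apply: smooth_field_sum => i _; apply: smooth_dcells; exact: smooth_copy_cell.
rewrite dcells1_iota_cell 1?eq_sym // -dcells_cons -addrA; congr (_ + _).
rewrite big_cons eqxx dcells_sum1; last first.
  by move=> i _; apply: smooth_dcells; exact: smooth_copy_cell.
congr (_ + _).
  apply/ffunP => f; rewrite !ffunE (_ : [seq upd_ix f z (f c) i | i <- cs] = [seq f i | i <- cs]).
    by congr (foldr _ _ _ x); apply/funext => y; rewrite ffunE.
  apply/eq_in_map => i hi; rewrite ffunE; case: eqP => // e.
  by rewrite -e hi in zcs.
rewrite !big_seq; apply: eq_bigr => i hi; rewrite -dcells_cons.
by case: eqP => // e; rewrite e hi in ccs.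
Qed.

Lemma euler_partial (g : V -> R) i x : smooth g ->
  partial i (euler g) x = euler (partial i g) x + partial i g x.
Proof.
move=> hg; rewrite /euler partial_sum; last by move=> a _; apply: smooth_coordM; exact: smooth_partial.
transitivity (\sum_a (x 0 a * partial a (partial i g) x + (if a == i then partial a g x else 0))).
  apply: eq_bigr => a _; rewrite partial_coordM; last exact: smooth_partial.
  rewrite (partialC i a hg).
  by congr (_ + _); case: eqP => _; rewrite ?mul1r ?mul0r.
by rewrite big_split /= -big_mkcond /= big_pred1_eq.
Qed.

Lemma foldr_partial_euler (g : V -> R) s x : smooth g ->
  foldr (@partial R D) (euler g) s x =
  euler (foldr (@partial R D) g s) x + (size s)%:R * foldr (@partial R D) g s x.
Proof.
move=> hg; elim: s x => [|i s IH] x /=; first by rewrite mul0r addr0.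
have sg := smooth_foldr s hg.
have -> : foldr (@partial R D) (euler g) s = fun y => euler (foldr (@partial R D) g s) y +
    (size s)%:R * foldr (@partial R D) g s y by apply/funext => y; exact: IH.
rewrite partialD; [|exact: smooth_euler|exact: smoothZ].
rewrite (partialZ _ _ sg) (euler_partial _ _ sg) -addrA; congr (_ + _).
by rewrite -natr1 mulrDl mul1r addrC.
Qed.

Lemma dcells_euler cs Z x : smooth_field Z ->
  dcells cs (euler_field Z) x = euler_field (dcells cs Z) x + (size cs)%:R *: dcells cs Z x.
Proof.
move=> hZ; apply/ffunP => f; rewrite [RHS]ffunE !ffunE.
have -> : (fun y => euler_field Z y f) = euler (fun y => Z y f).
  by apply/funext => y; rewrite ffunE.
by rewrite (foldr_partial_euler _ _ (hZ f)) size_map dcellsE.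
Qed.

End CellOperators.

(** * The Poincare homotopy in one column *)

Section ColumnHomotopy.
Variables (R : realType) (D q : nat) (I : eqType) (lab : 'I_q -> I).
Local Notation P s T := (permute_indices s T).
Local Notation V := 'rV[R]_D.

(** For a field alternating in the column [c]: vanishing of the exterior derivative in the indices
    of that column, solved for the term differentiated along the additional index [a]. *)
Definition closed_in (c : I) (Z : tensor_field R D q) := forall a f x,
  partial a (fun y => Z y f) x =
  \sum_(i | lab i == c) partial (f i) (fun y => Z y (upd_ix f i a)) x.

Definition alt_in (c : I) (T : tensor R D q) := forall a b, a != b -> lab a = c -> lab b = c ->
  P (tperm a b) T = - T.

Lemma stab_proj_absorb (I' : eqType) (lab' : 'I_q -> I') e (T : tensor R D q) :
  (forall a b, lab' a = lab' b -> lab a = lab b) ->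
  stab_proj lab e (stab_proj lab' e T) = #|stab lab'|%:R *: stab_proj lab e T.
Proof.
move=> h; rewrite {2}/stab_proj linear_sum /= (eq_bigr (fun=> stab_proj lab e T)).
  by rewrite sumr_const scaler_nat.
move=> s /stabP hs; rewrite linearZ /= stab_proj_perm; last by apply/stabP => i; exact: h.
by rewrite scalerA stab_sgn_sq scale1r.
Qed.

(* The Poincare homotopy in the column of the cell [z]: the antisymmetrization over that column
   turns the closedness of [Z] into Euler's operator. *)
Lemma homotopy_column (z : 'I_q) (cs : seq 'I_q) (Z : tensor_field R D q) x :
  smooth_field Z -> (forall y, alt_in (lab z) (Z y)) -> closed_in (lab z) Z ->
  (forall c, c \in cs -> lab c != lab z) ->
  #|[pred i | lab i == lab z]|%:R *: stab_proj lab true (dcells cs (dcells [:: z] (iota_cell z Z)) x) =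
  (#|[pred i | lab i == lab z]| + size cs)%:R *: stab_proj lab true (dcells cs Z x) +
  euler_field (fun y => stab_proj lab true (dcells cs Z y)) x.
Proof.
move=> sZ aZ cZ hcs; set n := #|_|; set W := dcells [:: z] _.
(* The stabilizer of [labz] permutes the column of [z] alone; its antisymmetrization performs the
   homotopy and is absorbed afterwards by the full one. *)
pose labz i := if lab i == lab z then None else Some i.
have labzP a b : labz a = labz b -> lab a = lab b.
  rewrite /labz; case: eqP => [->|_]; case: eqP => [->|_] //; by case=> ->.
have hz b : (labz b == labz z) = (lab b == lab z).
  by rewrite /labz eqxx; case: (lab b == lab z).
have sgnZ y s : s \in stab labz -> P s (Z y) = stab_sgn R true s *: Z y.
  apply: stab_inv_tperm => a b ab; rewrite /labz expr1 scaleN1r.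
  case: eqP => [ha|_]; case: eqP => [hb _|_] //; first exact: aZ.
  by case=> e; rewrite e eqxx in ab.
have sW : smooth_field W by apply: smooth_dcells; exact: smooth_iota_cell.
pose nn := #|[set s : 'S_q in stab labz | s z == z]|.
have nn0 : nn%:R != 0 :> R by rewrite pnatr_eq0 -lt0n stab_fiber_gt0.
have cardE : #|stab labz|%:R = nn%:R * n%:R :> R.
  rewrite -[LHS]mulr1 mulr_natl -sumr_const (stab_sum labz z (fun=> 1)) sumr_const.
  rewrite -[LHS]mulr_natl; congr (_%:R * _%:R).
  by apply: eq_card => b; rewrite [RHS]inE -hz.
(* Cartan's formula for a closed form of degree [n]: derivatives hitting the position vector give
   [n] copies of [Z], and closedness turns the rest into the Euler operator. *)
have WE y : stab_proj labz true (W y) = nn%:R *: (n%:R *: Z y + euler_field Z y).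
  apply/ffunP => f; pose G b := Z y f + \sum_a y 0 a * partial (f b) (fun u => Z u (upd_ix f b a)) y.
  transitivity (\sum_(s in stab labz) G (s z)).
    rewrite /stab_proj sum_ffunE; apply: eq_bigr => s hs.
    rewrite ffunE permE_ix dcells1E ffunE.
    have -> : (fun u => iota_cell z Z u (reindex_by s f)) =
        fun u : V => \sum_a stab_sgn R true s * (u 0 a * Z u (upd_ix f (s z) a)).
      apply/funext => u; rewrite ffunE; apply: eq_bigr => a _.
      rewrite upd_reindex -permE_ix sgnZ // ffunE mulrCA; reflexivity.
    rewrite partial_sum; last by move=> a _; apply: smoothZ; apply: smooth_coordM; exact: sZ.
    rewrite [LHS]mulr_sumr (eq_bigr (fun a => (if a == f (s z) then Z y (upd_ix f (s z) a) else 0) +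
        y 0 a * partial (f (s z)) (fun u => Z u (upd_ix f (s z) a)) y)).
      by rewrite big_split /= -big_mkcond /= big_pred1_eq upd_ix_same.
    move=> a _; rewrite partialZ; last by apply: smooth_coordM; exact: sZ.
    rewrite mulrA stab_sgn_sq mul1r partial_coordM; last exact: sZ.
    by rewrite addrC; congr (_ + _); case: eqP => _; rewrite ?mul1r ?mul0r.
  rewrite stab_sum (eq_bigl (fun b => lab b == lab z)) // [RHS]ffunE -[LHS]mulr_natl.
  congr (_ * _); rewrite [RHS]ffunE big_split /= sumr_const.
  congr (_ + _); first by rewrite ffunE -[LHS]mulr_natl.
  rewrite exchange_big /= ffunE /euler; apply: eq_bigr => a _.
  by rewrite (cZ a f y) mulr_sumr.
(* The additional [size cs] comes from moving the Euler operator across the derivatives in [cs]. *)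
have key : #|stab labz|%:R *: stab_proj lab true (dcells cs W x) =
    nn%:R *: ((n + size cs)%:R *: stab_proj lab true (dcells cs Z x) +
      euler_field (fun y => stab_proj lab true (dcells cs Z y)) x).
  rewrite -(stab_proj_absorb true (dcells cs W x) labzP).
  rewrite (stab_proj_dcells true x sW); last first.
    move=> s c /stabP hs /hcs hc; have := hs c; rewrite /labz (negbTE hc).
    by case: eqP => // _ [].
  have -> : (fun y => stab_proj labz true (W y)) =
      fun y => nn%:R *: (n%:R *: Z y + euler_field Z y) by apply/funext => y; exact: WE.
  have sE := smooth_euler_field sZ; have snZ := smooth_fieldZ n%:R sZ.
  rewrite dcellsZ; last exact: smooth_fieldD.
  rewrite linearZ /= dcellsD // dcellsZ // dcells_euler // !linearD !linearZ /=.
  rewrite euler_field_stab_proj; last exact: smooth_dcells.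
  by rewrite [nn%:R *: euler_field _ _ + _]addrC natrD [in RHS]scalerDl -!addrA.
apply: (scalerI nn0); rewrite -key cardE scalerA; reflexivity.
Qed.

End ColumnHomotopy.

Section ClosedFields.
Variables (R : realType) (D q : nat) (I : eqType) (lab : 'I_q -> I).
Local Notation P s T := (permute_indices s T).
Local Notation V := 'rV[R]_D.

Definition op_field p (G : (V -> R) -> V -> R) (T : tensor_field R D p) : tensor_field R D p :=
  fun x => [ffun f => G (fun y => T y f) x].

Lemma op_fieldE p G (T : tensor_field R D p) f :
  (fun x => op_field G T x f) = G (fun y => T y f).
Proof. by apply/funext => x; rewrite ffunE. Qed.

Lemma closed_inZ c k (Z : tensor_field R D q) : smooth_field Z -> closed_in lab c Z ->
  closed_in lab c (fun x => k *: Z x).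
Proof.
move=> sZ cZ a f x.
have E g : (fun y => (k *: Z y) g) = fun y => k * Z y g by apply/funext => y; rewrite ffunE.
rewrite E partialZ; last exact: sZ.
rewrite cZ mulr_sumr; apply: eq_bigr => i _; rewrite E partialZ //; exact: sZ.
Qed.

Lemma closed_in_euler_inv n r c (Z : tensor_field R D q) : smooth_field Z -> closed_in lab c Z ->
  closed_in lab c (op_field (euler_inv n r) Z).
Proof.
move=> sZ cZ a f x; rewrite op_fieldE partial_euler_inv; last exact: sZ.
have -> : partial a (fun y => Z y f) = fun x =>
   \sum_(i | lab i == c) partial (f i) (fun y => Z y (upd_ix f i a)) x.
  by apply/funext => y; rewrite cZ.
rewrite (linear_on_smooth_sum _ (linear_euler_inv _ _ _ _)); last first.
  by move=> i _; apply: smooth_partial; exact: sZ.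
by apply: eq_bigr => i _; rewrite op_fieldE partial_euler_inv; [|exact: sZ].
Qed.

(** Where a derivative hits the position vector, the identity is the Garnir relation between [z] and
    the column [c]; elsewhere it is the closedness of [Z]. *)
Lemma closed_in_iota_cell c z (Z : tensor_field R D q) : smooth_field Z -> lab z != c ->
  (forall x, Z x = \sum_(i | lab i == c) P (tperm i z) (Z x)) ->
  closed_in lab c Z -> closed_in lab c (iota_cell z Z).
Proof.
move=> sZ zc gZ cZ b f x.
have E g : (fun y => iota_cell z Z y g) = fun y : V => \sum_a y 0 a * Z y (upd_ix g z a).
  by apply/funext => y; rewrite ffunE.
have pE g e : partial e (fun y => iota_cell z Z y g) x =
    Z x (upd_ix g z e) + \sum_a x 0 a * partial e (fun y => Z y (upd_ix g z a)) x.
  rewrite E partial_sum; last by move=> a _; apply: smooth_coordM; exact: sZ.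
  rewrite (eq_bigr (fun a => (if a == e then Z x (upd_ix g z a) else 0) +
      x 0 a * partial e (fun y => Z y (upd_ix g z a)) x)).
    by rewrite big_split /= -big_mkcond /= big_pred1_eq.
  move=> a _; rewrite partial_coordM; last exact: sZ.
  by rewrite addrC; congr (_ + _); case: eqP => _; rewrite ?mul1r ?mul0r.
rewrite pE (eq_bigr _ (fun i _ => pE _ _)) big_split /=; congr (_ + _).
  rewrite {1}gZ sum_ffunE; apply: eq_bigr => i /eqP ic.
  have iz : i != z by apply: contraNneq zc => <-; apply/eqP.
  rewrite permE_ix; congr (Z x _); apply/ffunP => k; rewrite !ffunE.
  case: tpermP => [->|->|/eqP ki /eqP kz].
  - by rewrite !eqxx (negbTE iz).
  - by rewrite eqxx (negbTE iz).
  - by rewrite (negbTE ki) (negbTE kz).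
rewrite exchange_big /=; apply: eq_bigr => a _; rewrite cZ mulr_sumr; apply: eq_bigr => i /eqP ic.
have iz : i != z by apply: contraNneq zc => <-; apply/eqP.
congr (_ * _); rewrite ffunE (negbTE iz); congr (partial _ _ x); apply/funext => y.
congr (Z y _); apply/ffunP => k; rewrite !ffunE.
by case: eqP => // ->; rewrite (negbTE iz).
Qed.

End ClosedFields.

(** * Successive contractions of the last row *)

Section ContractionChain.
Variables (R : realType) (N D l n : nat).
Hypothesis N2 : (2 <= N)%N.
Hypothesis lm : (l < N.-1)%N.
Local Notation P s T := (permute_indices s T).
Local Notation m := N.-1.
Local Notation p := (m * n)%N.
Local Notation Q := (l + m * n)%N.
Local Notation col := (young_col N).

Lemma col_new (c : 'I_Q) : (p <= c)%N -> (col c < l)%N.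
Proof.
move=> h; have hc := ltn_ord c.
by rewrite /young_col -[nat_of_ord c](subnKC h) {1}mulnC modnMDl modn_small; lia.
Qed.

(* [stab left_lab] permutes the cells inside the columns on the left of [l], those that contain
   new cells. *)
Definition left_lab (i : 'I_Q) : nat + 'I_Q := if (col i < l)%N then inl (col i) else inr i.

Local Notation AL := (stab_proj left_lab true).

Lemma left_lab_col a b : left_lab a = left_lab b -> col a = col b.
Proof. by rewrite /left_lab; case: ltnP => _; case: ltnP => _ // -[] // ->. Qed.

Lemma left_stab_fix s (i : 'I_Q) : s \in stab left_lab -> (l <= col i)%N -> s i = i.
Proof.
move=> /stabP hs hi; have := hs i; rewrite /left_lab [(col i < l)%N]ltnNge hi /=.
by case: ltnP => // _ [].
Qed.

Lemma left_proj_tperm (a b : 'I_Q) (T : tensor R D Q) : (l <= col a)%N -> (l <= col b)%N ->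
  AL (P (tperm a b) T) = P (tperm a b) (AL T).
Proof.
move=> ha hb.
apply: (stab_proj_normal true T (g := fun u => match u with inl c => inl c | inr i => inr (tperm a b i) end)).
  move=> i; rewrite /left_lab; case: tpermP => [->|->|/eqP ia /eqP ib].
  - by rewrite ltnNge hb ltnNge ha /= tpermL.
  - by rewrite ltnNge ha ltnNge hb /= tpermR.
  - by case: ifP => //= _; rewrite tpermD // eq_sym.
by apply: inv_inj => -[u|u] //; rewrite tpermK.
Qed.

Definition new_cells : seq 'I_Q := cells_from p Q.

(** The columns from [l] on are left alone: they contain no new cell, and the fields considered are
    already alternating there. *)
Definition left_grad j (le : (j <= Q)%N) (Y : tensor_field R D j) : tensor_field R D Q :=
  fun x => AL (dcells new_cells (ext le Y) x).

Lemma smooth_left_grad j (le : (j <= Q)%N) (Y : tensor_field R D j) :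
  smooth_field Y -> smooth_field (left_grad le Y).
Proof. by move=> hY; apply: smooth_stab_proj; apply: smooth_dcells; exact: smooth_ext. Qed.

Lemma new_cells_tperm j (le : (j <= Q)%N) (a b : 'I_j) (Y : tensor_field R D j) x : (j <= p)%N ->
  P (tperm (widen_ord le a) (widen_ord le b)) (dcells new_cells (ext le Y) x) =
  dcells new_cells (ext le (fun y => P (tperm a b) (Y y))) x.
Proof.
move=> jp; rewrite perm_dcells map_tperm_low; last 2 first.
- exact: leq_trans (ltn_ord a) jp.
- exact: leq_trans (ltn_ord b) jp.
congr (dcells _ _ x); apply/funext => y.
by apply: perm_ext => i; exact: tperm_widen.
Qed.

Lemma left_grad_tperm j (le : (j <= Q)%N) (a b : 'I_j) (Y : tensor_field R D j) x : (j <= p)%N ->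
  (l <= col a)%N -> (l <= col b)%N ->
  P (tperm (widen_ord le a) (widen_ord le b)) (left_grad le Y x) =
  left_grad le (fun y => P (tperm a b) (Y y)) x.
Proof. by move=> jp ha hb; rewrite -left_proj_tperm // new_cells_tperm. Qed.

Lemma left_gradZ j (le : (j <= Q)%N) k (Y : tensor_field R D j) x : smooth_field Y ->
  left_grad le (fun y => k *: Y y) x = k *: left_grad le Y x.
Proof.
move=> sY; rewrite /left_grad -[RHS]linearZ /= -dcellsZ; last exact: smooth_ext.
congr (AL (dcells _ _ x)); apply/funext => y; apply/ffunP => f; rewrite !ffunE.
by [].
Qed.

Lemma left_grad_sum j (le : (j <= Q)%N) (J : Type) (r : seq J) (C : pred J)
    (F : J -> tensor_field R D j) x : (forall i, C i -> smooth_field (F i)) ->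
  left_grad le (fun y => \sum_(i <- r | C i) F i y) x = \sum_(i <- r | C i) left_grad le (F i) x.
Proof.
move=> sF; rewrite /left_grad.
have -> : ext le (fun y => \sum_(i <- r | C i) F i y) = fun y => \sum_(i <- r | C i) ext le (F i) y.
  by apply/funext => y; apply/ffunP => f; rewrite ffunE !sum_ffunE; apply: eq_bigr => i _; rewrite ffunE.
rewrite dcells_sum1; last by move=> i Ci; apply: smooth_ext; exact: sF.
by rewrite linear_sum.
Qed.

Lemma ext_ctr j (jQ : (j < Q)%N) (Y : tensor_field R D j.+1) :
  ext (ltnW jQ) (ctr Y) = iota_cell (Ordinal jQ) (ext jQ Y).
Proof.
apply/funext => x; apply/ffunP => f; rewrite !ffunE; apply: eq_bigr => a _.
rewrite ffunE; congr (_ * Y x _); apply/ffunP; apply: ord_lastP => [i|].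
  rewrite rcons_ix_widen !ffunE (_ : _ == _ = false); last first.
    by apply/eqP => h; have := congr1 val h => /= e; have := ltn_ord i; rewrite e ltnn.
  by congr (f _); exact: val_inj.
rewrite rcons_ix_max !ffunE (_ : _ == _ = true) //.
by apply/eqP; exact: val_inj.
Qed.

(* The Garnir relations of [Y] kill the terms in which a derivative hits the position vector. *)
Lemma left_grad_ctr j (jQ : (j < Q)%N) (Y : tensor_field R D j.+1) : (j < p)%N ->
  (l <= col (Ordinal jQ))%N -> young_field N Y ->
  left_grad (ltnW jQ) (ctr Y) = iota_cell (Ordinal jQ) (left_grad jQ Y).
Proof.
move=> jp lz [sY gY]; set z := Ordinal jQ.
have sE : smooth_field (ext jQ Y) by exact: smooth_ext.
have zw : z = widen_ord jQ (@ord_max j) by exact: val_inj.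
apply/funext => x; rewrite /left_grad ext_ctr.
have zn : z \notin new_cells by rewrite mem_cells_from -ltnNge.
rewrite (dcells_iota_cell x sE (cells_from_uniq _ _) zn) linearD /= stab_proj_iota_cell; last first.
  by move=> s hs; exact: left_stab_fix.
rewrite linear_sum /= [X in _ + X]big1_seq ?addr0 // => c /= hc.
have pc : (p <= c)%N by rewrite mem_cells_from in hc.
have cl := col_new pc.
set C := copy_cell _ _ _.
have CE : C = fun y => P (tperm z c) (ext jQ Y y).
  apply/funext => y; apply/ffunP => f; rewrite permE_ix !ffunE; congr (Y y _).
  apply/ffunP => i; rewrite !ffunE.
  have [->|iz] := eqVneq (widen_ord jQ i) z; first by rewrite tpermL.
  rewrite tpermD 1?eq_sym //; apply/eqP => e; have := congr1 val e => /= h.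
  by have := ltn_ord i; lia.
have sC : smooth_field C by exact: smooth_copy_cell.
have clast : (col c < col (@ord_max j))%N by exact: leq_trans cl lz.
have Crel : C = fun y => \sum_(i : 'I_j.+1 | col i == col c) P (tperm (widen_ord jQ i) c) (C y).
  apply/funext => y; rewrite {1}CE.
  have -> : ext jQ Y y = \sum_(i : 'I_j.+1 | col i == col c) P (tperm (widen_ord jQ i) z) (ext jQ Y y).
    have [_ /(_ (col c) ord_max clast) h] := gY y.
    apply/ffunP => f; rewrite ffunE h !sum_ffunE; apply: eq_bigr => i _.
    rewrite zw (@perm_ext _ _ _ _ jQ _ (tperm i ord_max)) ?ffunE //.
    by move=> k; exact: tperm_widen.
  rewrite linear_sum /=; apply: eq_bigr => i ic; rewrite CE !permute_indicesM.
  congr (P _ _).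
  have wz : widen_ord jQ i != z.
    apply/eqP => e; have := congr1 val e => /= h.
    have im : i = ord_max by exact: val_inj.
    by rewrite im in ic; rewrite (eqP ic) ltnn in clast.
  have wc : widen_ord jQ i != c.
    apply/eqP => e; have := congr1 val e => /= h; have := ltn_ord i; lia.
  have zc : z != c by apply/eqP => e; have := congr1 val e => /= h; lia.
  have <- : (tperm (widen_ord jQ i) z ^ tperm z c = tperm (widen_ord jQ i) c)%g.
    by rewrite tpermJ tpermL tpermD // eq_sym.
  by rewrite /conjg tpermV !mulgA tperm2 mul1g.
(* [C] is a sum of transforms of itself, each of which is odd under [AL]. *)
have key : AL (dcells (rem c new_cells) C x) =
    - (#|[pred i : 'I_j.+1 | col i == col c]|%:R *: AL (dcells (rem c new_cells) C x)).
  rewrite {1}Crel dcells_sum1; last by move=> i _; exact: smooth_perm.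
  rewrite linear_sum /= (eq_bigr (fun=> - AL (dcells (rem c new_cells) C x))).
    by rewrite sumr_const -scaler_nat scalerN.
  move=> i /eqP ic.
  have wc : widen_ord jQ i != c.
    apply/eqP => e; have := congr1 val e => /= h; have := ltn_ord i; lia.
  rewrite dcells_perm_fix; last first.
    move=> k; rewrite (mem_rem_uniq _ (cells_from_uniq _ _)) inE mem_cells_from => /andP[kc pk].
    rewrite tpermD 1?eq_sym //; apply/eqP => e; have := congr1 val e => /= h; have := ltn_ord i; lia.
  rewrite stab_proj_perm; last by apply: stab_tperm; rewrite /left_lab (_ : col (widen_ord jQ i) = col c) // cl.
  by rewrite stab_sgn_tperm // expr1 scaleN1r.
have : (#|[pred i : 'I_j.+1 | col i == col c]|.+1)%:R *: AL (dcells (rem c new_cells) C x) == 0.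
  by rewrite -natr1 scalerDl scale1r {2}key subrr.
by rewrite scaler_eq0 pnatr_eq0 /= => /eqP.
Qed.

End ContractionChain.

Section OpFields.
Variables (R : realType) (D : nat) (G : ('rV[R]_D -> R) -> 'rV[R]_D -> R).
Hypotheses (smG : forall f, smooth f -> smooth (G f)) (linG : linear_on_smooth G).
Local Notation P s T := (permute_indices s T).

Lemma smooth_op_field p (T : tensor_field R D p) : smooth_field T -> smooth_field (op_field G T).
Proof. by move=> hT f; rewrite op_fieldE; apply: smG; exact: hT. Qed.

Lemma perm_op_field p s (T : tensor_field R D p) x :
  P s (op_field G T x) = op_field G (fun y => P s (T y)) x.
Proof.
apply/ffunP => f; rewrite permE_ix !ffunE; congr (G _ x).
by apply/funext => y; rewrite permE_ix.
Qed.

Lemma op_field_sum p (J : Type) (r : seq J) (C : pred J) (k : J -> R)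
    (F : J -> tensor_field R D p) x : (forall i, C i -> smooth_field (F i)) ->
  op_field G (fun y => \sum_(i <- r | C i) k i *: F i y) x =
  \sum_(i <- r | C i) k i *: op_field G (F i) x.
Proof.
move=> sF; apply/ffunP => f; rewrite ffunE sum_ffunE.
have -> : (fun y => (\sum_(i <- r | C i) k i *: F i y) f) =
    fun y => \sum_(i <- r | C i) k i * F i y f.
  by apply/funext => y; rewrite sum_ffunE; apply: eq_bigr => i _; rewrite ffunE.
rewrite (linear_on_smooth_sum _ linG); last by move=> i Ci; apply: smoothZ; exact: sF.
apply: eq_bigr => i Ci; have [_ GZ] := linG.
by rewrite GZ ?ffunE //; exact: sF.
Qed.

Lemma stab_proj_op_field p (I : eqType) (lab : 'I_p -> I) e (T : tensor_field R D p) x :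
  smooth_field T ->
  stab_proj lab e (op_field G T x) = op_field G (fun y => stab_proj lab e (T y)) x.
Proof.
move=> sT; rewrite /stab_proj op_field_sum; last by move=> s _; exact: smooth_perm.
by apply: eq_bigr => s _; rewrite perm_op_field.
Qed.

Lemma young_field_op N p (T : tensor_field R D p) : young_field N T -> young_field N (op_field G T).
Proof.
move=> [sT gT]; split=> [|x]; first exact: smooth_op_field.
split=> [a b ab h|c y hc].
  have -> : - op_field G T x = \sum_(i <- [:: tt]) (-1) *: op_field G T x by rewrite big_seq1 scaleN1r.
  rewrite -(@op_field_sum p unit [:: tt] xpredT (fun=> -1) (fun=> T)) // perm_op_field.
  congr (op_field G _ x); apply/funext => u; rewrite big_seq1 scaleN1r.
  by have [-> ] := gT u.
rewrite (eq_bigr (fun i => 1 *: op_field G (fun u => P (tperm i y) (T u)) x)); last first.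
  by move=> i _; rewrite scale1r perm_op_field.
rewrite -op_field_sum; last by move=> i _; exact: smooth_perm.
congr (op_field G _ x); apply/funext => u; have [_ /(_ c y hc) h] := gT u.
by rewrite {1}h; apply: eq_bigr => i _; rewrite scale1r.
Qed.

End OpFields.

Section ColumnSteps.
Variables (R : realType) (N D l n : nat).
Hypothesis N2 : (2 <= N)%N.
Hypothesis lm : (l < N.-1)%N.
Local Notation P s T := (permute_indices s T).
Local Notation m := N.-1.
Local Notation p := (m * n)%N.
Local Notation Q := (l + m * n)%N.
Local Notation col := (young_col N).
Local Notation U := (@left_grad R N D l n _).

Let m0 : (0 < m)%N. Proof. by case: N N2 => [|[]]. Qed.

Lemma col_old (i : 'I_Q) : (l <= col i)%N -> (i < p)%N.
Proof. by move=> h; rewrite ltnNge; apply/negP => /(col_new N2 lm); rewrite ltnNge h. Qed.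

(** The cell [i] lies in one of the [n] rows of the rectangle, and [j] lies in the last of them. *)
Lemma col_low j (i : 'I_Q) : (j < p)%N -> (p <= j + m)%N -> (l <= col i)%N ->
  (col i <= j %% m)%N -> (i <= j)%N.
Proof.
move=> jp pj li ij; have ip := col_old li.
rewrite (divn_eq i m) (divn_eq j m) leq_add // leq_mul2r; apply/orP; right.
have -> : (j %/ m = n.-1)%N.
  have := modn_last N2 jp pj; have := divn_eq j m => e1 e2.
  have n0 : (0 < n)%N by case: n jp; rewrite ?muln0.
  have : (j %/ m * m = n.-1 * m)%N.
    have e3 : (m * n = m + n.-1 * m)%N by rewrite -{1}(prednK n0) mulnS mulnC.
    lia.
  by move/eqP; rewrite eqn_pmul2r // => /eqP.
have n0 : (0 < n)%N by case: n jp; rewrite ?muln0.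
by rewrite -ltnS (prednK n0) ltn_divLR // [X in (_ < X)%N]mulnC.
Qed.

Lemma card_col c : (l <= c)%N -> (c < m)%N -> #|[pred i : 'I_Q | col i == c]| = n.
Proof.
move=> lc cm.
have hb (i : 'I_n) : (m * i + c < Q)%N.
  have := ltn_ord i => h; apply: (@leq_trans (m * i.+1)); first by rewrite mulnS addnC ltn_add2r.
  by apply: leq_trans (leq_addl _ _); rewrite leq_mul2l h orbT.
pose h i : 'I_Q := Ordinal (hb i).
have hi : injective h.
  move=> a b /(congr1 val) /= /eqP; rewrite eqn_add2r eqn_pmul2l // => /eqP; exact: val_inj.
rewrite -[RHS]card_ord -(card_codom hi); apply: eq_card => i; rewrite inE.
apply/eqP/codomP => [ic|[k ->]]; last by rewrite /young_col /= mulnC modnMDl modn_small.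
have ip : (i < p)%N by apply: col_old; rewrite ic.
have hr : (i %/ m < n)%N by rewrite ltn_divLR // [X in (_ < X)%N]mulnC.
by exists (Ordinal hr); apply: val_inj; rewrite /= {1}(divn_eq i m) mulnC -ic.
Qed.

Lemma left_grad_alt j (jQ : (j < Q)%N) (Y : tensor_field R D j.+1) (x : 'rV[R]_D) : (j < p)%N ->
  (p <= j + m)%N -> (l <= col (Ordinal jQ))%N -> young_field N Y ->
  alt_in (@young_col N _) (col (Ordinal jQ)) (U jQ Y x).
Proof.
move=> jp pj lz [sY gY] a b ab ha hb.
have la : (a < j.+1)%N by rewrite ltnS; apply: col_low => //; rewrite ha.
have lb : (b < j.+1)%N by rewrite ltnS; apply: col_low => //; rewrite hb.
have ea : a = widen_ord jQ (Ordinal la) by exact: val_inj.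
have eb : b = widen_ord jQ (Ordinal lb) by exact: val_inj.
rewrite ea eb left_grad_tperm //; try by rewrite /young_col /= -/(col _) ?ha ?hb.
rewrite -scaleN1r -left_gradZ //; congr (U _ _ x); apply/funext => y.
have [h _] := gY y; rewrite scaleN1r; apply: h.
  by apply: contra_neq ab => /(congr1 val) /= h; exact: val_inj.
by rewrite /young_col /=; rewrite /young_col in ha hb; rewrite ha hb.
Qed.

(** A column between [l] and the last cell of [Y] consists of cells of [Y] only, so the relation
    passes through [left_grad] term by term. *)
Lemma left_grad_garnir j (jQ : (j < Q)%N) (Y : tensor_field R D j.+1) c (x : 'rV[R]_D) : (j < p)%N ->
  (p <= j + m)%N -> (l <= c)%N -> (c < col (Ordinal jQ))%N -> young_field N Y ->
  U jQ Y x = \sum_(i | col i == c) P (tperm i (Ordinal jQ)) (U jQ Y x).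
Proof.
move=> jp pj lc cz [sY gY].
have zw : Ordinal jQ = widen_ord jQ (@ord_max j) by exact: val_inj.
transitivity (U jQ (fun y => \sum_(i : 'I_j.+1 | col i == c) P (tperm i ord_max) (Y y)) x).
  by congr (U _ _ x); apply/funext => y; have [_ /(_ c ord_max cz)] := gY y.
rewrite left_grad_sum; last by move=> i _; exact: smooth_perm.
rewrite [RHS](reindex_onto (widen_ord jQ) (fun i : 'I_Q => inord i)) /=; last first.
  move=> i /eqP ic; apply: val_inj; rewrite /= inordK // ltnS; apply: col_low => //.
    by rewrite ic.
  by rewrite ic; exact: ltnW.
apply: eq_big => [i|i /eqP ic].
  by rewrite inord_val eqxx andbT.
by rewrite zw left_grad_tperm // ?ic //; exact: leq_trans lc (ltnW _).
Qed.

End ColumnSteps.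

Section Chain.
Variables (R : realType) (N D l n : nat).
Hypothesis N2 : (2 <= N)%N.
Hypothesis lm : (l < N.-1)%N.
Local Notation V := 'rV[R]_D.
Local Notation m := N.-1.
Local Notation p := (m * n)%N.
Local Notation Q := (l + m * n)%N.
Local Notation col := (young_col N).
Local Notation A := (stab_proj (@young_col N _) true).
Local Notation U := (@left_grad R N D l n _).

Let m0 : (0 < m)%N. Proof. by case: N N2 => [|[]]. Qed.

(* The cells [j, ..., p - 1] that have been contracted in a field of degree [j]. *)
Definition free_cells j : seq 'I_Q := [seq c : 'I_Q <- enum 'I_Q | (j <= c < p)%N].

Lemma mem_free_cells j c : (c \in free_cells j) = (j <= c < p)%N.
Proof. by rewrite mem_filter mem_enum andbT. Qed.

Lemma free_cells_uniq j : uniq (free_cells j).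
Proof. by rewrite filter_uniq // enum_uniq. Qed.

Lemma free_cellsS j (jQ : (j < Q)%N) : (j < p)%N ->
  perm_eq (free_cells j) (free_cells j.+1 ++ [:: Ordinal jQ]).
Proof.
move=> jp; apply: uniq_perm; first exact: free_cells_uniq.
  rewrite cat_uniq free_cells_uniq /= orbF andbT mem_free_cells /=.
  by rewrite ltnn.
move=> c; rewrite mem_cat inE !mem_free_cells -(inj_eq val_inj) /=.
by lia.
Qed.

Lemma free_cells_nil : free_cells p = [::].
Proof. by rewrite /free_cells (eq_filter (a2 := pred0)) ?filter_pred0 // => c /=; lia. Qed.

Lemma size_free_cells i j : (i + j = p)%N -> size (free_cells j) = i.
Proof.
elim: i j => [|i IH] j e; first by rewrite (_ : j = p) ?free_cells_nil.
have jp : (j < p)%N by lia.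
have jQ : (j < Q)%N by lia.
rewrite (perm_size (free_cellsS jQ jp)) size_cat IH ?addn1 //; lia.
Qed.

(** Up to a nonzero scalar, the antisymmetrized gradient along all cells from [j] on. Keeping new
    and contracted cells apart allows one homotopy per contracted cell. *)
Definition chain_grad j (le : (j <= Q)%N) (Y : tensor_field R D j) : tensor_field R D Q :=
  fun x => A (dcells (free_cells j) (U le Y) x).

(** This is [homotopy_column] in the column of the cell [j]: its height is [n], and the [i] cells
    contracted before lie in other columns. *)
Lemma chain_grad_step i j (jQ : (j < Q)%N) (Y : tensor_field R D j.+1) (x : V) :
  (i + j.+1 = p)%N -> (i + l < m)%N -> young_field N Y ->
  closed_in (@young_col N _) (j %% m)%N (U jQ Y) ->
  n%:R *: chain_grad (ltnW jQ) (ctr Y) x =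
  (n + i)%:R *: chain_grad jQ Y x + euler_field (chain_grad jQ Y) x.
Proof.
move=> e il hY cY; have [sY _] := hY; set z := Ordinal jQ.
have jp : (j < p)%N by lia.
have pj : (p <= j + m)%N by lia.
have zE := modn_last N2 jp pj.
have zl : (l <= col z)%N by rewrite /young_col /= zE; lia.
have sU := smooth_left_grad jQ sY.
have dE : chain_grad (ltnW jQ) (ctr Y) x =
    A (dcells (free_cells j.+1) (dcells [:: z] (iota_cell z (U jQ Y))) x).
  rewrite /chain_grad (left_grad_ctr N2 lm) // -dcells_cat; congr (A (_ x)).
  by apply: dcells_perm_eq; [exact: smooth_iota_cell|exact: free_cellsS].
have cE := card_col n N2 lm zl (ltn_pmod j m0).
have := @homotopy_column R D Q nat (@young_col N Q) z (free_cells j.+1) (U jQ Y) x sU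
  (fun y => left_grad_alt N2 lm y jp pj zl hY) cY.
rewrite cE (size_free_cells e) dE; apply=> c; rewrite mem_free_cells => /andP[jc cp].
by rewrite /young_col /=; apply: modn_neq_small => //; lia.
Qed.

End Chain.

Section ChainInduction.
Variables (R : realType) (N D l n : nat).
Hypothesis N2 : (2 <= N)%N.
Hypothesis lm : (l < N.-1)%N.
Local Notation m := N.-1.
Local Notation p := (m * n.+1)%N.
Local Notation Q := (l + m * n.+1)%N.
Variables (X : tensor_field R D Q) (K : R).
Hypothesis sX : smooth_field X.

(* After [i] contractions of a lift of [X], the gradient along all new and free cells is [X] up
   to the inverses of Euler operators that are still to be removed. *)
Definition chain_inv i := exists j (le : (j <= Q)%N) (Y : tensor_field R D j),
  [/\ (i + j = p)%N, contracted N p Y,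
    (forall c, (l <= c)%N -> (c + i < m)%N -> closed_in (@young_col N Q) c (left_grad le Y)) &
    forall x, chain_grad le Y x = (K / n.+1%:R ^+ i) *: op_field (euler_inv (n + i) (m - l - i)) X x].

(** One contraction applies Euler plus [n.+1 + i], which removes the outermost ray integral of
    [euler_inv (n + i)], and divides by the height [n.+1]. The columns left of the contracted cell
    stay closed. *)
Lemma chain_invS i : (i < m - l)%N -> chain_inv i -> chain_inv i.+1.
Proof.
(* Degree 0 is excluded: fewer than [m] cells have been contracted so far, and the rectangle has at
   least [m]. *)
move=> il [[|j] [le [Y [e cY closY BY]]]]; first by exfalso; have := leq_addr (m * n) m; rewrite -mulnS -e addn0; lia.
have jQ : (j < Q)%N := le; rewrite (bool_irrelevance le jQ) in closY BY *.
have jp : (j < p)%N by lia.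
have pj : (p <= j + m)%N by lia.
have zE := modn_last N2 jp pj.
have [hY _] := cY; have [sY _] := hY.
have zl : (l <= young_col N (Ordinal jQ))%N by rewrite /young_col /= zE; lia.
have sU := smooth_left_grad jQ sY.
exists j, (ltnW jQ), (ctr Y); split.
- by rewrite -e addSnnS.
- exact: contracted_ctr.
- move=> c lc ci; rewrite (left_grad_ctr N2 lm) //.
  have cz : (c < young_col N (Ordinal jQ))%N by rewrite /young_col /= zE; lia.
  apply: closed_in_iota_cell => //.
  + by rewrite gtn_eqF.
  + by move=> x; exact: left_grad_garnir.
  + by apply: closY => //; lia.
move=> x; have n0 : n.+1%:R != 0 :> R by rewrite pnatr_eq0.
apply: (scalerI n0); rewrite (chain_grad_step N2 lm x e) //; last 2 first.
- by lia.
- by apply: closY => //; rewrite zE; lia.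
have -> : chain_grad jQ Y = fun x => (K / n.+1%:R ^+ i) *: op_field (euler_inv (n + i) (m - l - i)) X x.
  by apply/funext => y; exact: BY.
have -> : (m - l - i = (m - l - i.+1).+1)%N by lia.
apply/ffunP => f; rewrite [LHS]ffunE.
set F := euler_inv (n + i) _; set g := fun y => X y f.
have sg : smooth g by exact: sX.
have -> : euler_field (fun y => (K / n.+1%:R ^+ i) *: op_field F X y) x f =
    (K / n.+1%:R ^+ i) * euler (F g) x.
  rewrite ffunE /euler mulr_sumr; apply: eq_bigr => a _; rewrite mulrCA; congr (_ * _).
  have -> : (fun y => ((K / n.+1%:R ^+ i) *: op_field F X y) f) = fun y => (K / n.+1%:R ^+ i) * F g y.
    by apply/funext => y; rewrite !ffunE.
  by rewrite partialZ //; exact: smooth_euler_inv.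
rewrite !ffunE -/g addnS -(euler_euler_inv (n + i) (m - l - i.+1) x sg) -/F.
rewrite addSn; move: (F g x) (euler (F g) x) => u v.
rewrite -![_ *: _]/(_ * _) exprS.
have := expf_neq0 i n0; move: (n.+1%:R ^+ i : R) (n.+1%:R : R) ((n + i).+1%:R : R) n0 => w w1 w2 w10 w0.
by field; rewrite w0.
Qed.

(** All Euler inverses are used up. The full antisymmetrization absorbs the one over the left
    columns, and contracted and new cells together are the cells from [j] on. *)
Lemma chain_end : chain_inv 0 -> exists j (le : (j <= Q)%N) (S : tensor_field R D j),
  [/\ (m - l + j = p)%N, young_field N S &
    forall x, stab_proj (@young_col N Q) true (igrad le S x) =
      (K / n.+1%:R ^+ (m - l) / #|stab (@left_lab N l n.+1)|%:R) *: X x].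
Proof.
move=> h0; have H i : (i <= m - l)%N -> chain_inv i.
  by elim: i => // i IH hi; apply: chain_invS => //; apply: IH; exact: ltnW.
have [j [le [S [e [hS _] _ BS]]]] := H _ (leqnn _).
have [sS _] := hS.
exists j, le, S; split=> // x; have := BS x; rewrite subnn /=.
have -> : op_field (euler_inv (n + (m - l)) 0) X x = X x by apply/ffunP => f; rewrite ffunE.
have c0 := card_stab_neq0 R (@left_lab N l n.+1).
move=> h; apply: (scalerI c0); rewrite scalerA mulrCA mulfV // mulr1 -h /chain_grad /left_grad.
rewrite -stab_proj_dcells; last 2 first.
- by apply: smooth_dcells; exact: smooth_ext.
- move=> s c hs; rewrite mem_free_cells => /andP[jc cp]; apply: left_stab_fix hs _.
  rewrite /young_col leqNgt; apply/negP => hc.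
  have := modn_last N2 cp; lia.
rewrite -dcells_cat stab_proj_absorb; last exact: left_lab_col.
congr (_ *: stab_proj _ _ (_ x)); apply: dcells_perm_eq; first exact: smooth_ext.
apply: uniq_perm; first exact: cells_from_uniq.
  rewrite cat_uniq free_cells_uniq cells_from_uniq andbT /=; apply/hasPn => c.
  by rewrite /= mem_cells_from mem_free_cells; lia.
move=> c; rewrite mem_cat mem_cells_from mem_free_cells mem_cells_from; lia.
Qed.

End ChainInduction.

(** * Closedness of the antisymmetrized gradient *)

Section ClosedStart.
Variables (R : realType) (N D : nat).
Hypothesis N2 : (2 <= N)%N.
Local Notation P s T := (permute_indices s T).
Local Notation m := N.-1.
Local Notation A := (stab_proj (@young_col N _) true).

Lemma grad_rcons_ix q (Z : tensor_field R D q) f a x :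
  grad Z x (rcons_ix f a) = partial a (fun y => Z y f) x.
Proof.
rewrite ffunE rcons_ix_max; congr (partial a _ x); apply/funext => y; congr (Z y _).
by apply/ffunP => i; rewrite ffunE rcons_ix_widen.
Qed.

(** By [stab_proj_grad], the antisymmetrized gradient is an alternating sum over the column of the
    added cell, that is, the exterior derivative in this column. *)
Lemma closed_of_grad q (G : tensor_field R D q) : smooth_field G ->
  (forall x, A (grad G x) = 0) -> closed_in (@young_col N q) (q %% m)%N (fun y => A (G y)).
Proof.
move=> sG h a f x.
have [k k0 hk] := @stab_proj_grad R nat q (@young_col N q.+1) (@young_col N q) true (fun=> erefl).
have := hk D G x sG; rewrite h => /esym /eqP; rewrite scaler_eq0 (negbTE k0) /= => /eqP.
move/(congr1 (fun T : tensor R D q.+1 => T (rcons_ix f a))); rewrite sum_ffunE ffunE.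
rewrite big_mkcond big_ord_recr /= -big_mkcond /= !eqxx /= expr0 scale1r.
rewrite tperm1 permute_indices1 grad_rcons_ix addrC => /eqP; rewrite addr_eq0 => /eqP ->.
rewrite -sumrN; apply: eq_bigr => b _.
have bm : widen_ord (leqnSn q) b != ord_max.
  by apply/eqP => e; have := congr1 val e => /= e'; have := ltn_ord b; rewrite e' ltnn.
rewrite bm /= expr1 scaleN1r ffunE opprK permE_ix tpermC reindex_max_rcons_ix -upd_rcons_ix.
by rewrite grad_rcons_ix.
Qed.

(** The columns from [l] on keep height [n] when [e <= l] cells are added to the rectangle; the
    cases [e = l] and [e = 0] are the degrees of the gradient and of the field itself. *)
Lemma swap_bound n l c e (i : nat) : (e <= l)%N -> (l <= c)%N -> (c < m)%N ->
  (i < e + m * n)%N -> (i %/ m * m + swapn l c (i %% m) < e + m * n)%N.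
Proof.
move=> el lc cm iq; have hi := divn_eq i m.
have small : (l <= i %% m)%N -> (i %/ m < n)%N.
  move=> h; rewrite ltnNge; apply/negP => ni.
  have : (n * m <= i %/ m * m)%N by rewrite leq_mul2r ni orbT.
  by rewrite [(n * m)%N]mulnC; lia.
have fin s : (s < m)%N -> (i %/ m < n)%N -> (i %/ m * m + s < e + m * n)%N.
  move=> sm hn; apply: (@leq_trans ((i %/ m).+1 * m)); first by rewrite mulSnr ltn_add2l.
  by apply: leq_trans (leq_addl _ _); rewrite mulnC leq_mul2l hn orbT.
rewrite /swapn; case: eqP => [il|_]; first by apply: fin => //; apply: small; rewrite il.
case: eqP => [ic|_]; last by rewrite -hi.
apply: fin; last by apply: small; rewrite ic.
exact: leq_ltn_trans cm.
Qed.

(** [T] is proportional to its column antisymmetrized row symmetrization; the antisymmetrization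
    commutes with [t], and the row symmetrization absorbs it. *)
Lemma young_colswap_inv q c1 c2 (t : 'S_q) (T : tensor R D q) : garnir N T ->
  (forall i, young_row N (t i) = young_row N i) ->
  (forall i, young_col N (t i) = swapn c1 c2 (young_col N i)) -> P t T = T.
Proof.
move=> gT hr hc; have [k k0 hk] := @young_idempotent R N q.
apply: (scalerI k0); rewrite -linearZ /= -hk // !col_antisymE.
rewrite -(stab_proj_normal true _ hc); last exact: inv_inj (swapnK _ _).
rewrite row_symE perm_stab_proj ?scale1r //; exact/stabP.
Qed.

Lemma closed_swap q c1 c2 (t : 'S_q) (X : tensor_field R D q) :
  (forall i, young_col N (t i) = swapn c1 c2 (young_col N i)) ->
  (forall x, P t (X x) = X x) ->
  closed_in (@young_col N q) c1 X -> closed_in (@young_col N q) c2 X.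
Proof.
move=> tc tX cX a f x.
have E g : (fun y => X y g) = fun y => X y (reindex_by t g).
  by apply/funext => y; rewrite -[in LHS]tX permE_ix.
rewrite E cX [RHS](reindex_inj (@perm_inj _ t)) /=; apply: eq_big => [i|i _].
  rewrite tc -{2}(swapnK c1 c2 c2) (inj_eq (inv_inj (swapnK _ _))).
  by rewrite {1}/swapn eqxx; case: (c2 == c1) / eqP => [->|_]; rewrite ?eqxx.
by rewrite ffunE upd_reindex -E.
Qed.

Variables (l n : nat).
Hypothesis lm : (l < m)%N.
Local Notation p := (m * n)%N.
Local Notation Q := (l + m * n)%N.
Local Notation le0 := (leq_addl l (m * n)).

Lemma closed_columns (T : tensor_field R D p) c : young_field N T -> diter N l.+1 T = 0 ->
  (l <= c)%N -> (c < m)%N -> closed_in (@young_col N Q) c (fun x => A (igrad le0 T x)).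
Proof.
move=> hT dT lc cm; have [sT gT] := hT.
have le1 : (p <= l.+1 + p)%N by exact: leq_addl.
have [k k0 hk] := @diter_rect R N N2 D n l.+1 le1 lm.
have cl : closed_in (@young_col N Q) l (fun x => A (igrad le0 T x)).
  have lE : (Q %% m = l)%N by rewrite addnC mulnC modnMDl modn_small.
  suff : closed_in (@young_col N Q) (Q %% m)%N (fun x => A (igrad le0 T x)) by rewrite lE.
  apply: closed_of_grad; first exact: smooth_igrad.
  move=> x; rewrite -(igrad_step le1 le0 sT); apply: (scalerI k0).
  by have := hk T x hT; rewrite dT scaler0 => <-.
have [t tr tc] := colswap_exists lm cm (fun i => @swap_bound n l c l i (leqnn _) lc cm).
(* On the cells of the rectangle, [t] acts as [t'], which leaves [T] invariant. *)
have [t' t'r t'c] := colswap_exists lm cm (fun i => @swap_bound n l c 0 i (leq0n _) lc cm).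
apply: (closed_swap tc) cl => x.
rewrite -(stab_proj_normal true _ tc); last exact: inv_inj (swapnK _ _).
congr (A _); rewrite (@igrad_perm_fix _ _ _ _ le0 t t') //; last first.
  move=> i; apply: val_inj; rewrite [LHS](divn_eq _ m) tr tc /=.
  by rewrite [RHS](divn_eq _ m) t'r t'c.
congr (igrad _ _ x); apply/funext => y; exact: (young_colswap_inv (gT y) t'r t'c).
Qed.

End ClosedStart.

Lemma size_cells_from j k : size (cells_from j (k + j)) = k.
Proof.
rewrite size_filter -(count_map _ (leq j)) val_enum_ord addnC iotaD count_cat.
have -> : count (leq j) (iota 0 j) = 0%N.
  by apply/eqP; rewrite -leqn0 leqNgt -has_count; apply/hasPn => i; rewrite mem_iota -ltnNge.
by apply/eqP; rewrite add0n -[X in _ == X](size_iota j) -all_count; apply/allP => i; rewrite mem_iota => /andP[].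
Qed.

(** * The primitive for one induction step *)

Section LiftStep.
Variables (R : realType) (N D l n : nat).
Hypothesis N2 : (2 <= N)%N.
Hypothesis lm : (l < N.-1)%N.
Local Notation m := N.-1.
Local Notation p := (m * n.+1)%N.
Local Notation Q := (l + m * n.+1)%N.
Local Notation le0 := (leq_addl l (m * n.+1)).
Local Notation A := (stab_proj (@young_col N _) true).
Local Notation AL := (stab_proj (@left_lab N l n.+1) true).

(** The field [S] has the degree from which [m - l] differentials lead back to that of [T]; it
    provides the correction in the induction on [l]. *)
Lemma lift_step (T : tensor_field R D p) : young_field N T -> diter N l.+1 T = 0 ->
  exists j (le : (j <= Q)%N) (S : tensor_field R D j), [/\ (m - l + j = p)%N, young_field N S &
    exists2 k : R, k != 0 & forall x, A (igrad le S x) = k *: A (igrad le0 T x)].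
Proof.
move=> hT dT; have [sT gT] := hT.
(* The [m - l] inverses in [E] compensate the Euler operators produced by as many contractions. *)
pose E := @euler_inv R D n (m - l); pose G := grad_lift l E.
have smE f : smooth f -> smooth (E f) by exact: smooth_euler_inv.
have clE f a b : smooth f -> partial b (E (partial a f)) = partial a (E (partial b f)).
  by exact: closed_euler_inv.
have linE : linear_on_smooth E by exact: linear_euler_inv.
have smG f : smooth f -> smooth (G f) by exact: smooth_grad_lift.
have linG : linear_on_smooth G by exact: linear_grad_lift.
pose W := op_field G T.
have hW : young_field N W by exact: young_field_op.
have [sW gW] := hW.
have igW : igrad le0 W = op_field E (igrad le0 T).
  apply/funext => x; apply/ffunP => f; rewrite !ffunE.
  have -> : (fun y => ext le0 W y f) = G (fun y => T y (restrict_ix le0 f)).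
    by apply/funext => y; rewrite !ffunE.
  rewrite foldr_partial_grad_lift //; last by rewrite size_map size_cells_from.
  congr (E _ x); apply/funext => y; rewrite ffunE.
  by congr (foldr _ _ _ y); apply/funext => u; rewrite ffunE.
pose X x := A (igrad le0 T x).
have sI := smooth_igrad le0 sT.
have sX : smooth_field X by exact: smooth_stab_proj.
have XW x : A (igrad le0 W x) = op_field E X x.
  by rewrite igW stab_proj_op_field.
pose h : R := #|stab (@left_lab N l n.+1)|%:R.
have h0 : h != 0 by exact: card_stab_neq0.
have c0 := card_stab_neq0 R (@young_col N Q).
have AAL x : A (AL (igrad le0 W x)) = h *: op_field E X x.
  by rewrite stab_proj_absorb ?XW //; exact: left_lab_col.
(* The columns left of [l] alternate by [AL], the others because all their cells belong to [W]. *)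
have alt x : A (AL (igrad le0 W x)) = #|stab (@young_col N Q)|%:R *: AL (igrad le0 W x).
  apply: stab_proj_inv; apply: stab_inv_tperm => a b ab hab; rewrite expr1 scaleN1r.
  have [al|la] := ltnP (young_col N a) l.
    rewrite perm_stab_proj; last by apply: stab_tperm; rewrite /left_lab -hab al.
    by rewrite stab_sgn_tperm // expr1 scaleN1r.
  have ap := col_old N2 lm la; have bp : (b < p)%N by apply: (col_old N2 lm); rewrite -hab.
  have ea : a = widen_ord le0 (Ordinal ap) by exact: val_inj.
  have eb : b = widen_ord le0 (Ordinal bp) by exact: val_inj.
  have ab' : Ordinal ap != Ordinal bp by apply: contra_neq ab => /(congr1 val) /= ?; exact: val_inj.
  rewrite -[AL _]/(left_grad le0 W x) ea eb left_grad_tperm //; last first.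
    by rewrite /young_col /= -[(b %% m)%N]hab.
  rewrite -scaleN1r -left_gradZ //; congr (left_grad le0 _ x); apply/funext => y.
  by have [hg _] := gW y; rewrite scaleN1r hg.
have UW : left_grad le0 W = fun x => (#|stab (@young_col N Q)|%:R^-1 * h) *: op_field E X x.
  apply/funext => x; apply: (scalerI c0); rewrite scalerA mulrA mulfV // mul1r -AAL.
  by rewrite alt.
(* Nothing is contracted yet; the constant [h] comes from the absorption of [AL]. *)
have inv0 : @chain_inv R N D l n X h 0.
  exists p, le0, W; split=> //.
  - by split=> // y x g; rewrite subnn addn0 leqNgt ltn_mod (leq_ltn_trans (leq0n l) lm).
  - move=> c lc cm; rewrite addn0 in cm; rewrite UW; apply: closed_inZ.
      exact: smooth_op_field.
    apply: closed_in_euler_inv => //.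
    exact: (closed_columns N2 lm hT dT lc cm).
  - move=> x; rewrite expr0 divr1 addn0 subn0 /chain_grad (free_cells_nil _ N2 lm) dcells_nil.
    exact: AAL.
have [j [le [S [e hS BS]]]] := chain_end N2 lm sX inv0.
exists j, le, S; split=> //; exists (h / n.+1%:R ^+ (m - l) / h); last exact: BS.
by rewrite !mulf_neq0 // invr_neq0 // expf_neq0 // pnatr_eq0.
Qed.

End LiftStep.

(** * Exactness *)

Section Boundaries.
Variables (R : realType) (N D : nat).

(** Coboundaries with the number of differentials as a parameter [r] in place of [N - k], so that it
    can vary in the induction. *)
Definition dim_image r p (T : tensor_field R D p) := T = 0 \/ exists (q : nat) (e : (r + q = p)%N),
  exists2 S : tensor_field R D q, Omega N S & T = ecast i (tensor_field R D i) e (diter N r S).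

Lemma young_field0 p : young_field N (0 : tensor_field R D p).
Proof.
split=> [f|x].
  rewrite (_ : (fun x => _) = fun x => 0); first exact: smooth_cst.
  by apply/funext => x; rewrite ffunE.
split=> [a b _ _|c y _]; first by rewrite linear0 oppr0.
by rewrite big1 // => i _; rewrite linear0.
Qed.

Lemma diter0 i p : diter N i (0 : tensor_field R D p) = 0.
Proof.
have := diter_lin i (-1) (young_field0 p) (young_field0 p).
have -> : (fun x => -1 *: (0 : tensor_field R D p) x + (0 : tensor_field R D p) x) = 0.
  by apply/funext => x; rewrite scaleN1r addNr.
by move=> ->; apply/funext => x; rewrite scaleN1r addNr.
Qed.

Lemma d_ecast a b (e : a = b) (e' : a.+1 = b.+1) (T : tensor_field R D a) :
  d N (ecast i (tensor_field R D i) e T) = ecast i (tensor_field R D i) e' (d N T).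
Proof. by case: _ / e in e' *; rewrite (eq_irrelevance e' erefl). Qed.

Lemma diter_d r q (S : tensor_field R D q) :
  diter N r.+1 S = ecast i (tensor_field R D i) (addnS r q) (diter N r (d N S)).
Proof.
elim: r => [|r IH]; first by rewrite (eq_irrelevance (addnS 0 q) erefl).
rewrite [LHS]/(d N (diter N r.+1 S)) IH; exact: d_ecast.
Qed.

Lemma dim_imageS r p (T : tensor_field R D p) : dim_image r.+1 T -> dim_image r T.
Proof.
move=> [->|[q [e [S hS ->]]]]; first by left.
right; exists q.+1, (etrans (addnS r q) e), (d N S).
  by apply/OmegaP; apply: young_field_d; have [] := hS.
by clear T; rewrite diter_d; case: p / e.
Qed.

Lemma dim_image_lin r p c (T U : tensor_field R D p) : dim_image r T -> dim_image r U ->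
  dim_image r (fun x => c *: T x + U x).
Proof.
move=> [->|[q [e [S hS ->]]]] hU.
  rewrite (_ : (fun x => _) = U) //.
  by apply/funext => x; rewrite scaler0 add0r.
right; exists q, e; case: hU => [->|[q' [e' [S' hS' ->]]]].
  exists (fun x => c *: S x + 0).
    apply/OmegaP; apply: (young_field_lin c (U := 0)) (young_field0 q).
    exact/OmegaP.
  rewrite (diter_lin r c (U := 0)); [|exact/OmegaP|exact: young_field0].
  by clear T U; rewrite diter0; case: p / e.
have qq : q' = q by apply: (@addnI r); rewrite e e'.
subst q'; rewrite (eq_irrelevance e' e); exists (fun x => c *: S x + S' x).
  by apply/OmegaP; apply: young_field_lin; exact/OmegaP.
rewrite diter_lin; [|exact/OmegaP..].
by clear T U e'; case: p / e.
Qed.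

End Boundaries.

Section Exactness.
Variables (R : realType) (N D n : nat).
Hypothesis N2 : (2 <= N)%N.
Local Notation m := N.-1.
Local Notation p := (m * n.+1)%N.

Lemma young_field_ecast a b (e : a = b) (T : tensor_field R D a) :
  young_field N T -> young_field N (ecast i (tensor_field R D i) e T).
Proof. by case: b / e. Qed.

Lemma young_op_igrad_ecast r j q b (e : (r + j = b)%N) (le : (j <= q)%N) (le0 : (b <= q)%N)
    (S : tensor_field R D j) : (q <= j + m)%N -> young_field N S ->
  exists2 c : R, c != 0 & forall x,
    young_op N (igrad le0 (ecast i (tensor_field R D i) e (diter N r S)) x) =
    c *: young_op N (igrad le S x).
Proof.
case: b / e le0 => le0 hq hS; have [c c0 hc] := young_op_igrad_diter R N2 D le0 le hq.
by exists c => // x; exact: hc.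
Qed.

Lemma dim_image_exact k (T : tensor_field R D p) : (k <= m)%N -> young_field N T ->
  diter N k T = 0 -> dim_image N (N - k) T.
Proof.
elim: k T => [|l IH] T lm hT dT; first by left.
have [j [le [S [e hS [k k0 hk]]]]] := lift_step N2 lm hT dT.
have E : (N - l.+1 = m - l)%N by lia.
have E' : (N - l = (m - l).+1)%N by lia.
rewrite E; pose T' := ecast i (tensor_field R D i) e (diter N (m - l) S).
have hT' : young_field N T'.
  exact: young_field_ecast (young_field_diter _ hS).
have le0 : (p <= l + p)%N by exact: leq_addl.
have [c1 c10 hc1] : exists2 c : R, c != 0 & forall x,
    young_op N (igrad le0 T' x) = c *: young_op N (igrad le S x).
  have hq : (l + p <= j + m)%N by rewrite -e; lia.
  exact: young_op_igrad_ecast.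
have [c2 c20 hc2] := young_op_rect R N2 le0 (ltnW lm).
have [c3 c30 hc3] := diter_rect R N2 D le0 (ltnW lm).
(* Under [young_op] the differentials leading from [S] to [T'] count as plain derivatives, so [T']
   is compared with [T] through the gradient of [S]. *)
have key x : diter N l T' x = (c1 * k) *: diter N l T x.
  rewrite !hc3 // scalerA [_ * c3]mulrC -scalerA; congr (_ *: _).
  apply: (scalerI c20); rewrite -hc2 // hc1 /young_op.
  have -> : col_antisym N (igrad le S x) = k *: col_antisym N (igrad le0 T x).
    by rewrite (bool_irrelevance le0 (leq_addl l p)); exact: hk.
  by rewrite row_symZ col_antisymZ -[col_antisym N (row_sym N _)]/(young_op N _) hc2 // !scalerA mulrC.
have c1k : c1 * k != 0 by rewrite mulf_neq0.
pose U x := - (c1 * k)^-1 *: T' x + T x.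
have hU : young_field N U by exact: young_field_lin.
have dU : diter N l U = 0.
  rewrite diter_lin //; apply/funext => x.
  by rewrite key scalerA mulNr mulVf // scaleN1r addNr.
(* By induction [U] is even an image under one more differential; [dim_imageS] brings it to the same
   power as [T']. *)
have := IH U (ltnW lm) hU dU; rewrite E' => /dim_imageS iU.
have iT' : dim_image N (m - l) T' by right; exists j, e, S => //; exact/OmegaP.
have := dim_image_lin (c1 * k)^-1 iT' iU.
rewrite (_ : (fun x => _) = T) //; apply/funext => x.
by rewrite /U addrA scaleNr subrr add0r.
Qed.

End Exactness.

Local Open Scope classical_set_scope.

(** * Cohomology in degree zero *)

Section Degree0.
Variables (R : realType) (N D : nat).
Hypothesis N2 : (2 <= N)%N.
Local Notation m := N.-1.
Local Notation V := 'rV[R]_D.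

Lemma diter_rect_eq q n k (e : (m * n = q)%N) (le : (q <= k + q)%N) : (k <= m)%N ->
  exists2 c : R, c != 0 & forall (T : tensor_field R D q) x, young_field N T ->
  diter N k T x = c *: col_antisym N (igrad le T x).
Proof. by case: q / e le => le km; exact: diter_rect. Qed.

Lemma young_field_degree0 (T : tensor_field R D 0) : smooth_field T -> young_field N T.
Proof. by move=> sT; split=> // x; split=> [[]|c []]. Qed.

(** As [k <= m], all cells lie in the first row; each column has at most one cell, and
    antisymmetrization is a scalar. *)
Lemma diter_degree0 k (le : (0 <= k + 0)%N) : (k <= m)%N ->
  exists2 c : R, c != 0 & forall (T : tensor_field R D 0) x, smooth_field T ->
  diter N k T x = c *: igrad le T x.
Proof.
move=> km; have [c c0 hc] := diter_rect_eq (muln0 m) le km.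
exists (c * #|col_stab N (k + 0)|%:R) => [|T x sT].
  by rewrite mulf_neq0 // card_col_stab_neq0.
rewrite hc; last exact: young_field_degree0.
rewrite -scalerA; congr (_ *: _); apply: col_alternatingP => a b ab.
have small (i : 'I_(k + 0)) : (i < m)%N.
  by apply: leq_trans (ltn_ord i) _; rewrite addn0.
rewrite /young_col !modn_small // => h.
by case/eqP: ab; exact: val_inj.
Qed.

Lemma scalar_fieldE f (g : multi_index D 0) : (fun x => scalar_field f x g) = f :> (V -> R).
Proof. by apply/funext => x; rewrite ffunE. Qed.

Lemma scalar_fieldP (T : tensor_field R D 0) : exists f, T = scalar_field f.
Proof.
exists (fun x => T x (ffun0 (card_ord 0))).
by apply/funext => x; apply/ffunP => g; rewrite ffunE; congr (T x _); apply/ffunP => -[].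
Qed.

Lemma cocycle_degree0 k f : (0 < k <= m)%N ->
  cocycles N k (scalar_field f) <-> poly_fun_lt R D k f.
Proof.
move=> /andP[k0 km]; have le : (0 <= k + 0)%N by [].
have [c c0 hc] := diter_degree0 le km.
have sE : smooth_field (scalar_field f) <-> smooth f.
  split=> [h|h g]; last by rewrite scalar_fieldE.
  by have := h (ffun0 (card_ord 0)); rewrite scalar_fieldE.
have iE x g : igrad le (scalar_field f) x g =
    foldr (@partial R D) f [seq g i | i <- cells_from 0 (k + 0)] x.
  rewrite ffunE; congr (foldr _ _ _ x); apply/funext => y; by rewrite !ffunE.
have cE : cells_from 0 (k + 0) = enum 'I_(k + 0) by exact: filter_predT.
split=> [[/OmegaP [sT _] dT]|hf].
  apply: flat_poly_fun; split=> [|s hs]; first exact/sE.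
  (* A sequence of [k] directions is read as a multi-index; the corresponding component of the
     gradient is the derivative along [s]. *)
  have hs' : size s == (k + 0)%N by rewrite addn0 hs.
  apply/funext => x; have : igrad le (scalar_field f) x [ffun i => tnth (Tuple hs') i] = 0.
    have := hc (scalar_field f) x sT; rewrite dT => /esym/eqP.
    by rewrite scaler_eq0 (negbTE c0) /= => /eqP ->; rewrite ffunE.
  by rewrite iE cE (eq_map (ffunE _)) map_tnth_enum.
have [sf hz] := poly_fun_flat hf; have sT : smooth_field (scalar_field f) by apply/sE.
split; first by apply/OmegaP; exact: young_field_degree0.
apply/funext => x; rewrite hc //; apply/ffunP => g; rewrite ffunE iE hz ?scaler0 ?ffunE //.
by rewrite size_map size_cells_from.
Qed.

Lemma coboundaries_degree0 k (T : tensor_field R D 0) : (k <= m)%N -> coboundaries N k T -> T = 0.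
Proof. by move=> km [//|[q [e]]]; exfalso; lia. Qed.

Lemma coh_class_self k p (T : tensor_field R D p) : coh_class N k T T.
Proof. by exists 0; [left|rewrite addr0]. Qed.

Lemma coh_class_eq0 k p (T : tensor_field R D p) : coboundaries N k T ->
  coh_class N k T = coh_class N k 0.
Proof.
move=> hT; apply/seteqP; split=> [_ [B hB <-]|_ [B hB <-]].
  exists (fun x => 1 *: T x + B x); first exact: dim_image_lin.
  by apply/funext => x; rewrite add0r scale1r.
exists (fun x => -1 *: T x + B x); first exact: dim_image_lin.
rewrite add0r; apply/funext => x.
have E : T x + (-1 *: T x + B x) = B x by rewrite scaleN1r addrA subrr add0r.
exact: E.
Qed.

End Degree0.

Theorem theorem1 (R : realType) (N D : nat) (hN : (2 <= N)%N) (hD : (1 <= D)%N)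
    (k : nat) (hk : (1 <= k <= N.-1)%N) :
  (forall n : nat, (1 <= n)%N ->
     cohomology R N D k (N.-1 * n) =
       [set coh_class N k (0 : tensor_field R D (N.-1 * n))]) /\
  set_bij (poly_fun_lt R D k) (cohomology R N D k 0)
    (fun f => coh_class N k (scalar_field f)).
Proof.
have [k0 km] := andP hk; split=> [[//|n] _|].
  apply/seteqP; split=> [_ [T [oT dT] <-]|_ ->].
    by apply: coh_class_eq0; apply: (dim_image_exact hN) => //; exact/OmegaP.
  exists 0 => //; split; last exact: diter0.
  by apply/OmegaP; exact: young_field0.
split=> [f hf|f g _ _ efg|_ [T hT <-]].
- by exists (scalar_field f) => //; apply/(cocycle_degree0 hN).
(* In degree 0 the only coboundary is 0, so equal classes have equal representatives. *)
- have : coh_class N k (scalar_field g) (scalar_field f) by rewrite -efg; exact: coh_class_self.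
  move=> [B /(coboundaries_degree0 hN km) ->]; rewrite addr0 => e.
  by rewrite -(scalar_fieldE f (ffun0 (card_ord 0))) -e scalar_fieldE.
- have [f fE] := scalar_fieldP T; exists f; last by rewrite -fE.
  by apply/(cocycle_degree0 hN) => //; rewrite -fE.
Qed.
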